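(* For $b>0$ let $Y_b$ be a random variable with density \[ f_{Y_b}(t) = \frac{e^{-|t|}}{2(1-e^{-b})}\,\mathbf{1}_{[-b,b]}(t), \] and let $\mathcal{S}$ be the set of all nonzero real symmetric log-concave random variables. (a) For every $t_0\in[0,\sqrt3]$, \[ \inf_{X\in\mathcal{S}} \sigma_X f_X(t_0\sigma_X) = \inf_{b>0} \sigma_{Y_b} f_{Y_b}(t_0\sigma_{Y_b}). \] (b) For $t_0\in[0,\sqrt3]$, the equalities \[ \inf_{X\in\mathcal{S}} \sigma_X f_X(t_0\sigma_X) = \lim_{b\to\infty} \sigma_{Y_b} f_{Y_b}(t_0\sigma_{Y_b}) = \frac{1}{\sqrt2}\,e^{-t_0\sqrt2} \] hold if and only if $t_0\in[\tfrac{1}{\sqrt2},\sqrt3]$. In this case the infimum is achieved for the Laplace distribution. (c) There is a constant $c_0$ with $\tfrac12 < c_0 < \tfrac{1}{\sqrt2}$ such that, for $t_0\in[0,\sqrt3]$, the equalities \[ \inf_{X\in\mathcal{S}} \sigma_X f_X(t_0\sigma_X) = \lim_{b\to 0^+} \sigma_{Y_b} f_{Y_b}(t_0\sigma_{Y_b}) = \frac{1}{2\sqrt3} \] hold if and only if $t_0\in[0,c_0]$. In this case the infimum is achieved for the uniform distribution (on a symmetric interval). The constant $c_0$ is given by \[ c_0 = \inf_{b>0}\ \frac{1}{\sigma(b)} \log\left(\frac{\sqrt3\,\sigma(b)}{1-e^{-b}}\right), \qquad \text{where } \sigma(b)>0,\ \ \sigma(b)^2 = 2 - \frac{e^{-b}b(b+2)}{1-e^{-b}},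 \] and its numerical value is $c_0\approx 0.63217$.
   Context: A real random variable $X$ is log-concave with density $f_X$ if $f_X=e^{-V}$ for some convex function $V:\mathbb{R}\to\mathbb{R}\cup\{\infty\}$; it is symmetric if $X$ and $-X$ have the same distribution. $\mathcal{S}$ is the set of all nonzero real symmetric log-concave random variables; each such $X$ has a unique upper-semicontinuous log-concave density, and $f_X$ always denotes this upper-semicontinuous density (its only possible discontinuities are at the two boundary points of the support). $\sigma_X$ denotes the standard deviation of $X$, i.e. $\sigma_X^2$ is the variance of $X$. The Laplace distribution is the one with density $\tfrac12 e^{-|t|}$ on $\mathbb{R}$ (up to scaling; the quantity $\sigma_X f_X(t_0\sigma_X)$ is invariant under $X\mapsto\lambda X$, $\lambda>0$). $\mathbf{1}_E$ denotes the indicator function of a set $E$. *)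

(* Defs.v *)
From HB Require Import structures.
From mathcomp Require Import all_boot all_order all_algebra.
From mathcomp Require Import all_classical all_reals all_analysis.

Set Implicit Arguments.
Unset Strict Implicit.
Unset Printing Implicit Defensive.

Import Order.TTheory GRing.Theory Num.Theory.
Import numFieldNormedType.Exports.

Local Open Scope classical_set_scope.
Local Open Scope ring_scope.

Section log_concave_functions.
Context {R : realType}.

Definition ereal_convex (V : R -> \bar R) : Prop :=
  (forall x, V x != -oo%E) /\
  forall x y t : R, 0 <= t -> t <= 1 ->
    (V (t * x + (1 - t) * y)%R <= t%:E * V x + (1 - t)%:E * V y)%E.

Definition log_concave (f : R -> R) : Prop :=
  exists V : R -> \bar R,
    ereal_convex V /\ forall x, (f x)%:E = expeR (- V x)%E.

Definition upper_semicontinuous (f : R -> R) : Prop :=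
  lower_semicontinuous (fun x => (- f x)%:E).

End log_concave_functions.

Section random_variables.
Context {R : realType} {d : measure_display} {T : measurableType d}.
Variable P : probability T R.

Definition has_density (X : {RV P >-> R}) (f : R -> R) : Prop :=
  [/\ measurable_fun setT f, forall x, 0 <= f x &
      forall A, measurable A ->
        distribution P X A = (\int[lebesgue_measure]_(x in A) (f x)%:E)%E].

Definition symmetric_rv (X : {RV P >-> R}) : Prop :=
  forall A : set R, measurable A ->
    distribution P X A = pushforward P (\- X) A.

(* [symmetric_log_concave X f]: X is in the class S and f is f_X. An upper
   semicontinuous log-concave density of X is unique as a function on R, so
   evaluating f at a single point is meaningful. *)
Definition symmetric_log_concave (X : {RV P >-> R}) (f : R -> R) : Prop :=
  [/\ ~ {ae P, forall w, X w = 0}, symmetric_rv X, has_density X f,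
      log_concave f & upper_semicontinuous f].

(* The variance of a log-concave random variable is finite, so that [fine]
   does not lose information. *)
Definition stddev (X : {RV P >-> R}) : R := Num.sqrt (fine 'V_P[X]).

Definition scaled_density (X : {RV P >-> R}) (f : R -> R) (t0 : R) : R :=
  stddev X * f (t0 * stddev X).

End random_variables.

Section extremal_problem.
Context {R : realType}.

(* The values sigma_X f_X(t0 sigma_X), X ranging over the class S. This set is
   nonempty and bounded below by 0, so [inf] below is a genuine infimum. *)
Definition slc_values (t0 : R) : set R :=
  [set v | exists (d : measure_display) (T : measurableType d)
      (P : probability T R) (X : {RV P >-> R}) (f : R -> R),
    symmetric_log_concave X f /\ v = scaled_density X f t0].

Definition slc_inf (t0 : R) : R := inf (slc_values t0).

Definition slc_inf_achieved_by (f : R -> R) (t0 : R) : Prop :=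
  exists (d : measure_display) (T : measurableType d)
      (P : probability T R) (X : {RV P >-> R}),
    symmetric_log_concave X f /\ scaled_density X f t0 = slc_inf t0.

Definition trunc_laplace_pdf (b t : R) : R :=
  expR (- `|t|) / (2 * (1 - expR (- b))) * \1_(`[- b, b]%classic) t.

Definition laplace_pdf (a t : R) : R := expR (- (`|t| / a)) / (2 * a).

(* The standard deviation of [trunc_laplace_pdf b] in closed form. *)
Definition trunc_laplace_sd (b : R) : R :=
  Num.sqrt (2 - expR (- b) * b * (b + 2) / (1 - expR (- b))).

End extremal_problem.

(* Main.v *)
(** Let [f] be an even log-concave density with standard deviation [sigma], put
    [x0 = t0 sigma], and let [s >= 0] be the slope of a supporting line of
    [- ln f] at [x0], so that [f x <= f x0 e^(- s (x - x0))] for [x >= 0]. If two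
    functions of equal mass on [0, +oo[ cross once, the one that is larger near
    [0] has the smaller second moment. When [s x0 <= 1], comparing [f] with a
    truncated exponential of rate [s] bounds [sigma f x0] below by a value of the
    family [Y_b]. When [s x0 > 1], comparing [f] with a function that is constant
    up to some [r] and then decays at rate [s] yields the Laplace value
    [e^(- t0 sqrt 2) / sqrt 2], the limit of the family as [b -> +oo]. The
    endpoint [t0 = sqrt 3], where [x0] may be the end of the support, follows by
    upper semicontinuity.

    The constant [c0] is the largest [t] such that
    [1 - e^-b <= sqrt 3 sigma(b) e^(- t sigma(b))] for all [b > 0]. The value
    [b = 17/4] bounds it above. For the bound below, small [b] is treated by a
    Taylor expansion; since both sides increase with [b], the remaining values are
    covered by finitely many cells, each requiring a single evaluation in
    fixed-point integer arithmetic. *)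

Require Import Defs.
From Stdlib Require Import ZArith.
From HB Require Import structures.
From mathcomp Require Import all_boot all_order all_algebra.
From mathcomp Require Import ssrZ zify ring lra.
From mathcomp Require Import all_classical all_reals all_analysis measurable_realfun.

Set Implicit Arguments.
Unset Strict Implicit.
Unset Printing Implicit Defensive.

Import Order.TTheory GRing.Theory Num.Theory.
Import numFieldNormedType.Exports.

Local Open Scope classical_set_scope.
Local Open Scope ring_scope.

(** * Taylor bounds for the exponential, and the one-variable inequality for plateaus *)

Section elementary.
Context {R : realType}.
Implicit Types x y b u t : R.

(** The threshold [s x0 = 1] has a simple origin. Put [u = s sigma]. The majorant of [f] is
    [c e^(- s x)] with equality at [x0], so [sigma f x0 = (c / s) u e^(- t0 u)], and [u e^(- t0 u)]
    increases until [t0 u = s x0] reaches 1 and decreases afterwards. A gentle slope therefore calls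
    for a lower bound on sigma, hence for a comparison function above [f] near 0; a steep slope
    calls for an upper bound, hence for one that starts below [f]. In both cases the mass is
    prescribed, which leaves one free parameter: the truncation point, or the end [r] of the
    plateau.

    The numerical work serves twice. The lower bound on [c0] also yields, for [b <= 13/2], the
    inequality behind the Laplace range of [t0]; beyond [13/2] that inequality follows from the size
    of [e^b]. *)

Lemma is_derive_ge0_nondecreasing (f f' : R -> R) a :
  (forall x, a <= x -> is_derive x 1 f (f' x)) ->
  (forall x, a <= x -> 0 <= f' x) ->
  forall x y, a <= x -> x <= y -> f x <= f y.
Proof.
move=> df f'0; apply: ger0_derive1_ndecry.
- by move=> x; rewrite in_itv/= andbT => /ltW /df[].
- move=> x; rewrite in_itv/= andbT => /ltW ax.
  by rewrite derive1E (@derive_val _ _ _ _ _ _ _ (df _ ax)) f'0.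
- apply: continuous_in_subspaceT => x; rewrite inE/= in_itv/= andbT => ax.
  by apply: differentiable_continuous; apply/derivable1_diffP; case: (df _ ax).
Qed.

Lemma is_derive_ge0 (f f' : R -> R) :
  (forall x, is_derive x 1 f (f' x)) -> f 0 = 0 ->
  (forall x, 0 <= x -> 0 <= f' x) -> forall x, 0 <= x -> 0 <= f x.
Proof.
move=> df f0 f'0 x x0; rewrite -f0.
by apply: (@is_derive_ge0_nondecreasing _ f' 0) => // z _; exact: df.
Qed.

Lemma is_derive_expRN x : is_derive x 1 (fun x => expR (- x)) (- expR (- x)).
Proof.
by apply: is_derive_eq; rewrite mulrN1.
Qed.

(** Each remainder vanishes at 0 and has the preceding one as its derivative, so signs propagate
    upward from [1 - e^-y >= 0]. *)
Lemma expRN_taylor x : 0 <= x ->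
  [/\ 1 - x + x ^+ 2 / 2 - x ^+ 3 / 6 <= expR (- x) &
      expR (- x) <= 1 - x + x ^+ 2 / 2 - x ^+ 3 / 6 + x ^+ 4 / 24].
Proof.
have H0 y : 0 <= y -> 0 <= 1 - expR (- y).
  by move=> y0; rewrite subr_ge0 expR_le1 oppr_le0.
have H1 : forall y, 0 <= y -> 0 <= expR (- y) - 1 + y.
  apply: (is_derive_ge0 _ _ H0).
  - move=> z; have ? := is_derive_expRN z; apply: is_derive_eq.
    by rewrite /GRing.scale/=; ring.
  - by rewrite oppr0 expR0; ring.
have H2 : forall y, 0 <= y -> 0 <= 1 - y + y ^+ 2 / 2 - expR (- y).
  apply: (is_derive_ge0 _ _ H1).
  - move=> z; have ? := is_derive_expRN z; apply: is_derive_eq.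
    by rewrite /GRing.scale/=; field.
  - by rewrite oppr0 expR0; ring.
have H3 : forall y, 0 <= y -> 0 <= expR (- y) - (1 - y + y ^+ 2 / 2 - y ^+ 3 / 6).
  apply: (is_derive_ge0 _ _ H2).
  - move=> z; have ? := is_derive_expRN z; apply: is_derive_eq.
    by rewrite /GRing.scale/=; field.
  - by rewrite oppr0 expR0; ring.
have H4 : forall y, 0 <= y ->
    0 <= 1 - y + y ^+ 2 / 2 - y ^+ 3 / 6 + y ^+ 4 / 24 - expR (- y).
  apply: (is_derive_ge0 _ _ H3).
  - move=> z; have ? := is_derive_expRN z; apply: is_derive_eq.
    by rewrite /GRing.scale/=; field.
  - by rewrite oppr0 expR0; ring.
by move=> x0; have := H3 _ x0; have := H4 _ x0; rewrite !subr_ge0.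
Qed.

Lemma expR_ge_taylor5 x : 0 <= x ->
  1 + x + x ^+ 2 / 2 + x ^+ 3 / 6 + x ^+ 4 / 24 + x ^+ 5 / 120 <= expR x.
Proof.
have H1 : forall y, 0 <= y -> 0 <= expR y - 1 - y.
  by move=> y _; have := expR_ge1Dx y; lra.
have H2 : forall y, 0 <= y -> 0 <= expR y - 1 - y - y ^+ 2 / 2.
  apply: (is_derive_ge0 _ _ H1).
  - by move=> z; apply: is_derive_eq; rewrite /GRing.scale/=; field.
  - by rewrite expR0; ring.
have H3 : forall y, 0 <= y -> 0 <= expR y - 1 - y - y ^+ 2 / 2 - y ^+ 3 / 6.
  apply: (is_derive_ge0 _ _ H2).
  - by move=> z; apply: is_derive_eq; rewrite /GRing.scale/=; field.
  - by rewrite expR0; ring.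
have H4 : forall y, 0 <= y ->
    0 <= expR y - 1 - y - y ^+ 2 / 2 - y ^+ 3 / 6 - y ^+ 4 / 24.
  apply: (is_derive_ge0 _ _ H3).
  - by move=> z; apply: is_derive_eq; rewrite /GRing.scale/=; field.
  - by rewrite expR0; ring.
have H5 : forall y, 0 <= y -> 0 <= expR y - 1 - y - y ^+ 2 / 2 - y ^+ 3 / 6
                        - y ^+ 4 / 24 - y ^+ 5 / 120.
  apply: (is_derive_ge0 _ _ H4).
  - by move=> z; apply: is_derive_eq; rewrite /GRing.scale/=; field.
  - by rewrite expR0; ring.
by move=> /H5; lra.
Qed.

(* With [A^2 = x^2 + 3 + 2/x], the derivative in [x] has the sign of
   [3x^5 + 4x^4 + 8x^3 + 12x^2 + 2x - 2]. *)
Lemma plateau_log_ineq x A : 1 <= x -> A = Num.sqrt (x ^+ 2 + 3 + 2 / x) ->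
  0 <= ln A - ln (Num.sqrt 6) - ln x + (x - 1) - (A - Num.sqrt 6).
Proof.
move=> x1 ->.
pose Q (z : R) := z ^+ 2 + 3 + 2 / z.
pose f (z : R) := ln (Num.sqrt (Q z)) - ln z + z - Num.sqrt (Q z).
suff : f 1 <= f x.
  rewrite /f ln1 /Q !(expr1n, divr1) (_ : 1 + 3 + 2 = 6 :> R); last by ring.
  by lra.
pose f' (z : R) := (2 * z - 2 / z ^+ 2) / (2 * Num.sqrt (Q z)) / Num.sqrt (Q z)
  - z^-1 + 1 - (2 * z - 2 / z ^+ 2) / (2 * Num.sqrt (Q z)).
have Q_gt0 z : 1 <= z -> 0 < Q z.
  move=> z1; have z0 : 0 < z by lra.
  by rewrite /Q !addr_gt0// ?exprn_gt0// divr_gt0.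
apply: (@is_derive_ge0_nondecreasing f f' 1) => // z z1.
- have z0 : 0 < z by lra.
  have zn0 : z != 0 by rewrite gt_eqF.
  have dV : is_derive z 1 (fun z => z^-1) (- z ^- 2 *: 1).
    exact: is_deriveV.
  have dQ : is_derive z 1 Q (2 * z - 2 / z ^+ 2).
    rewrite /Q; apply: is_derive_eq; rewrite /GRing.scale/=; field; exact: zn0.
  have Qz := Q_gt0 z z1.
  have dS : is_derive z 1 (fun z => Num.sqrt (Q z))
      ((2 * Num.sqrt (Q z))^-1 * (2 * z - 2 / z ^+ 2)).
    exact: is_derive1_comp (is_derive1_sqrt Qz) dQ.
  have S0 : 0 < Num.sqrt (Q z) by rewrite sqrtr_gt0.
  have dL : is_derive z 1 (fun z => ln (Num.sqrt (Q z)))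
      ((Num.sqrt (Q z))^-1 * ((2 * Num.sqrt (Q z))^-1 * (2 * z - 2 / z ^+ 2))).
    exact: (@is_derive1_comp R (@ln R) (fun z => Num.sqrt (Q z)) z _ _
      (is_derive1_ln S0) dS).
  have dl := is_derive1_ln z0.
  apply: is_derive_eq; rewrite /f'; field.
  by rewrite zn0 gt_eqF.
- have z0 : 0 < z by lra.
  have Qz := Q_gt0 z z1.
  rewrite /f'; set S := Num.sqrt (Q z).
  have S0 : 0 < S by rewrite sqrtr_gt0.
  have SS : S ^+ 2 = Q z by rewrite sqr_sqrtr// ltW.
  have zQ : z * Q z = z ^+ 3 + 3 * z + 2.
    by rewrite /Q; field; rewrite gt_eqF.
  (* The derivative factors as [(z - 1) (z S^2 - (S - 1) W) / (z S)^2]. Since [z S^2 + W = M], what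
     remains is [S W <= M], which is squared to remove the root. *)
  pose W := z ^+ 2 + z + 1; pose M := z ^+ 3 + z ^+ 2 + 4 * z + 3.
  have W0 : 0 < W by rewrite /W; nra.
  have M0 : 0 < M by rewrite /M !addr_gt0// ?exprn_gt0// mulr_gt0.
  have SWM : S * W <= M.
    rewrite -(@ler_pXn2r _ 2)// ?nnegrE ?mulr_ge0 ?(ltW S0) ?(ltW W0) ?(ltW M0)//.
    rewrite exprMn SS -subr_ge0 -(pmulr_rge0 _ z0).
    rewrite (_ : _ * _ = z * M ^+ 2 - (z * Q z) * W ^+ 2); last by ring.
    rewrite zQ (_ : _ - _ = 3 * z ^+ 5 + 4 * z ^+ 4 + 8 * z ^+ 3
       + 12 * z ^+ 2 + 2 * (z - 1)); last by rewrite /M /W; ring.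
    by rewrite !addr_ge0// ?mulr_ge0 ?exprn_ge0 ?subr_ge0 ?(ltW z0).
  rewrite (_ : _ + _ - _ = (z - 1) * (z * S ^+ 2 - (S - 1) * W) / (z ^+ 2 * S ^+ 2)); last first.
    by rewrite /W; field; rewrite !gt_eqF.
  rewrite divr_ge0 ?mulr_ge0 ?exprn_ge0 ?subr_ge0// ?(ltW z0)// ?(ltW S0)//.
  by rewrite SS zQ; rewrite /W /M in SWM *; lra.
Qed.
End elementary.

(** * The standard deviation of the truncated Laplace law *)

Section trunc_laplace.
Context {R : realType}.
Implicit Types x y b u t : R.

(** With [h = y - x] the claim is [x <= y e^-h], and [e^-h >= 1 - h] suffices because [y <= 1]. This
    lemma and the next are the two branches that distinguish gentle from steep slopes. *)
Lemma mulr_expRN_incr x y : 0 <= x -> x <= y -> y <= 1 ->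
  x * expR (- x) <= y * expR (- y).
Proof.
move=> x0 xy y1.
have -> : - x = (y - x) + - y by ring.
rewrite expRD mulrA ler_pM2r ?expR_gt0//.
have e1 : expR (- (y - x)) >= 1 - (y - x) by exact: expR_ge1Dx.
have e2 : expR (y - x) * expR (- (y - x)) = 1 by rewrite expRxMexpNx_1.
have e0 := expR_gt0 (- (y - x)).
rewrite -(ler_pM2r e0) -mulrA e2 mulr1.
apply: le_trans (ler_wpM2l _ e1); nra.
Qed.

Lemma mulr_expRN_decr x y : 1 <= x -> x <= y ->
  y * expR (- y) <= x * expR (- x).
Proof.
move=> x1 xy.
have -> : - x = (y - x) + - y by ring.
rewrite expRD mulrA ler_pM2r ?expR_gt0//.
have e1 : expR (y - x) >= 1 + (y - x) by exact: expR_ge1Dx.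
by apply: le_trans (ler_wpM2l _ e1); nra.
Qed.

Definition trunc_laplace_var b : R :=
  2 - expR (- b) * b * (b + 2) / (1 - expR (- b)).

Lemma expRN_itv b : 0 < b -> 0 < expR (- b) < 1.
Proof. by move=> b0; rewrite expR_gt0 expR_lt1 oppr_lt0 b0. Qed.

Lemma trunc_laplace_varE b : 0 < b ->
  trunc_laplace_var b = 2 - b * (b + 2) / (expR b - 1).
Proof.
move=> b0; rewrite /trunc_laplace_var expRN.
have e1 : 1 < expR b by rewrite expR_gt1.
by field; rewrite !gt_eqF// ?subr_gt0//; lra.
Qed.

(** The bound is the expansion of the variance at 0 through order 3. Replacing [e^b] by its Taylor
    polynomial of degree 5 leaves a difference with nonnegative coefficients only. *)
Lemma trunc_laplace_var_ge b : 0 < b ->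
  b ^+ 2 / 3 * (1 - b / 4) <= trunc_laplace_var b.
Proof.
move=> b0; rewrite trunc_laplace_varE//.
have e1 : 0 < expR b - 1 by rewrite subr_gt0 expR_gt1.
have e5 := expR_ge_taylor5 (ltW b0).
rewrite -subr_ge0 (_ : _ - _ =
  ((2 - b ^+ 2 / 3 * (1 - b / 4)) * (expR b - 1) - b * (b + 2)) / (expR b - 1));
  last by field; rewrite gt_eqF.
rewrite divr_ge0 ?(ltW e1)//.
have [w0|w0] := leP 0 (2 - b ^+ 2 / 3 * (1 - b / 4)).
  pose T := b + b ^+ 2 / 2 + b ^+ 3 / 6 + b ^+ 4 / 24 + b ^+ 5 / 120.
  have eT : T <= expR b - 1 by rewrite /T; lra.
  have := ler_wpM2l w0 eT.
  rewrite -subr_ge0 => h.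
  suff : 0 <= (2 - b ^+ 2 / 3 * (1 - b / 4)) * T - b * (b + 2) by lra.
  rewrite (_ : _ - _ = b ^+ 5 / 360 + b ^+ 7 / 1440 + b ^+ 8 / 1440); last first.
    by rewrite /T; field.
  have p k : 0 <= b ^+ k by rewrite exprn_ge0// ltW.
  by have := p 5%N; have := p 7%N; have := p 8%N; lra.
exfalso; suff : 0 < 2 - b ^+ 2 / 3 * (1 - b / 4) by lra.
rewrite (_ : _ - _ = (b ^+ 2 * (b - 4) + 24) / 12); last by field.
(* On the half-line [b^3 - 4 b^2] is smallest at [8/3], with value [- 256/27]. *)
have : (b - 8 / 3) ^+ 2 * (b + 4 / 3) >= 0.
  by apply: mulr_ge0; [exact: sqr_ge0|lra].
by move=> h; rewrite divr_gt0//; lra.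
Qed.

Lemma trunc_laplace_var_gt0 b : 0 < b -> 0 < trunc_laplace_var b.
Proof.
move=> b0; rewrite trunc_laplace_varE//.
have e1 : 0 < expR b - 1 by rewrite subr_gt0 expR_gt1.
have e5 := expR_ge_taylor5 (ltW b0).
rewrite (_ : _ - _ = (2 * (expR b - 1) - b * (b + 2)) / (expR b - 1));
  last by field; rewrite gt_eqF.
rewrite divr_gt0//.
have : 0 < b ^+ 3 / 3 + b ^+ 4 / 12 + b ^+ 5 / 60.
  by rewrite !addr_gt0 ?divr_gt0 ?exprn_gt0.
nra.
Qed.

Lemma trunc_laplace_var_lt2 b : 0 < b -> trunc_laplace_var b < 2.
Proof.
move=> b0; have /andP[u0 u1] := expRN_itv b0.
by rewrite /trunc_laplace_var ltrBlDr ltrDl divr_gt0 ?subr_gt0// !mulr_gt0//; lra.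
Qed.

(** Write [c = b + h]. After cross-multiplication [h] enters only through the quadratic [c (c + 2)]
    and through [e^h], so the quadratic minorant of [e^h] leaves [h (N + h N' / 2)], whose
    coefficients are nonnegative. *)
Lemma trunc_laplace_var_incr b c : 0 < b -> b <= c ->
  trunc_laplace_var b <= trunc_laplace_var c.
Proof.
move=> b0 bc; have c0 : 0 < c by lra.
rewrite !trunc_laplace_varE// lerD2l lerN2.
have b1 : 0 < expR b - 1 by rewrite subr_gt0 expR_gt1.
have c1 : 0 < expR c - 1 by rewrite subr_gt0 expR_gt1.
rewrite ler_pdivrMr// mulrAC ler_pdivlMr//.
pose h := c - b; have h0 : 0 <= h by rewrite subr_ge0.
have eh : 1 + h + h ^+ 2 / 2 <= expR h.
  have := expR_ge_taylor5 h0.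
  have : 0 <= h ^+ 3 / 6 + h ^+ 4 / 24 + h ^+ 5 / 120.
    by rewrite !addr_ge0 ?divr_ge0 ?exprn_ge0.
  lra.
have -> : expR c = expR b * expR h by rewrite -expRD /h; congr expR; ring.
have -> : c = b + h by rewrite /h; ring.
have [v1 _] := expRN_taylor (ltW b0).
have v0 := expR_ge1Dx (- b).
have eN := expRxMexpNx_1 b.
have ep := expR_gt0 b.
move: eh v1 v0 eN ep b1; move: (expR b) (expR h) (expR (- b)) => E H v.
move=> eh v1 v0 eN ep b1.
(* [N >= 0] and its derivative [N' >= 0], where [N = (b^2-2)e^b + 2b + 2] *)
have N'0 : 0 <= E * (b ^+ 2 + 2 * b - 2) + 2.
  rewrite (_ : _ + 2 = E * (b ^+ 2 + 2 * b - 2 + 2 * v)); last by nra.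
  by rewrite mulr_ge0 ?(ltW ep)//; nra.
have N0 : 0 <= E * (b ^+ 2 - 2) + 2 * b + 2.
  rewrite (_ : _ + 2 = E * (b ^+ 2 - 2 + (2 * b + 2) * v)); last first.
    by transitivity (E * (b ^+ 2 - 2) + (2 * b + 2) * (E * v)); [rewrite eN|]; ring.
  rewrite mulr_ge0 ?(ltW ep)//.
  have [b2|b2] := leP 2 b; first by nra.
  have : (2 * b + 2) * (1 - b + b ^+ 2 / 2 - b ^+ 3 / 6) <= (2 * b + 2) * v.
    by rewrite ler_wpM2l//; lra.
  have : 0 <= b ^+ 3 * (2 - b) by rewrite mulr_ge0 ?exprn_ge0//; lra.
  nra.
apply: (@le_trans _ _ (b * (b + 2) * (E * (1 + h + h ^+ 2 / 2) - 1))); last first.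
  rewrite ler_wpM2l ?mulr_ge0//; [lra..|].
  by rewrite lerD2r ler_wpM2l ?(ltW ep).
rewrite -subr_ge0.
rewrite (_ : _ - _ = h * ((E * (b ^+ 2 - 2) + 2 * b + 2)
   + h * (E * (b ^+ 2 + 2 * b - 2) + 2) / 2)); last by field.
by rewrite mulr_ge0// addr_ge0// divr_ge0// mulr_ge0.
Qed.

End trunc_laplace.

(** * The critical inequality and its proof for small [b] *)

Section numeric.
Context {R : realType}.
Implicit Types x y b u t : R.

Lemma mulr_expRN_incrM t x y : 0 < t -> 0 <= x -> x <= y -> t * y <= 1 ->
  x * expR (- (t * x)) <= y * expR (- (t * y)).
Proof.
move=> t0 x0 xy ty; rewrite -(ler_pM2l t0) !mulrA.
by apply: mulr_expRN_incr => //; [rewrite mulr_ge0// ltW|rewrite ler_pM2l].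
Qed.

Lemma ler_sqrtr x y : 0 <= x -> 0 <= y -> x ^+ 2 <= y -> x <= Num.sqrt y.
Proof. by move=> x0 y0; rewrite -{2}(ger0_norm x0) -sqrtr_sqr ler_sqrt. Qed.

Lemma sqrt3_ge : 1732 / 1000 <= Num.sqrt 3 :> R.
Proof.
by apply: ler_sqrtr; lra.
Qed.

Lemma trunc_laplace_sd_gt0 b : 0 < b -> 0 < trunc_laplace_sd b.
Proof. by move=> b0; rewrite sqrtr_gt0 trunc_laplace_var_gt0. Qed.

Lemma sqr_trunc_laplace_sd b : 0 < b ->
  trunc_laplace_sd b ^+ 2 = trunc_laplace_var b.
Proof. by move=> b0; rewrite sqr_sqrtr// ltW// trunc_laplace_var_gt0. Qed.

Lemma trunc_laplace_sd_lt b : 0 < b -> trunc_laplace_sd b < Num.sqrt 2.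
Proof. by move=> b0; rewrite ltr_sqrt// trunc_laplace_var_lt2. Qed.

(** [tau_lo] and [tau_hi] are 0.63217 minus and plus half a unit of its last digit. *)
Definition tau_lo : R := (632 * 10 ^+ 3 + 165) / 10 ^+ 6.
Definition tau_hi : R := (632 * 10 ^+ 3 + 175) / 10 ^+ 6.

(** As [7/10 < 1 / sqrt 2] and the standard deviation stays below [sqrt 2], such [t] keep it on the
    increasing branch of [r e^(- t r)]. A minorant of the standard deviation is then enough, as used
    in [sd_lower_boundP]. *)
Lemma tau_sd_le1 t b : 0 <= t -> t <= 7 / 10 -> 0 < b ->
  t * trunc_laplace_sd b <= 1.
Proof.
move=> t0 t1 b0; have h := sqr_trunc_laplace_sd b0.
have h2 := trunc_laplace_var_lt2 b0; have h3 := trunc_laplace_sd_gt0 b0.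
nra.
Qed.

(** This says that the value of [Y_b] at [t] is not below the uniform value [1 / (2 sqrt 3)]; see
    [trunc_laplace_value_uniform]. *)
Definition sd_lower_bound t b :=
  1 - expR (- b) <= Num.sqrt 3 * trunc_laplace_sd b * expR (- (t * trunc_laplace_sd b)).

Lemma sd_lower_boundP t b r : 0 < t -> t <= 7 / 10 -> 0 < b -> 0 <= r ->
  r <= trunc_laplace_sd b ->
  1 - expR (- b) <= Num.sqrt 3 * r * expR (- (t * r)) -> sd_lower_bound t b.
Proof.
move=> t0 t1 b0 r0 rb /le_trans; apply.
rewrite -!mulrA ler_wpM2l ?sqrtr_ge0//.
by apply: mulr_expRN_incrM => //; apply: tau_sd_le1 => //; exact: ltW.
Qed.

(** Both sides are equivalent to [b] at 0, so no finite set of cells reaches 0 and the second-order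
    terms have to decide. *)
Lemma sd_lower_bound_small b : 0 < b -> b <= 1 / 4 -> sd_lower_bound tau_lo b.
Proof.
move=> b0 b1; have s3 := sqrt3_ge.
have s30 : 0 < Num.sqrt 3 :> R by rewrite sqrtr_gt0.
(* [p / sqrt 3] is a polynomial minorant of the standard deviation: [33/256] slightly exceeds the
   [1/8] in the expansion of [sqrt (1 - b / 4)], which pays for the higher-order terms when
   [b <= 1/4]. *)
pose p := b * (1 - 33 / 256 * b).
have p0 : 0 <= p by rewrite /p; nra.
apply: (@sd_lower_boundP _ _ (p / Num.sqrt 3)) => //.
- by rewrite /tau_lo; lra.
- by rewrite /tau_lo; lra.
- by rewrite divr_ge0// ltW.
- rewrite -(@ler_pXn2r _ 2)// ?nnegrE ?divr_ge0 ?sqrtr_ge0// sqr_trunc_laplace_sd//.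
  apply: le_trans (trunc_laplace_var_ge b0).
  rewrite expr_div_n sqr_sqrtr// /p exprMn mulrAC ler_pM2l ?divr_gt0 ?exprn_gt0//.
  nra.
- have -> : Num.sqrt 3 * (p / Num.sqrt 3) = p by field; rewrite gt_eqF.
  (* [365/1000] is a rational just above [tau_lo / sqrt 3]. *)
  pose x := 365 / 1000 * p.
  have xp : tau_lo * (p / Num.sqrt 3) <= x.
    rewrite mulrA ler_pdivrMr// /x /tau_lo; nra.
  have x0 : 0 <= x by rewrite /x; nra.
  apply: (@le_trans _ _ (p * expR (- x))); last first.
    by rewrite ler_wpM2l// ler_expR lerN2.
  have [ex _] := expRN_taylor x0.
  apply: le_trans (ler_wpM2l p0 ex).
  have [eb _] := expRN_taylor (ltW b0).
  suff : b - b ^+ 2 / 2 + b ^+ 3 / 6 <=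
     p * (1 - x + x ^+ 2 / 2 - x ^+ 3 / 6) by lra.
  rewrite /x /p -subr_ge0.
  set P := (X in 0 <= X).
  have pk k : 0 <= b ^+ k by rewrite exprn_ge0// ltW.
  (* Comparing consecutive powers makes the polynomial inequality linear in them. *)
  have qk k : b ^+ k.+1 <= b ^+ k / 4 by rewrite exprS; have := pk k; nra.
  have := (pk 2, pk 3, pk 4, pk 5, pk 6, pk 7, pk 8)%N.
  have := (qk 2, qk 3, qk 4, qk 5, qk 6, qk 7)%N.
  rewrite /P => -[[[[[? ?] ?] ?] ?] ?] [[[[[[? ?] ?] ?] ?] ?] ?].
  lra.
Qed.

End numeric.

(** * Fixed-point bounds for the critical constant *)

Delimit Scope Z_scope with ZZ.

Section fixed_point_programs.
Local Open Scope Z_scope.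

(* The integer [z] stands for the real number [z / 2^44]. *)
Definition fxD : Z := Z.shiftl 1 44.
Definition fxmul_dn (a b : Z) : Z := Z.shiftr (a * b) 44.
Definition fxmul_up (a b : Z) : Z := - Z.shiftr (- (a * b)) 44.
(** The argument is divided by 64, with [z] rounded so as to keep the direction of the bound, a
    Taylor polynomial of [expRN_taylor] is evaluated over a common denominator, and six squarings
    undo the division. [Z.max 0] is there because rounding down a square preserves a lower bound
    only for a nonnegative base. *)
Definition fxexpN_dn (y : Z) : Z :=
  let z := - Z.shiftr (- y) 6 in
  iter 6 (fun q => fxmul_dn q q)
    (Z.max 0 (Z.shiftr ((6 * fxD * fxD * fxD - 6 * z * fxD * fxD
                         + 3 * z * z * fxD - z * z * z) / 6) 88)).
Definition fxexpN_up (y : Z) : Z :=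
  let z := Z.shiftr y 6 in
  iter 6 (fun q => fxmul_up q q)
    (- Z.shiftr (- (24 * fxD * fxD * fxD * fxD - 24 * z * fxD * fxD * fxD
                    + 12 * z * z * fxD * fxD - 4 * z * z * z * fxD
                    + z * z * z * z) / 24) 132).
Definition fxsqrt3_dn : Z := 17320508075 * fxD / 10 ^ 10.
Definition fxsqrt3_up : Z := 17320508076 * fxD / 10 ^ 10 + 1.
Definition fxtau_lo : Z := - (- (632165 * fxD) / 10 ^ 6).
Definition fxtau_hi : Z := 632175 * fxD / 10 ^ 6.

(** Integer division rounds toward minus infinity: the sign sits inside the dividend here, to bound
    from below, and outside the quotient in [fxvar_up], to bound from above. *)
Definition fxvar_dn (b hi : Z) : Z :=
  2 * fxD + - (b * (b + 2 * fxD) * hi) / (fxD * (fxD - hi)).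
Definition fxvar_up (b lo : Z) : Z :=
  2 * fxD - (b * (b + 2 * fxD) * lo) / (fxD * (fxD - lo)).

(* The state [(b, lo, hi)] records [lo <= e^-b <= hi]. *)
Definition fxcell (dlo dhi db : Z) (s : Z * Z * Z) : option (Z * Z * Z) :=
  let '(b, lo, hi) := s in
  let r := Z.sqrt (fxvar_dn b hi * fxD) in
  let lo' := fxmul_dn lo dlo in
  (* [lo'] bounds the exponential at the right end of the cell, whereas [r] bounds the standard
     deviation at the left end. *)
  if (hi <? fxD) && (fxD - lo' <=?
       fxmul_dn (fxmul_dn fxsqrt3_dn r) (fxexpN_dn (fxmul_up fxtau_lo r)))
  then Some (b + db, lo', fxmul_up hi dhi) else None.

Definition fxcells (db : Z) (n : nat) (s : option (Z * Z * Z)) :=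
  iter n (obind (fxcell (fxexpN_dn db) (fxexpN_up db) db)) s.

(* Pairs [(n, k)]: [n] cells of width [2^(k - 14)]. *)
Definition fxgrid : seq (nat * Z) :=
  [:: (156%nat, 3); (148%nat, 4); (112%nat, 5); (90%nat, 6); (88%nat, 7);
      (82%nat, 8); (71%nat, 7); (66%nat, 6); (80%nat, 5); (116%nat, 4);
      (217%nat, 3); (350%nat, 2); (191%nat, 3); (87%nat, 4); (52%nat, 5);
      (33%nat, 6); (21%nat, 7); (138%nat, 8)].

Definition fxinit (b : Z) : option (Z * Z * Z) :=
  Some (b, fxexpN_dn b, fxexpN_up b).

(** With 44 fractional bits, [2^(30 + k)] encodes the width [2^(k - 14)]. Started at [1/4], the
    sweep of [fxgrid] ends near 7; its finest cells lie around 4.2, where the inequality is almost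
    an equality. *)
Definition fxsweep (g : seq (nat * Z)) (s : option (Z * Z * Z)) :=
  foldl (fun s c => fxcells (Z.shiftl 1 (30 + c.2)) c.1 s) s g.

(** Beyond the last cell [1 - e^-x] is replaced by its supremum 1, so one test covers a whole
    half-line. *)
Definition fxlast (s : option (Z * Z * Z)) : bool :=
  if s is Some (b, lo, hi) then
    let r := Z.sqrt (fxvar_dn b hi * fxD) in
    (hi <? fxD) && (fxD <=?
       fxmul_dn (fxmul_dn fxsqrt3_dn r) (fxexpN_dn (fxmul_up fxtau_lo r)))
  else false.

(** All roundings go against the inequality to be shown; the [+ 1] turns the integer part of the
    square root into an upper bound. *)
Definition fxwitness_check : bool :=
  let b := 17 * fxD / 4 in
  let lo := fxexpN_dn b in
  let r := Z.sqrt (fxvar_up b lo * fxD) + 1 in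
  fxmul_up (fxmul_up fxsqrt3_up r) (fxexpN_up (fxmul_dn fxtau_hi r))
    <=? fxD - fxexpN_up b.

Lemma fxlast_run : fxlast (fxsweep fxgrid (fxinit (fxD / 4))) = true.
Proof. by vm_cast_no_check (erefl true). Qed.

Lemma fxwitness_checkT : fxwitness_check = true.
Proof. by vm_cast_no_check (erefl true). Qed.

End fixed_point_programs.

(** * Soundness of the fixed-point programs over the reals *)

Section fixed_point_soundness.
Context {R : realType}.
Implicit Types (a b c r y z lo hi : Z) (e x : R).

(* Locked: [int_of_Z] of a large integer must never be computed. *)
Definition Z2R (z : Z) : R := locked (fun z => (int_of_Z z)%:~R) z.

Lemma Z2RD a b : Z2R (a + b)%ZZ = Z2R a + Z2R b.
Proof. by rewrite /Z2R -!lock -intrD; congr (_%:~R); lia. Qed.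

Lemma Z2RM a b : Z2R (a * b)%ZZ = Z2R a * Z2R b.
Proof. by rewrite /Z2R -!lock -intrM; congr (_%:~R); lia. Qed.

Lemma Z2RN a : Z2R (- a)%ZZ = - Z2R a.
Proof. by rewrite /Z2R -!lock -mulrNz; congr (_%:~R); lia. Qed.

Lemma Z2RB a b : Z2R (a - b)%ZZ = Z2R a - Z2R b.
Proof. by rewrite /Z.sub Z2RD Z2RN. Qed.

Lemma ler_Z2R a b : (a <= b)%ZZ -> Z2R a <= Z2R b.
Proof. by move=> ab; rewrite /Z2R -!lock ler_int; lia. Qed.

Lemma Z2R0 : Z2R 0 = 0. Proof. by rewrite /Z2R -lock. Qed.

Lemma Z2R1 : Z2R 1 = 1. Proof. by rewrite /Z2R -lock. Qed.

Lemma Z2R_small n : Z2R (Z.of_nat n) = n%:R.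
Proof. by rewrite /Z2R -lock (_ : int_of_Z _ = n%:Z)//; lia. Qed.

Lemma fxD_pow : [/\ fxD = 2 ^ 44, fxD * fxD = 2 ^ 88
  & fxD * (fxD * fxD) = 2 ^ 132]%ZZ.
Proof. by []. Qed.

Definition fxval z : R := Z2R z / Z2R fxD.

Lemma Z2R_fxD_gt0 : 0 < Z2R fxD.
Proof.
by apply: (@lt_le_trans _ _ (Z2R 1)); [rewrite Z2R1|apply: ler_Z2R].
Qed.

Local Notation D := (Z2R fxD).

Lemma fxval_fxD : fxval fxD = 1.
Proof. by rewrite /fxval divff// gt_eqF// Z2R_fxD_gt0. Qed.

Lemma fxval0 : fxval 0 = 0. Proof. by rewrite /fxval Z2R0 mul0r. Qed.

Lemma fxvalD a b : fxval (a + b)%ZZ = fxval a + fxval b.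
Proof. by rewrite /fxval Z2RD mulrDl. Qed.

Lemma fxvalB a b : fxval (a - b)%ZZ = fxval a - fxval b.
Proof. by rewrite /fxval Z2RB mulrBl. Qed.

Lemma fxval_le a b : (a <= b)%ZZ -> fxval a <= fxval b.
Proof. by move=> ab; rewrite /fxval ler_pM2r ?invr_gt0 ?Z2R_fxD_gt0// ler_Z2R. Qed.

Lemma fxval_ge0 a : (0 <= a)%ZZ -> 0 <= fxval a.
Proof. by move=> a0; rewrite -fxval0 fxval_le. Qed.

Lemma fxmul_dn_ge0 a b : (0 <= a)%ZZ -> (0 <= b)%ZZ -> (0 <= fxmul_dn a b)%ZZ.
Proof. by move=> a0 b0; apply/Z.shiftr_nonneg; lia. Qed.

Lemma shiftr_le a n : (0 <=? n)%ZZ -> (Z.shiftr a n * 2 ^ n <= a)%ZZ.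
Proof. move=> /Z.leb_spec0 n0; rewrite Z.shiftr_div_pow2// Z.mul_comm.
by apply: Z.mul_div_le; exact: Z.pow_pos_nonneg. Qed.

(** Over the denominator [D * D] both a product and its rounded value are integers, and the rounding
    becomes a statement about [Z]. *)
Lemma fxval_divD c : fxval c = Z2R (c * fxD)%ZZ / (D * D).
Proof. by have := Z2R_fxD_gt0 => D0; rewrite /fxval Z2RM; field; rewrite gt_eqF. Qed.

Lemma fxvalM a b : fxval a * fxval b = Z2R (a * b)%ZZ / (D * D).
Proof. by have := Z2R_fxD_gt0 => D0; rewrite /fxval Z2RM; field; rewrite gt_eqF. Qed.

Lemma fxmul_dnP a b : fxval (fxmul_dn a b) <= fxval a * fxval b.
Proof.
rewrite fxvalM fxval_divD ler_pM2r ?invr_gt0 ?mulr_gt0 ?Z2R_fxD_gt0//.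
by apply: ler_Z2R; have [-> _ _] := fxD_pow; exact: shiftr_le.
Qed.

Lemma fxmul_upP a b : fxval a * fxval b <= fxval (fxmul_up a b).
Proof.
rewrite fxvalM fxval_divD ler_pM2r ?invr_gt0 ?mulr_gt0 ?Z2R_fxD_gt0//.
apply: ler_Z2R; have := @shiftr_le (- (a * b)) 44 isT.
by have [-> _ _] := fxD_pow; rewrite /fxmul_up; lia.
Qed.

Lemma iter_fxmul_dnP n p e : (0 <= p)%ZZ -> fxval p <= e ->
  fxval (iter n (fun q => fxmul_dn q q) p) <= e ^+ (2 ^ n).
Proof.
move=> p0 pe; elim: n p e p0 pe => [//|n IH] p e p0 pe.
rewrite iterSr expnS exprM; apply: IH; first exact: fxmul_dn_ge0.
by apply: le_trans (fxmul_dnP _ _) _; have := fxval_ge0 p0; rewrite expr2; nra.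
Qed.

Lemma iter_fxmul_dn_ge0 n p : (0 <= p)%ZZ ->
  (0 <= iter n (fun q => fxmul_dn q q) p)%ZZ.
Proof. by move=> p0; elim: n => [//|n IH]; apply: fxmul_dn_ge0. Qed.

Lemma iter_fxmul_upP n p e : 0 <= e -> e <= fxval p ->
  e ^+ (2 ^ n) <= fxval (iter n (fun q => fxmul_up q q) p).
Proof.
move=> e0 pe; elim: n p e e0 pe => [//|n IH] p e e0 pe.
rewrite iterSr expnS exprM; apply: IH; first exact: exprn_ge0.
by apply: le_trans (fxmul_upP _ _); rewrite expr2; nra.
Qed.

Lemma fxexpN_dn_ge0 y : (0 <= fxexpN_dn y)%ZZ.
Proof. by apply: iter_fxmul_dn_ge0; lia. Qed.

Lemma expRN_64 x : expR (- x) = expR (- (x / 64)) ^+ 64.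
Proof. by rewrite -expRM_natl; congr expR; field. Qed.

(** The denominator is a variable, so that the algebra never meets the large constant [fxD]. *)
Lemma Z2R_expN_dn (d w z : Z) : 0 < Z2R d ->
  (w * (6 * (d * d)) <=
     6 * d * d * d - 6 * z * d * d + 3 * z * z * d - z * z * z)%ZZ ->
  Z2R w / Z2R d <= 1 - Z2R z / Z2R d + (Z2R z / Z2R d) ^+ 2 / 2
    - (Z2R z / Z2R d) ^+ 3 / 6.
Proof.
move=> d0 /ler_Z2R; rewrite !(Z2RM, Z2RB, Z2RD) (Z2R_small 6) (Z2R_small 3).
rewrite -subr_ge0 => h; rewrite -subr_ge0.
move: h; set X := (X in 0 <= X -> _) => h.
rewrite (_ : _ - _ = X / (6 * Z2R d ^+ 3)).
  by rewrite divr_ge0// mulr_ge0// exprn_ge0// ltW.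
by rewrite /X; field; rewrite gt_eqF.
Qed.

Lemma Z2R_expN_up (d w z : Z) : 0 < Z2R d ->
  (24 * d * d * d * d - 24 * z * d * d * d + 12 * z * z * d * d
     - 4 * z * z * z * d + z * z * z * z <= w * (24 * (d * (d * d))))%ZZ ->
  1 - Z2R z / Z2R d + (Z2R z / Z2R d) ^+ 2 / 2 - (Z2R z / Z2R d) ^+ 3 / 6
    + (Z2R z / Z2R d) ^+ 4 / 24 <= Z2R w / Z2R d.
Proof.
move=> d0 /ler_Z2R; rewrite !(Z2RM, Z2RB, Z2RD) (Z2R_small 24) (Z2R_small 12)
  (Z2R_small 4).
rewrite -subr_ge0 => h; rewrite -subr_ge0.
move: h; set X := (X in 0 <= X -> _) => h.
rewrite (_ : _ - _ = X / (24 * Z2R d ^+ 4)).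
  by rewrite divr_ge0// mulr_ge0// exprn_ge0// ltW.
by rewrite /X; field; rewrite gt_eqF.
Qed.

Lemma fxexpN_dnP y : (0 <= y)%ZZ -> fxval (fxexpN_dn y) <= expR (- fxval y).
Proof.
move=> y0; rewrite expRN_64; have D0 := Z2R_fxD_gt0.
apply: (iter_fxmul_dnP 6); first lia.
set z := (- _)%ZZ.
have yz : (y <= z * 64)%ZZ by have := @shiftr_le (- y) 6 isT; rewrite /z; lia.
have yz' : fxval y / 64 <= fxval z.
  rewrite ler_pdivrMr// /fxval mulrAC ler_pM2r ?invr_gt0//.
  by have := ler_Z2R yz; rewrite Z2RM (Z2R_small 64).
have z0 : 0 <= fxval z by apply: fxval_ge0; lia.
set w := Z.shiftr _ _.
suff wz : fxval w <= expR (- fxval z).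
  apply: (@le_trans _ _ (expR (- fxval z))); last by rewrite ler_expR lerN2.
  have [w0|w0] := Z.max_spec 0 w; first by case: w0 => _ ->.
  by case: w0 => _ ->; rewrite fxval0 expR_ge0.
have [e1 _] := expRN_taylor z0; apply: le_trans e1.
set N := (6 * fxD * fxD * fxD - 6 * z * fxD * fxD + 3 * z * z * fxD - z * z * z)%ZZ in w *.
have wN : (w * (6 * (fxD * fxD)) <= N)%ZZ.
  have := @shiftr_le (N / 6)%ZZ 88 isT; rewrite -/w.
  have [_ <- _] := fxD_pow.
  by have := Z.mul_div_le N 6 erefl; lia.
exact: (Z2R_expN_dn D0 wN).
Qed.

Lemma fxexpN_upP y : (0 <= y)%ZZ -> expR (- fxval y) <= fxval (fxexpN_up y).
Proof.
move=> y0; rewrite expRN_64; have D0 := Z2R_fxD_gt0.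
apply: (iter_fxmul_upP 6); first exact: expR_ge0.
set z := Z.shiftr y 6.
have yz : (z * 64 <= y)%ZZ by exact: (@shiftr_le y 6).
have yz' : fxval z <= fxval y / 64.
  rewrite ler_pdivlMr// /fxval mulrAC ler_pM2r ?invr_gt0//.
  by have := ler_Z2R yz; rewrite Z2RM (Z2R_small 64).
have z0 : 0 <= fxval z by apply: fxval_ge0; apply/Z.shiftr_nonneg.
apply: (@le_trans _ _ (expR (- fxval z))); first by rewrite ler_expR lerN2.
have [_ e1] := expRN_taylor z0; apply: le_trans e1 _.
set N := (24 * fxD * fxD * fxD * fxD - 24 * z * fxD * fxD * fxD
  + 12 * z * z * fxD * fxD - 4 * z * z * z * fxD + z * z * z * z)%ZZ.
set w := (- _)%ZZ.
have wN : (N <= w * (24 * (fxD * (fxD * fxD))))%ZZ.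
  have := @shiftr_le ((- N) / 24)%ZZ 132 isT.
  have [_ _ <-] := fxD_pow.
  rewrite /w; set q := Z.shiftr _ _.
  by have := Z.mul_div_le (- N)%ZZ 24 erefl; lia.
exact: (Z2R_expN_up D0 wN).
Qed.

Lemma ltr_Z2R a b : (a < b)%ZZ -> Z2R a < Z2R b.
Proof.
move=> ab; apply: (@lt_le_trans _ _ (Z2R (a + 1)%ZZ)).
  by rewrite Z2RD Z2R1 ltrDl.
by apply: ler_Z2R; lia.
Qed.

(** The variance is [2 - b (b + 2) u / (1 - u)] with [u = e^-b], so bounds on the exponential enter
    it through the increasing map [u / (1 - u)]. *)
Lemma odds_le (u h d : R) : 0 < d -> h < d -> u <= h / d ->
  u / (1 - u) <= h / (d - h).
Proof.
move=> d0 hd uh; have v1 : h / d < 1 by rewrite ltr_pdivrMr// mul1r.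
have u1 : 0 < 1 - u by rewrite subr_gt0; exact: le_lt_trans uh _.
rewrite ler_pdivrMr// mulrAC ler_pdivlMr ?subr_gt0//.
by move: uh; rewrite ler_pdivlMr//; lra.
Qed.

Lemma odds_ge (u h d : R) : 0 < d -> h < d -> u < 1 -> h / d <= u ->
  h / (d - h) <= u / (1 - u).
Proof.
move=> d0 hd u1 uh.
rewrite ler_pdivrMr ?subr_gt0// mulrAC ler_pdivlMr ?subr_gt0//.
by move: uh; rewrite ler_pdivrMr//; lra.
Qed.

Lemma Z2R_var_dn (d b q hi : Z) (x u : R) : 0 < Z2R d -> (hi < d)%ZZ ->
  (q * (d * (d - hi)) <= - (b * (b + 2 * d) * hi))%ZZ ->
  0 <= x -> x = Z2R b / Z2R d -> 0 < u -> u <= Z2R hi / Z2R d ->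
  2 + Z2R q / Z2R d <= 2 - u * x * (x + 2) / (1 - u).
Proof.
move=> d0 hd /ler_Z2R; rewrite !(Z2RM, Z2RB, Z2RD, Z2RN) (Z2R_small 2).
move=> h x0 xE u0 uh.
have hd' := ltr_Z2R hd.
have v1 : Z2R hi / Z2R d < 1 by rewrite ltr_pdivrMr// mul1r.
rewrite lerD2l.
apply: (@le_trans _ _ (- (x * (x + 2) * (Z2R hi / (Z2R d - Z2R hi))))).
  rewrite ler_pdivrMr// -(@ler_pM2r _ (Z2R d * (Z2R d - Z2R hi))); last first.
    by rewrite mulr_gt0// subr_gt0.
  apply: le_trans h _; rewrite le_eqVlt; apply/orP; left; apply/eqP.
  have n1 : Z2R d != 0 by rewrite gt_eqF.
  have n2 : Z2R d - Z2R hi != 0 by rewrite gt_eqF// subr_gt0.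
  by rewrite xE; field; rewrite n1 n2.
have u1 : 0 < 1 - u by rewrite subr_gt0; exact: le_lt_trans uh _.
rewrite lerN2 (_ : u * x * (x + 2) / (1 - u) = x * (x + 2) * (u / (1 - u))).
  by rewrite ler_wpM2l ?mulr_ge0 ?addr_ge0//; exact: odds_le.
by field; rewrite gt_eqF.
Qed.

Lemma Z2R_var_up (d b q lo : Z) (x u : R) : 0 < Z2R d ->
  (lo < d)%ZZ ->
  (q * (d * (d - lo)) <= b * (b + 2 * d) * lo)%ZZ ->
  0 <= x -> x = Z2R b / Z2R d -> u < 1 -> Z2R lo / Z2R d <= u ->
  2 - u * x * (x + 2) / (1 - u) <= 2 - Z2R q / Z2R d.
Proof.
move=> d0 hd /ler_Z2R; rewrite !(Z2RM, Z2RB, Z2RD) (Z2R_small 2).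
move=> h x0 xE u1 uh.
have hd' := ltr_Z2R hd.
rewrite lerD2l lerN2.
apply: (@le_trans _ _ (x * (x + 2) * (Z2R lo / (Z2R d - Z2R lo)))).
  rewrite ler_pdivrMr// -(@ler_pM2r _ (Z2R d * (Z2R d - Z2R lo))); last first.
    by rewrite mulr_gt0// subr_gt0.
  apply: le_trans h _; rewrite le_eqVlt; apply/orP; left; apply/eqP.
  have n1 : Z2R d != 0 by rewrite gt_eqF.
  have n2 : Z2R d - Z2R lo != 0 by rewrite gt_eqF// subr_gt0.
  by rewrite xE; field; rewrite n1 n2.
rewrite (_ : u * x * (x + 2) / (1 - u) = x * (x + 2) * (u / (1 - u))).
  by rewrite ler_wpM2l ?mulr_ge0 ?addr_ge0//; exact: odds_ge.
by field; rewrite gt_eqF// subr_gt0.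
Qed.

Local Notation D0 := Z2R_fxD_gt0.

Lemma fxsqrt3P : fxval fxsqrt3_dn <= Num.sqrt 3 <= fxval fxsqrt3_up.
Proof.
have DD : 0 < (D * D)^-1 by rewrite invr_gt0 mulr_gt0 ?D0.
have E3 : 3 = Z2R (3 * (fxD * fxD))%ZZ / (D * D) :> R.
  rewrite (Z2RM 3) (Z2RM fxD) (Z2R_small 3) mulfK// gt_eqF//.
  by rewrite mulr_gt0 ?D0.
apply/andP; split.
  apply: ler_sqrtr; [by apply: fxval_ge0; exact/Z.leb_le|by []|].
  rewrite expr2 fxvalM E3 (ler_pM2r DD).
  by apply: ler_Z2R; exact/Z.leb_le.
have u0 : 0 <= fxval fxsqrt3_up by apply: fxval_ge0; exact/Z.leb_le.
rewrite -(ger0_norm u0) -sqrtr_sqr; apply: ler_wsqrtr.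
rewrite expr2 fxvalM E3 (ler_pM2r DD).
by apply: ler_Z2R; exact/Z.leb_le.
Qed.

Lemma fxtauP : tau_lo <= fxval fxtau_lo /\ fxval fxtau_hi <= tau_hi.
Proof.
have E c : (10 ^+ 6) * Z2R c = Z2R (10 * 10 * 10 * (10 * 10 * 10) * c)%ZZ :> R.
  by rewrite !Z2RM (Z2R_small 10); ring.
have E1 n : (632 * 10 ^+ 3 + n%:R) * D =
    Z2R ((632 * (10 * 10 * 10) + Z.of_nat n) * fxD)%ZZ :> R.
  rewrite [RHS]Z2RM; congr (_ * _).
  by rewrite !(Z2RM, Z2RD) Z2R_small (Z2R_small 10) (Z2R_small 632); ring.
split.
  rewrite /tau_lo ler_pdivrMr ?exprn_gt0// /fxval [leRHS]mulrC [leRHS]mulrA ler_pdivlMr ?D0//.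
  by rewrite E (E1 165%N); apply: ler_Z2R; exact/Z.leb_le.
rewrite /tau_hi ler_pdivlMr ?exprn_gt0// /fxval [leLHS]mulrC [leLHS]mulrA ler_pdivrMr ?D0//.
by rewrite E (E1 175%N); apply: ler_Z2R; exact/Z.leb_le.
Qed.

Definition fxbracket b lo hi :=
  [/\ 0 < fxval b, (0 <= lo)%ZZ & fxval lo <= expR (- fxval b) <= fxval hi].

Definition fxroot_dn b hi := Z.sqrt (fxvar_dn b hi * fxD).
Definition fxbound_dn r :=
  fxmul_dn (fxmul_dn fxsqrt3_dn r) (fxexpN_dn (fxmul_up fxtau_lo r)).

Lemma fxvar_dnP b lo hi : fxbracket b lo hi -> (hi < fxD)%ZZ ->
  fxval (fxvar_dn b hi) <= trunc_laplace_var (fxval b).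
Proof.
move=> [b0 lo0 /andP[el eh]] hD.
rewrite /fxvar_dn; set q := (_ / _)%ZZ.
have -> : fxval (2 * fxD + q)%ZZ = 2 + Z2R q / D.
  by rewrite fxvalD /fxval (Z2RM 2) (Z2R_small 2) mulfK// gt_eqF ?D0.
apply: (Z2R_var_dn (b := b) (hi := hi)) => //.
- exact: D0.
- have M0 : (0 < fxD * (fxD - hi))%ZZ by apply: Z.mul_pos_pos; [|lia].
  by rewrite Z.mul_comm; apply: Z.mul_div_le.
- exact: ltW.
- exact: expR_gt0.
Qed.

Lemma fxroot_dnP b lo hi : fxbracket b lo hi -> (hi < fxD)%ZZ ->
  0 <= fxval (fxroot_dn b hi) <= trunc_laplace_sd (fxval b).
Proof.
move=> br hD; have [b0 _ _] := br.
have r0 : 0 <= fxval (fxroot_dn b hi) by apply: fxval_ge0; exact: Z.sqrt_nonneg.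
(* [Z.sqrt] is 0 at negative integers, which is still a valid lower bound. *)
rewrite r0/=; have [n0|n0] := Z.leb_spec0 0 (fxvar_dn b hi * fxD)%ZZ; last first.
  rewrite /fxroot_dn Z.sqrt_neg ?fxval0 ?sqrtr_ge0//; lia.
apply: ler_sqrtr => //; first by rewrite ltW// trunc_laplace_var_gt0.
apply: le_trans (fxvar_dnP br hD).
rewrite expr2 fxvalM fxval_divD ler_pM2r ?invr_gt0 ?mulr_gt0 ?D0//.
by apply: ler_Z2R; case: (Z.sqrt_spec _ n0).
Qed.

Lemma fxbound_dnP r : (0 <= r)%ZZ ->
  fxval (fxbound_dn r) <=
  Num.sqrt 3 * fxval r * expR (- (tau_lo * fxval r)).
Proof.
move=> r0; have vr := (@fxval_ge0 _ r0).
have [s3 _] := andP fxsqrt3P; have [tau _] := fxtauP.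
have s0 : (0 <= fxsqrt3_dn)%ZZ by exact/Z.leb_le.
have t0 : (0 <= fxtau_lo)%ZZ by exact/Z.leb_le.
apply: (le_trans (fxmul_dnP _ _)); apply: ler_pM.
- exact: (@fxval_ge0 _ (fxmul_dn_ge0 s0 r0)).
- by apply: fxval_ge0; apply: fxexpN_dn_ge0.
- by apply: (le_trans (fxmul_dnP _ _)); rewrite ler_wpM2r.
- have mu := @fxmul_upP fxtau_lo r.
  have mu0 : (0 <= fxmul_up fxtau_lo r)%ZZ.
    rewrite /fxmul_up; have := @shiftr_le (- (fxtau_lo * r)) 44 isT.
    have := Z.mul_nonneg_nonneg _ _ t0 r0.
    lia.
  apply: (le_trans (fxexpN_dnP mu0)); rewrite ler_expR lerN2.
  by apply: le_trans mu; rewrite ler_wpM2r.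
Qed.

Lemma fxbracket_lower_bound b lo hi x : fxbracket b lo hi -> (hi < fxD)%ZZ ->
  fxval b <= x -> 1 - expR (- x) <= fxval (fxbound_dn (fxroot_dn b hi)) ->
  sd_lower_bound tau_lo x.
Proof.
move=> br hD bx h; have [b0 _ _] := br.
have x0 : 0 < x by exact: lt_le_trans bx.
have /andP[r0 rb] := fxroot_dnP br hD.
apply: (@sd_lower_boundP _ _ _ (fxval (fxroot_dn b hi))) => //.
- by rewrite /tau_lo; lra.
- by rewrite /tau_lo; lra.
- by apply: (le_trans rb); rewrite ler_wsqrtr// trunc_laplace_var_incr.
- by apply: (le_trans h); apply: fxbound_dnP; exact: Z.sqrt_nonneg.
Qed.

Lemma fxcellP dlo dhi db b lo hi b' lo' hi' :
  (0 <= db)%ZZ -> (0 <= dlo)%ZZ -> fxval dlo <= expR (- fxval db) <= fxval dhi ->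
  fxbracket b lo hi ->
  fxcell dlo dhi db (b, lo, hi) = Some (b', lo', hi') ->
  [/\ fxbracket b' lo' hi', fxval b <= fxval b' &
    forall x, fxval b <= x -> x <= fxval b' -> sd_lower_bound tau_lo x].
Proof.
move=> db0 dlo0 /andP[dl dh] br; have [b0 lo0 /andP[el eh]] := br.
rewrite /fxcell; case: ifP => // /andP[/Z.ltb_spec0 hD /Z.leb_spec0 hA] [<- <- <-].
have vdb := (@fxval_ge0 _ db0).
have vb' : fxval (b + db)%ZZ = fxval b + fxval db by rewrite fxvalD.
have lo'P : fxval (fxmul_dn lo dlo) <= expR (- fxval (b + db)%ZZ).
  apply: (le_trans (fxmul_dnP _ _)).
  by rewrite vb' opprD expRD ler_pM ?fxval_ge0.
split.
- split; [by rewrite vb' ltr_pwDl|exact: fxmul_dn_ge0|].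
  rewrite lo'P/= vb' opprD expRD; apply: le_trans (fxmul_upP _ _).
  by rewrite ler_pM ?expR_ge0.
- by rewrite vb' lerDl.
- move=> x bx xb'; apply: (fxbracket_lower_bound br hD bx).
  have := (@fxval_le _ _ hA); rewrite fxvalB fxval_fxD; apply: le_trans.
  rewrite lerD2l lerN2; apply: (le_trans lo'P).
  by rewrite ler_expR lerN2.
Qed.

(** A failed cell yields [None], for which nothing is claimed; [fxlast] rejects that state. *)
Definition fxcovered (x0 : R) (s : option (Z * Z * Z)) :=
  if s is Some (b, lo, hi) then
    [/\ fxbracket b lo hi, x0 <= fxval b &
      forall x, x0 <= x -> x <= fxval b -> sd_lower_bound tau_lo x]
  else True.

Lemma fxcell_covered x0 db s : (0 <= db)%ZZ -> fxcovered x0 s ->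
  fxcovered x0 (obind (fxcell (fxexpN_dn db) (fxexpN_up db) db) s).
Proof.
move=> db0; case: s => [[[b lo] hi]|] // [br bb ib].
change (fxcovered x0 (fxcell (fxexpN_dn db) (fxexpN_up db) db (b, lo, hi))).
case E : (fxcell _ _ _ _) => [[[b' lo'] hi']|]; last by [].
have e0 : fxval (fxexpN_dn db) <= expR (- fxval db) <= fxval (fxexpN_up db).
  by rewrite fxexpN_dnP// fxexpN_upP.
have [br' bb' h] := fxcellP db0 (@fxexpN_dn_ge0 _) e0 br E.
split => //; first exact: le_trans bb'.
move=> x bx xb; have [xb1|xb1] := leP x (fxval b); first exact: ib.
by apply: h => //; exact: ltW.
Qed.

Lemma fxcellsP x0 db n s : (0 <= db)%ZZ -> fxcovered x0 s ->
  fxcovered x0 (fxcells db n s).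
Proof.
move=> db0; rewrite /fxcells; elim: n => [//|n IH] cs; rewrite iterS.
by apply: fxcell_covered => //; exact: IH.
Qed.

Lemma fxgridP x0 g s : fxcovered x0 s ->
  fxcovered x0 (fxsweep g s).
Proof.
elim: g s => [//|c g IH] s cs; apply: IH; apply: fxcellsP => //.
exact/Z.shiftl_nonneg.
Qed.

Lemma fxinitP : fxcovered (1 / 4) (fxinit (fxD / 4)).
Proof.
have E : fxval (fxD / 4)%ZZ = 1 / 4.
  rewrite /fxval; have -> : D = Z2R (4 * (fxD / 4))%ZZ by [].
  have c0 : 0 < Z2R (fxD / 4)%ZZ.
    by rewrite -Z2R0; apply: ltr_Z2R; exact/Z.ltb_lt.
  rewrite (Z2RM 4) (Z2R_small 4); move: c0; move: (Z2R _) => c c0.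
  by field; rewrite gt_eqF.
have : (0 <= fxD / 4)%ZZ by exact/Z.leb_le.
move: (fxD / 4)%ZZ E => b bE b0; rewrite /fxinit /fxcovered bE; split => //.
- split; [by rewrite bE|exact: fxexpN_dn_ge0|].
  by rewrite fxexpN_dnP// fxexpN_upP.
- move=> x x1 x2; apply: sd_lower_bound_small => //; lra.
Qed.

Lemma sd_lower_bound_tau_lo x : 0 < x -> sd_lower_bound tau_lo x.
Proof.
move=> x0; have [x1|x1] := leP x (1 / 4); first exact: sd_lower_bound_small.
have := @fxgridP (1 / 4) fxgrid (fxinit (fxD / 4)) fxinitP.
move: fxlast_run; move: (fxsweep _ _) => [[[b lo] hi]|]; last by [].
rewrite /fxlast -/(fxroot_dn b hi) -/(fxbound_dn (fxroot_dn b hi)) /fxcovered.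
move=> /andP[/Z.ltb_spec0 hD /Z.leb_spec0 hA] [br bb h].
have [xb|xb] := leP x (fxval b); first by apply: h => //; exact: ltW.
apply: (fxbracket_lower_bound br hD (ltW xb)).
have := (@fxval_le _ _ hA); rewrite fxval_fxD; apply: le_trans.
by rewrite lerBlDr lerDl expR_ge0.
Qed.

Lemma fxvar_upP b lo : 0 < fxval b -> (lo < fxD)%ZZ ->
  fxval lo <= expR (- fxval b) ->
  trunc_laplace_var (fxval b) <= fxval (fxvar_up b lo).
Proof.
move=> b0 hlo lob; rewrite /fxvar_up; set q := (_ / _)%ZZ.
have -> : fxval (2 * fxD - q)%ZZ = 2 - Z2R q / D.
  by rewrite fxvalB /fxval (Z2RM 2) (Z2R_small 2) mulfK// gt_eqF ?D0.
apply: (Z2R_var_up (b := b) (lo := lo)) => //.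
- exact: D0.
- have M0 : (0 < fxD * (fxD - lo))%ZZ by apply: Z.mul_pos_pos; [|lia].
  by rewrite Z.mul_comm; apply: Z.mul_div_le.
- exact: ltW.
- by have /andP[] := expRN_itv b0.
Qed.

Definition fxroot_up b lo := (Z.sqrt (fxvar_up b lo * fxD) + 1)%ZZ.

Lemma fxroot_upP b lo : 0 < fxval b -> (lo < fxD)%ZZ ->
  fxval lo <= expR (- fxval b) -> (0 <= fxvar_up b lo * fxD)%ZZ ->
  trunc_laplace_sd (fxval b) <= fxval (fxroot_up b lo).
Proof.
move=> b0 hlo lob vv.
have r0 : 0 <= fxval (fxroot_up b lo).
  by apply: fxval_ge0; rewrite /fxroot_up; have := Z.sqrt_nonneg (fxvar_up b lo * fxD); lia.
rewrite /trunc_laplace_sd -(ger0_norm r0) -sqrtr_sqr; apply: ler_wsqrtr.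
apply: (le_trans (fxvar_upP b0 hlo lob)).
rewrite expr2 fxvalM fxval_divD ler_pM2r ?invr_gt0 ?mulr_gt0 ?D0//.
by apply: ler_Z2R; have [_] := Z.sqrt_spec _ vv; rewrite /fxroot_up; lia.
Qed.

Lemma fxbound_upP b r : 0 < fxval b -> (0 <= r)%ZZ -> (r * 5 <= 7 * fxD)%ZZ ->
  trunc_laplace_sd (fxval b) <= fxval r ->
  Num.sqrt 3 * trunc_laplace_sd (fxval b)
    * expR (- (tau_hi * trunc_laplace_sd (fxval b)))
  <= fxval (fxmul_up (fxmul_up fxsqrt3_up r) (fxexpN_up (fxmul_dn fxtau_hi r))).
Proof.
move=> b0 r0 r1 sr; have fr0 : 0 <= fxval r := @fxval_ge0 _ r0.
have [_ s3] := andP fxsqrt3P; have [_ tau] := fxtauP.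
(* An upper bound [r] on the standard deviation is usable only on the increasing branch; [r <= 7/5]
   ensures this. *)
have tr : tau_hi * fxval r <= 1.
  have : fxval r <= 7 / 5.
    rewrite /fxval ler_pdivrMr ?D0// mulrAC ler_pdivlMr//.
    by have := @ler_Z2R _ _ r1; rewrite (Z2RM r) (Z2RM 7) (Z2R_small 5) (Z2R_small 7).
  by rewrite /tau_hi; lra.
have tau0 : (0 <= fxtau_hi)%ZZ by exact/Z.leb_le.
apply: (@le_trans _ _ (Num.sqrt 3 * fxval r * expR (- (tau_hi * fxval r)))).
  rewrite -[leLHS]mulrA -[leRHS]mulrA ler_wpM2l ?sqrtr_ge0//.
  apply: mulr_expRN_incrM sr tr; first by rewrite /tau_hi; lra.
  by rewrite ltW// trunc_laplace_sd_gt0.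
apply: le_trans (fxmul_upP _ _); apply: ler_pM.
- by rewrite mulr_ge0// sqrtr_ge0.
- exact: expR_ge0.
- by apply: le_trans (fxmul_upP _ _); rewrite ler_wpM2r.
- apply: (le_trans _ (fxexpN_upP (fxmul_dn_ge0 tau0 r0))).
  rewrite ler_expR lerN2; apply: (le_trans (fxmul_dnP _ _)).
  by rewrite ler_wpM2r.
Qed.

Lemma sd_upper_witness :
  exists2 b : R, 0 < b &
    Num.sqrt 3 * trunc_laplace_sd b * expR (- (tau_hi * trunc_laplace_sd b))
    <= 1 - expR (- b).
Proof.
have bZ : (0 < 17 * fxD / 4)%ZZ by exact/Z.ltb_lt.
have hlo : (fxexpN_dn (17 * fxD / 4) < fxD)%ZZ by exact/Z.ltb_lt.
have vv : (0 <= fxvar_up (17 * fxD / 4) (fxexpN_dn (17 * fxD / 4)) * fxD)%ZZ.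
  exact/Z.leb_le.
have r0 : (0 <= fxroot_up (17 * fxD / 4) (fxexpN_dn (17 * fxD / 4)))%ZZ.
  exact/Z.leb_le.
have r1 : (fxroot_up (17 * fxD / 4) (fxexpN_dn (17 * fxD / 4)) * 5 <= 7 * fxD)%ZZ.
  exact/Z.leb_le.
have := fxwitness_checkT.
rewrite /fxwitness_check -/(fxroot_up (17 * fxD / 4) (fxexpN_dn (17 * fxD / 4))).
(* The closed integer becomes a variable, its needed properties having been computed beforehand. *)
move: (17 * fxD / 4)%ZZ bZ hlo vv r0 r1 => b bZ hlo vv r0 r1.
move=> /Z.leb_spec0 /(@fxval_le _ _); rewrite fxvalB fxval_fxD => h.
have b0 : 0 < fxval b by rewrite divr_gt0 ?D0// -Z2R0; exact: ltr_Z2R.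
have bN : (0 <= b)%ZZ by lia.
exists (fxval b) => //.
have k := fxbound_upP b0 r0 r1 (fxroot_upP b0 hlo (fxexpN_dnP bN) vv).
apply: le_trans k (le_trans h _).
by rewrite lerD2l lerN2; exact: fxexpN_upP.
Qed.

End fixed_point_soundness.

(** * Values of the truncated Laplace family *)

Section closed_form.
Context {R : realType}.
Implicit Types x y b t : R.

(** The quantity [sigma f (t sigma)] of [Y_b] without the indicator: for [t <= sqrt 3] the point
    [t sigma] belongs to the support, as [scaled_density_sym_exp_itv] shows. *)
Definition trunc_laplace_value t b : R :=
  trunc_laplace_sd b * expR (- (t * trunc_laplace_sd b)) / (2 * (1 - expR (- b))).
Local Notation G := trunc_laplace_value.

Lemma one_sub_expRN_gt0 b : 0 < b -> 0 < 1 - expR (- b).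
Proof. by move=> /expRN_itv /andP[_]; rewrite subr_gt0. Qed.

Lemma trunc_laplace_value_uniform t b : 0 < b ->
  (1 / (2 * Num.sqrt 3) <= G t b) = `[< sd_lower_bound t b >].
Proof.
move=> b0; have u0 := one_sub_expRN_gt0 b0.
have s3 : 0 < Num.sqrt 3 :> R by rewrite sqrtr_gt0.
rewrite asboolb /sd_lower_bound /G ler_pdivrMr ?mulr_gt0//.
rewrite mulrAC ler_pdivlMr ?mulr_gt0// mul1r.
rewrite (_ : _ * _ * (2 * _) = 2 * (Num.sqrt 3 * trunc_laplace_sd b *
  expR (- (t * trunc_laplace_sd b)))); last by ring.
by rewrite ler_pM2l.
Qed.

Lemma trunc_laplace_value_decr s t b : 0 < b -> s <= t -> G t b <= G s b.
Proof.
move=> b0 st; rewrite /G ler_pM2r ?invr_gt0 ?mulr_gt0 ?one_sub_expRN_gt0//.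
by rewrite ler_pM2l ?trunc_laplace_sd_gt0// ler_expR lerN2 ler_pM2r ?trunc_laplace_sd_gt0.
Qed.

Lemma sqrt2_itv : 1414 / 1000 < (Num.sqrt 2 : R) < 1415 / 1000.
Proof.
have s0 : 0 <= Num.sqrt 2 :> R by exact: sqrtr_ge0.
have : Num.sqrt 2 ^+ 2 = 2 :> R by exact: sqr_sqrtr.
by move=> h; apply/andP; split; nra.
Qed.

Lemma expRN_13_2 : 144 / 10 ^+ 5 <= expR (- (13 / 2)) :> R.
Proof.
have q0 : 0 <= 1 / 4 :> R by [].
have [q1 _] := expRN_taylor q0.
have -> : - (13 / 2) = 26%:R * (- (1 / 4)) :> R by field.
rewrite expRM_natl; move: q1; move: (expR _) => x q1.
have x1 : 7786 / 10 ^+ 4 <= x by apply: le_trans q1; lra.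
have x2 : 606 / 1000 <= x ^+ 2 by nra.
have x4 : 367 / 1000 <= x ^+ 4 by rewrite (exprM x 2 2); nra.
have x8 : 134 / 1000 <= x ^+ 8 by rewrite (exprM x 4 2); nra.
have x16 : 179 / 10 ^+ 4 <= x ^+ 16 by rewrite (exprM x 8 2); nra.
have x24 : 239 / 10 ^+ 5 <= x ^+ 24 by rewrite (exprD x 16 8); nra.
by rewrite (exprD x 24 2); nra.
Qed.

(** The bound at [tau_lo] reads [1 - e^-b <= sqrt 6 z e^(- tau_lo sqrt 2 z)], so it suffices that
    [ln (sqrt 6) <= 1 - (1 - tau_lo sqrt 2) z]. This holds for [z <= 98/100], and [b <= 13/2]
    guarantees that range. *)
Lemma sd_lower_bound_laplace_small b : 0 < b -> b <= 13 / 2 ->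
  1 - expR (- b) <= trunc_laplace_sd b / Num.sqrt 2
    * expR (1 - trunc_laplace_sd b / Num.sqrt 2).
Proof.
move=> b0 b1; have /andP[s2l s2u] := sqrt2_itv.
have s2 : 0 < Num.sqrt 2 :> R by rewrite sqrtr_gt0.
have s22 : Num.sqrt 2 * Num.sqrt 2 = 2 :> R by rewrite -expr2 sqr_sqrtr.
have sd0 := trunc_laplace_sd_gt0 b0.
have c0 : 0 < 13 / 2 :> R by [].
pose z := trunc_laplace_sd b / Num.sqrt 2.
have z0 : 0 < z by rewrite divr_gt0.
have sdE : trunc_laplace_sd b = Num.sqrt 2 * z.
  by rewrite /z mulrC divfK// gt_eqF.
have z1 : z <= 98 / 100.
  have : trunc_laplace_sd b ^+ 2 <= 2 * (98 / 100) ^+ 2.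
    rewrite sqr_trunc_laplace_sd//; apply: (le_trans (trunc_laplace_var_incr b0 b1)).
    rewrite /trunc_laplace_var; have e1 := expRN_13_2.
    have := one_sub_expRN_gt0 c0; move: e1; move: (expR _) => e e1 e2.
    have : 792 / 10 ^+ 4 <= e * (13 / 2) * (13 / 2 + 2) / (1 - e).
      by rewrite ler_pdivlMr//; lra.
    lra.
  rewrite sdE exprMn expr2 s22 ler_pM2l// => h.
  by rewrite -(@ler_pXn2r _ 2)// ?nnegrE ltW.
apply: (le_trans (sd_lower_bound_tau_lo b0)).
rewrite -/z sdE.
(* The number 0.896 lies just above [ln (sqrt 6)], and [w] just above the fourth root of 6; the
   exponent is halved to make the Taylor polynomial of degree 5 accurate enough. *)
have e6 : Num.sqrt 3 * Num.sqrt 2 <= expR (896 / 1000) :> R.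
  have h0 : 0 <= 448 / 1000 :> R by lra.
  rewrite -sqrtrM// -[leRHS]ger0_norm ?expR_ge0// -sqrtr_sqr ler_wsqrtr//.
  have -> : 896 / 1000 = 2%:R * (448 / 1000) :> R by field.
  rewrite expRM_natl -exprM.
  have [w [w0 w6] h1] : exists2 w : R, 0 <= w /\ 6 <= w ^+ 4 & w <= expR (448 / 1000).
    exists ((1565 * 10 ^+ 2 + 16) / 10 ^+ 5); first by split; lra.
    by apply: le_trans (expR_ge_taylor5 h0); lra.
  apply: le_trans (_ : w ^+ 4 <= _); first by lra.
  by rewrite ler_pXn2r// nnegrE expR_ge0.
rewrite (_ : _ * _ * _ = z * (Num.sqrt 3 * Num.sqrt 2
  * expR (- (tau_lo * (Num.sqrt 2 * z))))); last by ring.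
rewrite ler_wpM2l ?(ltW z0)//.
have -> : 1 - z = (1 - z + tau_lo * (Num.sqrt 2 * z)) + - (tau_lo * (Num.sqrt 2 * z)).
  by rewrite addrK.
rewrite [leRHS]expRD ler_wpM2r ?expR_ge0//; apply: (le_trans e6).
rewrite ler_expR; have : 893 / 1000 + 88 / 10 ^+ 5 <= tau_lo * Num.sqrt 2 :> R.
  by rewrite /tau_lo; lra.
by rewrite mulrA; nra.
Qed.

(** The deficit [d = 1 - z] is at most [q], which is of order [b^2 e^-b], while
    [(1 - d) e^d >= 1 - d^2 (1 + d) / 2]. Hence [q^2] need only be small compared with [e^-b], and
    [E1] provides this: [e^b] dominates the square of [X = b (b + 2) / 4]. *)
Lemma sd_lower_bound_laplace_large b : 13 / 2 <= b ->
  1 - expR (- b) <= trunc_laplace_sd b / Num.sqrt 2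
    * expR (1 - trunc_laplace_sd b / Num.sqrt 2).
Proof.
move=> b1; have b0 : 0 < b by lra.
have s2 : 0 < Num.sqrt 2 :> R by rewrite sqrtr_gt0.
have s22 : Num.sqrt 2 * Num.sqrt 2 = 2 :> R by rewrite -expr2 sqr_sqrtr.
have sd0 := trunc_laplace_sd_gt0 b0.
have sd2 := trunc_laplace_sd_lt b0.
have ss := sqr_trunc_laplace_sd b0.
pose z := trunc_laplace_sd b / Num.sqrt 2.
have z0 : 0 < z by rewrite divr_gt0.
have z1 : z < 1 by rewrite ltr_pdivrMr// mul1r.
have sdE : trunc_laplace_sd b = Num.sqrt 2 * z.
  by rewrite /z mulrC divfK// gt_eqF.
pose X := b / 2 * (b / 2 + 1).
have X13 : 13 <= X by rewrite /X; nra.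
have E1 : 9 / 4 * X ^+ 2 <= expR b.
  have -> : expR b = expR (b / 2) ^+ 2 by rewrite -expRM_natl; congr expR; field.
  have -> : 9 / 4 * X ^+ 2 = (3 / 2 * X) ^+ 2 by field.
  suff h : 3 / 2 * X <= expR (b / 2).
    by apply: lerXn2r h; rewrite nnegrE ?expR_ge0//; lra.
  have c0 : 0 <= b / 2 by lra.
  apply: le_trans (expR_ge_taylor5 c0).
  rewrite /X; pose e := b / 2 - 13 / 4.
  have e0 : 0 <= e by rewrite /e; lra.
  have -> : b / 2 = e + 13 / 4 by rewrite /e; ring.
  have pk k : 0 <= e ^+ k by rewrite exprn_ge0.
  have := (pk 2, pk 3, pk 4, pk 5)%N => -[[[p2 p3] p4] p5].
  lra.
have varE := trunc_laplace_varE b0.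
rewrite -/z expRN.
have zq : z ^+ 2 = 1 - 2 * X / (expR b - 1).
  have : trunc_laplace_sd b ^+ 2 = 2 * z ^+ 2 by rewrite sdE exprMn [in LHS]expr2 s22.
  have E2 : 0 < expR b - 1 by nra.
  rewrite ss varE (_ : b * (b + 2) / _ = 2 * (2 * X / (expR b - 1))); first lra.
  by rewrite /X; field; rewrite gt_eqF.
move: E1 zq; move: (expR b) => E E1 zq.
have E2 : 0 < E - 1 by nra.
have E0 : 0 < E by lra.
pose q := 2 * X / (E - 1).
have qE : q * (E - 1) = 2 * X by rewrite /q divfK// gt_eqF.
have q0 : 0 <= q by rewrite /q divr_ge0//; lra.
have q1 : q <= 1 / 10 by rewrite /q ler_pdivrMr//; nra.
pose d := 1 - z.
have d0 : 0 < d by rewrite subr_gt0.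
have dq : d <= q by rewrite /q /d; nra.
have qu : 55 / 100 * q ^+ 2 <= E^-1.
  rewrite -[leRHS]div1r ler_pdivlMr// -(@ler_pM2r _ ((E - 1) ^+ 2)) ?exprn_gt0//.
  have -> : 55 / 100 * q ^+ 2 * E * (E - 1) ^+ 2 =
      55 / 100 * E * (q * (E - 1)) ^+ 2 by move: (q) => p; ring.
  by rewrite qE mul1r; nra.
have zE : z = 1 - d by rewrite /d; ring.
have ed : 1 + d + d ^+ 2 / 2 <= expR d.
  have := expR_ge_taylor5 (ltW d0).
  have pk k : 0 <= d ^+ k by rewrite exprn_ge0// ltW.
  by have := (pk 3, pk 4, pk 5)%N => -[[p3 p4] p5]; lra.
apply: (@le_trans _ _ (z * (1 + d + d ^+ 2 / 2))); last by rewrite ler_wpM2l ?(ltW z0).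
have : d ^+ 2 <= q ^+ 2 by rewrite ler_pXn2r// nnegrE ltW.
rewrite zE; nra.
Qed.

(* With [z = sd / sqrt 2], this says [1 - e^-b <= z e^(1 - z)]. *)
Lemma sd_lower_bound_laplace b : 0 < b ->
  1 - expR (- b) <= trunc_laplace_sd b / Num.sqrt 2
    * expR (1 - trunc_laplace_sd b / Num.sqrt 2).
Proof.
move=> b0; have [b1|/ltW b1] := leP b (13 / 2).
- exact: sd_lower_bound_laplace_small.
- exact: sd_lower_bound_laplace_large.
Qed.

(** The quotient of the two sides is [z e^(t sqrt 2 (1 - z)) / (1 - e^-b)] with
    [z = sd / sqrt 2 < 1]. It increases with [t], so [t = 1 / sqrt 2] is the worst case, settled by
    [sd_lower_bound_laplace]. *)
Lemma trunc_laplace_value_ge_laplace t b : 0 < b -> 1 / Num.sqrt 2 <= t ->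
  expR (- (t * Num.sqrt 2)) / Num.sqrt 2 <= G t b.
Proof.
move=> b0 t1; have s2 : 0 < Num.sqrt 2 :> R by rewrite sqrtr_gt0.
have s22 : Num.sqrt 2 * Num.sqrt 2 = 2 :> R by rewrite -expr2 sqr_sqrtr.
have u0 := one_sub_expRN_gt0 b0.
have l := sd_lower_bound_laplace b0.
have sd2 := trunc_laplace_sd_lt b0; have sd0 := trunc_laplace_sd_gt0 b0.
rewrite /G; set s := trunc_laplace_sd b in l sd2 sd0 *.
rewrite ler_pdivlMr ?mulr_gt0// mulrAC ler_pdivrMr//.
rewrite (_ : expR _ * (2 * _) = 2 * expR (- (t * Num.sqrt 2)) * (1 - expR (- b))); last by ring.
have -> : s * expR (- (t * s)) * Num.sqrt 2 =
   2 * expR (- (t * Num.sqrt 2)) * (s / Num.sqrt 2 * expR (t * (Num.sqrt 2 - s))).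
  have -> : - (t * s) = - (t * Num.sqrt 2) + t * (Num.sqrt 2 - s) by ring.
  rewrite expRD; transitivity (Num.sqrt 2 * Num.sqrt 2 * expR (- (t * Num.sqrt 2))
    * (s / Num.sqrt 2 * expR (t * (Num.sqrt 2 - s)))); last by rewrite s22.
  by field; rewrite gt_eqF.
rewrite ler_wpM2l ?mulr_ge0 ?expR_ge0//; apply: (le_trans l).
rewrite ler_wpM2l ?divr_ge0 ?(ltW sd0) ?(ltW s2)// ler_expR.
rewrite (_ : 1 - s / Num.sqrt 2 = 1 / Num.sqrt 2 * (Num.sqrt 2 - s)); last first.
  by field; rewrite gt_eqF.
by rewrite ler_wpM2r// subr_ge0 (ltW sd2).
Qed.

(** With [k = t sqrt 2 < 1] and [d = 1 - sd / sqrt 2], the claim is [(1 - d) e^(k d) < 1 - e^-b],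
    where the left side is at most [1 - (1 - k) d]. Since [d > b (b + 2) e^-b / 4], the choice
    [b = 2 / (1 - k)] makes [(1 - k) d] exceed [e^-b]. *)
Lemma trunc_laplace_value_lt_laplace t : 0 <= t -> t < 1 / Num.sqrt 2 ->
  exists2 b, 0 < b & G t b < expR (- (t * Num.sqrt 2)) / Num.sqrt 2.
Proof.
move=> t0 t1; have s2 : 0 < Num.sqrt 2 :> R by rewrite sqrtr_gt0.
have s22 : Num.sqrt 2 * Num.sqrt 2 = 2 :> R by rewrite -expr2 sqr_sqrtr.
pose k := t * Num.sqrt 2.
have k1 : 0 < 1 - k by rewrite subr_gt0 /k -ltr_pdivlMr.
have k0 : 0 <= k by rewrite mulr_ge0 ?(ltW s2).
have [b b0 bk] : exists2 b, 0 < b & 2 = b * (1 - k).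
  by exists (2 / (1 - k)); [rewrite divr_gt0|rewrite divfK// gt_eqF].
exists b => //.
have u0 := one_sub_expRN_gt0 b0; have eb := expR_gt0 (- b).
have sd2 := trunc_laplace_sd_lt b0; have sd0 := trunc_laplace_sd_gt0 b0.
have ss := sqr_trunc_laplace_sd b0.
rewrite /G; move: ss sd2 sd0; set s := trunc_laplace_sd b => ss sd2 sd0.
pose d := 1 - s / Num.sqrt 2.
have d0 : 0 < d by rewrite subr_gt0 ltr_pdivrMr// mul1r.
have d1 : d < 1 by rewrite ltrBlDr ltrDl divr_gt0.
have dE : s = Num.sqrt 2 * (1 - d) by rewrite /d; field; rewrite gt_eqF.
have dq : b * (b + 2) * expR (- b) / 4 < d.
  have : 2 * d - d ^+ 2 = expR (- b) * b * (b + 2) / (1 - expR (- b)) / 2.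
    have : s ^+ 2 = 2 * (1 - d) ^+ 2 by rewrite dE exprMn expr2 s22.
    rewrite ss /trunc_laplace_var => h.
    move: h; set w := _ / (1 - _) => h; lra.
  have : expR (- b) * b * (b + 2) <= expR (- b) * b * (b + 2) / (1 - expR (- b)).
    rewrite ler_pdivlMr// ger_pMr ?gerBl ?ltW//.
    by rewrite !mulr_gt0 ?addr_gt0.
  nra.
have e1 : expR (k * d) * (1 - k * d) <= 1.
  have := expR_ge1Dx (- (k * d)); have := expRxMexpNx_1 (k * d).
  by have := expR_gt0 (k * d); nra.
have kd : 0 < 1 - k * d by nra.
rewrite ltr_pdivrMr ?mulr_gt0// mulrAC ltr_pdivlMr//.
have -> : expR (- (t * s)) = expR (- k) * expR (k * d).
  by rewrite -expRD dE /k; congr expR; ring.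
rewrite -/k dE.
rewrite (_ : _ * _ * Num.sqrt 2 = (Num.sqrt 2 * Num.sqrt 2) * expR (- k) * ((1 - d) * expR (k * d))); last by ring.
rewrite s22 (_ : expR (- k) * _ = 2 * expR (- k) * (1 - expR (- b))); last by ring.
rewrite ltr_pM2l ?mulr_gt0 ?expR_gt0//.
have : (1 - d) * expR (k * d) <= 1 - (1 - k) * d.
  rewrite -(ler_pM2r kd) -mulrA.
  apply: (@le_trans _ _ ((1 - d) * 1)); first by rewrite ler_wpM2l// subr_ge0 (ltW d1).
  have : 0 <= (1 - k) * d * (k * d) by rewrite !mulr_ge0 ?(ltW k1) ?(ltW d0).
  lra.
have : expR (- b) < (1 - k) * d.
  apply: (@le_lt_trans _ _ ((1 - k) * (b * (b + 2) * expR (- b) / 4))).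
    have -> : (1 - k) * (b * (b + 2) * expR (- b) / 4) =
      b * (1 - k) * (b + 2) * expR (- b) / 4 by ring.
    rewrite -bk; nra.
  by rewrite ltr_pM2l.
lra.
Qed.

Definition critical_ratio b : R :=
  (trunc_laplace_sd b)^-1 * ln (Num.sqrt 3 * trunc_laplace_sd b / (1 - expR (- b))).

Definition critical_t0 : R := inf [set critical_ratio b | b in `]0, +oo[].

Lemma le_critical_ratio t b : 0 < b ->
  (t <= critical_ratio b) = `[< sd_lower_bound t b >].
Proof.
move=> b0; have u0 := one_sub_expRN_gt0 b0; have sd0 := trunc_laplace_sd_gt0 b0.
have s3 : 0 < Num.sqrt 3 :> R by rewrite sqrtr_gt0.
rewrite asboolb /sd_lower_bound /critical_ratio [_ * ln _]mulrC ler_pdivlMr//.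
rewrite -ler_expR lnK ?posrE ?divr_gt0 ?mulr_gt0//.
by rewrite ler_pdivlMr// [expR (- (t * _))]expRN ler_pdivlMr ?expR_gt0// mulrC.
Qed.

(** The infimum is described by its lower bounds, so no minimiser has to be located. *)
Lemma le_critical_t0 t :
  t <= critical_t0 <-> forall b, 0 < b -> sd_lower_bound t b.
Proof.
have lb s : (forall b, 0 < b -> sd_lower_bound s b) ->
    lbound [set critical_ratio b | b in `]0, +oo[] s.
  move=> h _ [b + <-]; rewrite /= in_itv/= andbT => b0.
  by rewrite le_critical_ratio//; apply/asboolP; exact: h.
split=> [tc b b0|h].
- apply/asboolP; rewrite -le_critical_ratio//; apply: (le_trans tc).
  apply: ge_inf; first by exists tau_lo; apply: lb; exact: sd_lower_bound_tau_lo.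
  by exists b => //=; rewrite in_itv/= b0.
- apply: lb_le_inf; last exact: lb.
  by exists (critical_ratio 1), 1 => //=; rewrite in_itv/= ltr01.
Qed.

Lemma critical_t0_itv : tau_lo <= critical_t0 <= tau_hi.
Proof.
apply/andP; split; first by apply/le_critical_t0; exact: sd_lower_bound_tau_lo.
have [b b0 h] := @sd_upper_witness R.
have u0 := one_sub_expRN_gt0 b0; have sd0 := trunc_laplace_sd_gt0 b0.
have s3 : 0 < Num.sqrt 3 :> R by rewrite sqrtr_gt0.
apply: (@le_trans _ _ (critical_ratio b)).
  have := (le_critical_t0 critical_t0).1 (lexx _) b b0.
  by move=> /asboolP; rewrite -le_critical_ratio.
rewrite /critical_ratio mulrC ler_pdivrMr//.
rewrite -ler_expR lnK ?posrE ?divr_gt0 ?mulr_gt0//.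
rewrite ler_pdivrMr// [leRHS]mulrC; move: h.
by rewrite [expR (- (tau_hi * _))]expRN ler_pdivrMr ?expR_gt0.
Qed.

(** A crude bound: it serves only the equivalence of the standard deviation with [b / sqrt 3] at
    0. *)
Lemma trunc_laplace_var_le b : 0 < b -> b <= 1 ->
  trunc_laplace_var b <= b ^+ 2 / 3 * (1 + b).
Proof.
move=> b0 b1; have u0 := one_sub_expRN_gt0 b0.
have [v3 _] := expRN_taylor (ltW b0).
rewrite /trunc_laplace_var; move: u0 v3; move: (expR (- b)) => v u0 v3.
rewrite lerBlDl -lerBlDr ler_pdivlMr//.
rewrite -subr_ge0; set w := 2 + 2 * b + 2 / 3 * b ^+ 2 - b ^+ 3 / 3.
have w0 : 0 <= w by rewrite /w; nra.
have := ler_wpM2r w0 v3.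
have : 0 <= b ^+ 4 * (1 / 3 - 5 / 18 * b + b ^+ 2 / 18).
  by rewrite mulr_ge0 ?exprn_ge0 ?(ltW b0)//; nra.
rewrite /w; lra.
Qed.

Lemma trunc_laplace_sd_bounds b : 0 < b -> b <= 1 ->
  b / Num.sqrt 3 * (1 - b / 4) <= trunc_laplace_sd b <= b / Num.sqrt 3 * (1 + b).
Proof.
move=> b0 b1; have s3 : 0 < Num.sqrt 3 :> R by rewrite sqrtr_gt0.
have s33 : Num.sqrt 3 ^+ 2 = 3 :> R by rewrite sqr_sqrtr.
have p0 : 0 <= b / Num.sqrt 3 by rewrite divr_ge0 ?(ltW b0) ?(ltW s3).
have q0 : 0 <= b ^+ 2 / 3 by rewrite divr_ge0 ?exprn_ge0 ?(ltW b0).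
apply/andP; split.
- apply: ler_sqrtr; [by rewrite mulr_ge0//; lra|by rewrite ltW ?trunc_laplace_var_gt0|].
  rewrite exprMn expr_div_n s33; apply: le_trans (trunc_laplace_var_ge b0).
  by rewrite ler_wpM2l//; nra.
- have h0 : 0 <= b / Num.sqrt 3 * (1 + b) by rewrite mulr_ge0//; lra.
  rewrite /trunc_laplace_sd -[leRHS]ger0_norm// -sqrtr_sqr; apply: ler_wsqrtr.
  rewrite exprMn expr_div_n s33; apply: (le_trans (trunc_laplace_var_le b0 b1)).
  by rewrite ler_wpM2l//; nra.
Qed.

Lemma trunc_laplace_value_cvg0 t : 0 <= t ->
  trunc_laplace_value t b @[b --> 0^'+] --> (1 / (2 * Num.sqrt 3) : R).
Proof.
move=> t0; have s3 : 0 < Num.sqrt 3 :> R by rewrite sqrtr_gt0.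
pose K : R := 1 / (2 * Num.sqrt 3).
have K0 : 0 < K by rewrite divr_gt0 ?mulr_gt0.
pose lo b : R := K * ((1 - b / 4) * (1 - t * (b / Num.sqrt 3 * (1 + b)))).
pose hi b : R := K * ((1 + b) / (1 - b / 2)).
apply: (@squeeze_cvgr _ _ _ _ lo hi).
- near=> b; have b0 : 0 < b by [].
  have b1 : b <= 1 by near: b; apply: nbhs_right_le.
  have /andP[sl su] := trunc_laplace_sd_bounds b0 b1.
  have u0 := one_sub_expRN_gt0 b0; have sd0 := trunc_laplace_sd_gt0 b0.
  have ul : 1 - expR (- b) <= b by have := expR_ge1Dx (- b); lra.
  have uu : b * (1 - b / 2) <= 1 - expR (- b).
    have [_ e4] := expRN_taylor (ltW b0).
    have : 0 <= b ^+ 3 * (1 / 6 - b / 24).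
      by rewrite mulr_ge0 ?exprn_ge0 ?(ltW b0)//; lra.
    lra.
  rewrite /trunc_laplace_value; set s := trunc_laplace_sd b in sl su sd0 *.
  apply/andP; split.
  + rewrite /lo /K ler_pdivlMr ?mulr_gt0//.
    set w := 1 - t * (b / Num.sqrt 3 * (1 + b)).
    have r0 : 0 <= (1 - b / 4) / Num.sqrt 3 by rewrite divr_ge0 ?(ltW s3)//; lra.
    rewrite (_ : _ * (2 * _) = (1 - expR (- b)) * ((1 - b / 4) / Num.sqrt 3 * w)); last first.
      by rewrite -/w; field; rewrite gt_eqF.
    (* Only [b <= 1] is known, so for large [t] the factor [w] may be negative; the bound is then
       trivial. *)
    have [w0|w0] := leP 0 w; last first.
      apply: (@le_trans _ _ 0); last by rewrite mulr_ge0 ?expR_ge0 ?(ltW sd0).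
      by rewrite mulr_ge0_le0 ?(ltW u0)// mulr_ge0_le0// ltW.
    have we : w <= expR (- (t * s)).
      apply: le_trans (expR_ge1Dx _); rewrite lerD2l lerN2.
      by rewrite ler_wpM2l.
    apply: (@le_trans _ _ (b * ((1 - b / 4) / Num.sqrt 3 * w))).
      by rewrite ler_wpM2r// mulr_ge0.
    rewrite (_ : b * _ = b / Num.sqrt 3 * (1 - b / 4) * w); last first.
      by field; rewrite gt_eqF.
    by rewrite ler_pM// mulr_ge0 ?divr_ge0 ?(ltW b0) ?(ltW s3)//; lra.
  + rewrite /hi /K ler_pdivrMr ?mulr_gt0//.
    apply: (@le_trans _ _ (b / Num.sqrt 3 * (1 + b) * 1)).
      rewrite ler_pM ?expR_ge0 ?(ltW sd0)//.
      by rewrite expR_le1 oppr_le0 mulr_ge0 ?(ltW sd0).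
    have b2 : 0 < 1 - b / 2 by lra.
    rewrite mulr1 (_ : _ * (2 * _) = (1 + b) / Num.sqrt 3 * ((1 - expR (- b)) / (1 - b / 2))); last first.
      by field; rewrite !gt_eqF//; lra.
    rewrite (_ : b / _ * _ = (1 + b) / Num.sqrt 3 * b); last by field; rewrite gt_eqF.
    apply: ler_wpM2l; last by rewrite ler_pdivlMr.
    by rewrite divr_ge0 ?(ltW s3)//; lra.
- apply: cvg_at_right_filter.
  have -> : 1 / (2 * Num.sqrt 3) = K * ((1 - 0 / 4) * (1 - t * (0 / Num.sqrt 3 * (1 + 0)))).
    by rewrite !mul0r mulr0 !subr0 !mulr1.
  apply: cvgM; first exact: cvg_cst.
  apply: cvgM; apply: cvgB; [exact: cvg_cst| |exact: cvg_cst|].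
    by apply: cvgM; [exact: cvg_id|exact: cvg_cst].
  apply: cvgM; first exact: cvg_cst.
  apply: cvgM; first by apply: cvgM; [exact: cvg_id|exact: cvg_cst].
  by apply: cvgD; [exact: cvg_cst|exact: cvg_id].
- apply: cvg_at_right_filter.
  have -> : 1 / (2 * Num.sqrt 3) = K * ((1 + 0) / (1 - 0 / 2)).
    by rewrite !mul0r subr0 addr0 divr1 mulr1.
  apply: cvgM; first exact: cvg_cst.
  apply: cvgM; first by apply: cvgD; [exact: cvg_cst|exact: cvg_id].
  apply: cvgV; first by rewrite mul0r subr0.
  apply: cvgB; first exact: cvg_cst.
  by apply: cvgM; [exact: cvg_id|exact: cvg_cst].
Unshelve. all: by end_near. Qed.

Lemma trunc_laplace_value_cvgy t :
  trunc_laplace_value t b @[b --> +oo] --> expR (- (t * Num.sqrt 2)) / Num.sqrt 2.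
Proof.
have s2 : 0 < Num.sqrt 2 :> R by rewrite sqrtr_gt0.
have s22 : Num.sqrt 2 * Num.sqrt 2 = 2 :> R by rewrite -expr2 sqr_sqrtr.
have e0 : expR (- b) @[b --> +oo] --> (0 : R) by exact: cvgr_expR.
have q0 : expR (- b) * b * (b + 2) @[b --> +oo] --> (0 : R).
  (* For [b >= 1], [b^2 (b + 2) <= 3 b^3 <= 18 e^b]. *)
  apply: (@squeeze_cvgr _ _ _ _ (fun=> 0) (fun b => 18 / b)).
  - near=> b; have b1 : 1 <= b by near: b; apply: nbhs_pinfty_ge; rewrite num_real.
    have b0 : 0 < b by lra.
    apply/andP; split; first by rewrite !mulr_ge0 ?expR_ge0//; lra.
    rewrite ler_pdivlMr// expRN -mulrA -mulrA mulrC ler_pdivrMr ?expR_gt0//.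
    have := expR_ge_taylor5 (ltW b0).
    have p4 : 0 <= b ^+ 4 by rewrite exprn_ge0// ltW.
    have p5 : 0 <= b ^+ 5 by rewrite exprn_ge0// ltW.
    have : b ^+ 2 <= b ^+ 3 by nra.
    nra.
  - exact: cvg_cst.
  - rewrite -[X in _ --> X](mulr0 18); apply: cvgM; first exact: cvg_cst.
    by apply/gtr0_cvgV0; [near=> b; near: b; apply: nbhs_pinfty_gt; rewrite num_real|exact: cvg_id].
have v2 : trunc_laplace_var b @[b --> +oo] --> (2 : R).
  rewrite -[X in _ --> X]subr0 -[X in _ - X](mul0r (1 - 0)^-1).
  apply: cvgB; first exact: cvg_cst.
  apply: cvgM => //; apply: cvgV; first by rewrite subr0.
  by apply: cvgB => //; exact: cvg_cst.
have sd2 : trunc_laplace_sd b @[b --> +oo] --> (Num.sqrt 2 : R).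
  by apply: (@cvg_comp _ _ _ _ (Num.sqrt : R -> R) _ _ _ v2); exact: sqrt_continuous.
have -> : expR (- (t * Num.sqrt 2)) / Num.sqrt 2 =
   Num.sqrt 2 * expR (- (t * Num.sqrt 2)) / (2 * (1 - 0)).
  transitivity (Num.sqrt 2 * expR (- (t * Num.sqrt 2)) / (Num.sqrt 2 * Num.sqrt 2)).
    by field; rewrite gt_eqF.
  by rewrite s22 subr0 mulr1.
apply: cvgM.
  apply: cvgM => //.
  have ts : - (t * trunc_laplace_sd b) @[b --> +oo] --> - (t * Num.sqrt 2).
    by apply: cvgN; apply: cvgM => //; exact: cvg_cst.
  by apply: (@cvg_comp _ _ _ _ (@expR R) _ _ _ ts); exact: continuous_expR.
apply: cvgV; first by rewrite subr0 mulr1.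
by apply: cvgM; [exact: cvg_cst|apply: cvgB => //; exact: cvg_cst].
Unshelve. all: by end_near. Qed.

End closed_form.

(** * Second moments on the half-line *)

Section moments.
Context {R : realType}.
Implicit Types (h u w f F : R -> R) (x z r s c : R).
Local Notation mu := (@lebesgue_measure R).

Lemma is_derive_continuous f f' : (forall x, is_derive x 1 f (f' x)) -> continuous f.
Proof.
move=> df x; apply: differentiable_continuous; apply/derivable1_diffP.
by case: (df x).
Qed.

Lemma is_derive_derive1 f f' : (forall x, is_derive x 1 f (f' x)) -> (f^`())%classic =1 f'.
Proof. by move=> df x; rewrite derive1E (@derive_val _ _ _ _ _ _ _ (df x)). Qed.

Lemma integral_is_derive f F a b : a <= b -> (forall x, is_derive x 1 F (f x)) ->
  continuous f -> (\int[mu]_(x in `[a, b]) (f x)%:E = (F b - F a)%:E)%E.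
Proof.
move=> ab dF cf; have cF := is_derive_continuous dF.
move: ab; rewrite le_eqVlt => /predU1P[->|ab].
  by rewrite set_itv1 integral_set1 subrr.
rewrite (@continuous_FTC2 _ f F)//; first exact: continuous_subspaceT.
- split; first by move=> x _; case: (dF x).
  + by apply: cvg_at_right_filter; exact: cF.
  + by apply: cvg_at_left_filter; exact: cF.
- by move=> x _; exact: is_derive_derive1.
Qed.

Lemma integral_is_derivey f F a l : (forall x, a <= x -> 0 <= f x) ->
  (forall x, is_derive x 1 F (f x)) -> continuous f ->
  F x @[x --> +oo] --> l ->
  (\int[mu]_(x in `[a, +oo[) (f x)%:E = (l - F a)%:E)%E.
Proof.
move=> f0 dF cf Fl; have cF := is_derive_continuous dF.
rewrite (@ge0_continuous_FTC2y _ f F _ l)//; first exact: continuous_subspaceT.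
- by apply: cvg_at_right_filter; exact: cF.
- by move=> x _; exact: is_derive_derive1.
Qed.

Definition hmom (n : nat) h : \bar R :=
  (\int[mu]_(x in `[0%R, +oo[) (x ^+ n * h x)%:E)%E.

Lemma measurable_monom (n : nat) h (D : set R) : measurable_fun setT h ->
  measurable_fun D (EFin \o (fun x => x ^+ n * h x)).
Proof.
move=> mh; apply: measurable_funTS; apply/measurable_EFinP.
by apply: measurable_funM => //; exact: exprn_measurable.
Qed.

Lemma hmom_piecewise (n : nat) h u w r : 0 <= r -> measurable_fun setT h ->
  measurable_fun setT w -> (forall x, 0 <= x -> 0 <= h x) ->
  (forall x, 0 <= x -> x <= r -> h x = u x) -> (forall x, r < x -> h x = w x) ->
  (hmom n h = \int[mu]_(x in `[0%R, r]) (x ^+ n * u x)%:E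
            + \int[mu]_(x in `[r, +oo[) (x ^+ n * w x)%:E)%E.
Proof.
move=> r0 mh mw h0 hu hw; rewrite /hmom.
have -> : `[0, +oo[%classic = `[0, r]%classic `|` `]r, +oo[%classic :> set R.
  by rewrite -itv_bndbnd_setU// bnd_simp.
rewrite ge0_integral_setU//=.
- congr (_ + _)%E.
    by apply: eq_integral => x /[!inE]/=; rewrite in_itv/= => /andP[x0 xr]; rewrite hu.
  rewrite -integral_itv_obnd_cbnd; last exact: measurable_monom.
  by apply: eq_integral => x /[!inE]/=; rewrite in_itv/= andbT => rx; rewrite hw.
- exact: measurable_monom.
- move=> x; rewrite !in_itv/= andbT => xr.
  have x0 : 0 <= x by case: xr => [/andP[]|/ltW /(le_trans r0)].
  by rewrite lee_fin mulr_ge0 ?exprn_ge0 ?h0.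
- rewrite disj_set2E; apply/eqP; rewrite -subset0 => x [] /=.
  by rewrite !in_itv/= andbT => /andP[_ xr] /(le_lt_trans xr); rewrite ltxx.
Qed.

(* Pointwise, [(x^2 - z^2) (h2 x - h1 x) >= 0]. *)
Lemma hmom2_crossing h1 h2 z : measurable_fun setT h1 -> measurable_fun setT h2 ->
  (forall x, 0 <= x -> 0 <= h1 x) -> (forall x, 0 <= x -> 0 <= h2 x) -> 0 <= z ->
  (forall x, 0 <= x -> x < z -> h2 x <= h1 x) ->
  (forall x, z < x -> h1 x <= h2 x) ->
  hmom 0 h1 = hmom 0 h2 -> (hmom 0 h1 < +oo)%E ->
  (hmom 2 h1 <= hmom 2 h2)%E.
Proof.
move=> m1 m2 p1 p2 z0 lo hi e01 fin1.
have H0 : forall x, `[0, +oo[%classic x -> 0 <= x.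
  by move=> x; rewrite /= in_itv/= andbT.
(* The integrated inequality is arranged as sums of nonnegative integrals, since second moments may
   be infinite; the equal masses are finite and cancel at the end. *)
have key : (hmom 2 h1 + (z ^+ 2)%:E * hmom 0 h2 <=
            hmom 2 h2 + (z ^+ 2)%:E * hmom 0 h1)%E.
  have q1 n h x : (forall x, 0 <= x -> 0 <= h x) -> `[0, +oo[%classic x ->
      (0 <= (x ^+ n * h x)%:E)%E.
    by move=> p /H0 x0; rewrite lee_fin mulr_ge0 ?exprn_ge0 ?p.
  rewrite /hmom -!ge0_integralZl//=; last 6 first.
  - exact: measurable_monom.
  - by move=> x; exact: q1.
  - by rewrite lee_fin sqr_ge0.
  - exact: measurable_monom.
  - by move=> x; exact: q1.
  - by rewrite lee_fin sqr_ge0.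
  have mz h : measurable_fun setT h ->
      measurable_fun (`[0, +oo[ : set R) (fun x => (z ^+ 2)%:E * (EFin \o (fun x => x ^+ 0 * h x)%R) x)%E.
    by move=> mh; apply: measurable_funeM; exact: measurable_monom.
  have qz h x : (forall x, 0 <= x -> 0 <= h x) -> `[0, +oo[%classic x ->
      (0 <= (z ^+ 2)%:E * (x ^+ 0 * h x)%:E)%E.
    by move=> p xx; rewrite mule_ge0 ?q1// lee_fin sqr_ge0.
  rewrite -!ge0_integralD//=; try by [move=> *; exact: q1|move=> *; exact: qz
    |exact: mz|exact: measurable_monom].
  apply: ge0_le_integral => //.
  - by move=> x xx; apply: adde_ge0; [exact: q1|exact: qz].
  - by apply: emeasurable_funD; [exact: measurable_monom|exact: mz].
  - by apply: emeasurable_funD; [exact: measurable_monom|exact: mz].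
  - move=> x /H0 x0; rewrite -!EFinM -!EFinD lee_fin !expr0 !mul1r.
    rewrite -subr_ge0 (_ : _ - _ = (x ^+ 2 - z ^+ 2) * (h2 x - h1 x)); last by ring.
    have [xz|zx|->] := ltgtP x z.
    + rewrite mulr_le0// ?subr_le0 ?lo// ?lerXn2r// ?nnegrE// ltW//.
    + by rewrite mulr_ge0// ?subr_ge0 ?hi// lerXn2r// ?nnegrE// ltW.
    + by rewrite subrr mul0r.
move: key; rewrite -e01 leeD2rE//.
have f0 : hmom 0 h1 \is a fin_num.
  rewrite ge0_fin_numE//; apply: integral_ge0 => x /H0 x0.
  by rewrite lee_fin mulr_ge0 ?exprn_ge0 ?p1.
by rewrite fin_numM.
Qed.

(** The rate [s = 0] gives a uniform profile; it has its own moment lemma because the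
    antiderivatives divide by [s]. *)
Definition trunc_exp c s b x : R := if x <= b then c * expR (- (s * x)) else 0.

Definition plateau c s r x : R := if x <= r then c else c * expR (- (s * (x - r))).

Lemma measurable_expRN_affine s r :
  measurable_fun setT (fun x : R => expR (- (s * (x - r)))).
Proof.
apply: measurableT_comp => //; apply: measurable_funN.
by apply: measurable_funM => //; apply: measurable_funB.
Qed.

Lemma measurable_trunc_exp c s b : measurable_fun setT (trunc_exp c s b).
Proof.
apply: measurable_fun_ifT => //; first exact: measurable_fun_ler.
apply: measurable_funM => //; have := @measurable_expRN_affine s 0.
by under eq_fun do rewrite subr0.
Qed.

Lemma measurable_plateau c s r : measurable_fun setT (plateau c s r).
Proof.
apply: measurable_fun_ifT => //; first exact: measurable_fun_ler.
by apply: measurable_funM => //; exact: measurable_expRN_affine.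
Qed.

Lemma trunc_exp_ge0 c s b x : 0 <= c -> 0 <= trunc_exp c s b x.
Proof. by move=> c0; rewrite /trunc_exp; case: ifP => // _; rewrite mulr_ge0 ?expR_ge0. Qed.

Lemma plateau_ge0 c s r x : 0 <= c -> 0 <= plateau c s r x.
Proof. by move=> c0; rewrite /plateau; case: ifP => // _; rewrite mulr_ge0 ?expR_ge0. Qed.

Lemma is_derive_expRN_affine s r x : is_derive x 1
  (fun x => expR (- (s * (x - r)))) (- s * expR (- (s * (x - r)))).
Proof.
by apply: is_derive_eq; rewrite /GRing.scale/=; ring.
Qed.

Lemma is_derive_hmom0 c s r x : s != 0 -> is_derive x 1
  (fun x => - (c / s) * expR (- (s * (x - r)))) (x ^+ 0 * (c * expR (- (s * (x - r))))).
Proof.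
move=> s0; have dE := is_derive_expRN_affine s r x.
by apply: is_derive_eq; rewrite /GRing.scale/=; field.
Qed.

Lemma is_derive_hmom2 c s r x : s != 0 -> is_derive x 1
  (fun x => - (c / s ^+ 3) * (((s * x) ^+ 2 + 2 * (s * x) + 2) * expR (- (s * (x - r)))))
  (x ^+ 2 * (c * expR (- (s * (x - r))))).
Proof.
move=> s0; have dE := is_derive_expRN_affine s r x.
by apply: is_derive_eq; rewrite /GRing.scale/=; field.
Qed.

Lemma continuous_hmom_exp (n : nat) c s r :
  continuous (fun x : R => x ^+ n * (c * expR (- (s * (x - r))))).
Proof.
move=> x; apply: cvgM; first exact: exprn_continuous.
apply: cvgM; first exact: cvg_cst.
exact: (is_derive_continuous (is_derive_expRN_affine s r)).
Qed.

Lemma integral_cst_hmom0 c r : 0 <= r ->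
  (\int[mu]_(x in `[0%R, r]) (x ^+ 0 * c)%:E = (c * r)%:E)%E.
Proof.
move=> r0.
have d x : is_derive x 1 (fun x => c * x) (x ^+ 0 * c).
  by apply: is_derive_eq; rewrite /GRing.scale/=; ring.
rewrite (integral_is_derive r0 d); first by rewrite mulr0 subr0.
by move=> x; apply: cvgM; [exact: exprn_continuous|exact: cvg_cst].
Qed.

Lemma integral_cst_hmom2 c r : 0 <= r ->
  (\int[mu]_(x in `[0%R, r]) (x ^+ 2 * c)%:E = (c * (r ^+ 3 / 3))%:E)%E.
Proof.
move=> r0.
have d x : is_derive x 1 (fun x => c * (x ^+ 3 / 3)) (x ^+ 2 * c).
  by apply: is_derive_eq; rewrite /GRing.scale/=; field.
rewrite (integral_is_derive r0 d); first by rewrite expr0n/= mul0r mulr0 subr0.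
by move=> x; apply: cvgM; [exact: exprn_continuous|exact: cvg_cst].
Qed.

Lemma integral_zero_hmom (n : nat) r :
  (\int[mu]_(x in `[r, +oo[) (x ^+ n * 0)%:E = 0)%E.
Proof. by under eq_integral do rewrite mulr0; rewrite integral0. Qed.

Lemma hmom0_trunc_exp c s b : 0 <= c -> s != 0 -> 0 <= b ->
  hmom 0 (trunc_exp c s b) = (c * (1 - expR (- (s * b))) / s)%:E.
Proof.
move=> c0 s0 b0.
rewrite (@hmom_piecewise 0 _ (fun x => c * expR (- (s * (x - 0)))) (fun=> 0) b)//.
- rewrite integral_zero_hmom adde0.
  rewrite (integral_is_derive b0 (fun x => is_derive_hmom0 c 0 x s0)).
  + by congr (_%:E); rewrite !subr0 mulr0 oppr0 expR0; field.
  + exact: continuous_hmom_exp.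
- exact: measurable_trunc_exp.
- by move=> x _; exact: trunc_exp_ge0.
- by move=> x _ xb; rewrite /trunc_exp xb subr0.
- by move=> x bx; rewrite /trunc_exp leNgt bx.
Qed.

Lemma hmom2_trunc_exp c s b : 0 <= c -> s != 0 -> 0 <= b ->
  hmom 2 (trunc_exp c s b) =
  (c * (2 - expR (- (s * b)) * ((s * b) ^+ 2 + 2 * (s * b) + 2)) / s ^+ 3)%:E.
Proof.
move=> c0 s0 b0.
rewrite (@hmom_piecewise 2 _ (fun x => c * expR (- (s * (x - 0)))) (fun=> 0) b)//.
- rewrite integral_zero_hmom adde0.
  rewrite (integral_is_derive b0 (fun x => is_derive_hmom2 c 0 x s0)).
  + by congr (_%:E); rewrite !subr0 mulr0 oppr0 expR0; field.
  + exact: continuous_hmom_exp.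
- exact: measurable_trunc_exp.
- by move=> x _; exact: trunc_exp_ge0.
- by move=> x _ xb; rewrite /trunc_exp xb subr0.
- by move=> x bx; rewrite /trunc_exp leNgt bx.
Qed.

Lemma cvgr_poly2_expRN :
  (y ^+ 2 + 2 * y + 2) * expR (- y) @[y --> +oo] --> (0 : R).
Proof.
apply: (@squeeze_cvgr _ _ _ _ (fun=> 0) (fun y => 30 / y)).
- near=> y; have y1 : 1 <= y by near: y; apply: nbhs_pinfty_ge; rewrite num_real.
  have y0 : 0 < y by lra.
  apply/andP; split; first by rewrite mulr_ge0 ?expR_ge0//; nra.
  rewrite ler_pdivlMr// expRN mulrAC ler_pdivrMr ?expR_gt0//.
  have := expR_ge_taylor5 (ltW y0).
  have p4 : 0 <= y ^+ 4 by rewrite exprn_ge0// ltW.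
  have p5 : 0 <= y ^+ 5 by rewrite exprn_ge0// ltW.
  have : y ^+ 2 <= y ^+ 3 by nra.
  nra.
- exact: cvg_cst.
- rewrite -[X in _ --> X](mulr0 30); apply: cvgM; first exact: cvg_cst.
  by apply/gtr0_cvgV0; [near=> y; near: y; apply: nbhs_pinfty_gt; rewrite num_real|exact: cvg_id].
Unshelve. all: by end_near. Qed.

Lemma cvgr_mulrl_pinfty s : 0 < s -> s * x @[x --> +oo] --> +oo.
Proof.
move=> s0; apply/cvgryPge => A; near=> x.
by rewrite mulrC -ler_pdivrMr//; near: x; apply: nbhs_pinfty_ge; rewrite num_real.
Unshelve. all: by end_near. Qed.

Lemma cvgr_hmom0 c s r : 0 < s ->
  - (c / s) * expR (- (s * (x - r))) @[x --> +oo] --> 0.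
Proof.
move=> s0; rewrite -[X in _ --> X](mulr0 (- (c / s))).
apply: cvgM; first exact: cvg_cst.
rewrite (_ : (fun _ => _) = (fun x => expR (s * r) * expR (- (s * x)))); last first.
  by apply/funext => x; rewrite -expRD; congr expR; ring.
rewrite -[X in _ --> X](mulr0 (expR (s * r))); apply: cvgM; first exact: cvg_cst.
by apply: (@cvg_comp _ _ _ _ (fun y => expR (- y)) _ _ _ (cvgr_mulrl_pinfty s0)); exact: cvgr_expR.
Qed.

Lemma cvgr_hmom2 c s r : 0 < s ->
  - (c / s ^+ 3) * (((s * x) ^+ 2 + 2 * (s * x) + 2) * expR (- (s * (x - r))))
    @[x --> +oo] --> 0.
Proof.
move=> s0; rewrite -[X in _ --> X](mulr0 (- (c / s ^+ 3))).
apply: cvgM; first exact: cvg_cst.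
rewrite (_ : (fun _ => _) = (fun x => expR (s * r) *
  (((s * x) ^+ 2 + 2 * (s * x) + 2) * expR (- (s * x))))); last first.
  apply/funext => x; rewrite [RHS]mulrCA -expRD; congr (_ * expR _); ring.
rewrite -[X in _ --> X](mulr0 (expR (s * r))); apply: cvgM; first exact: cvg_cst.
by apply: (@cvg_comp _ _ _ _ (fun y => (y ^+ 2 + 2 * y + 2) * expR (- y))
  _ _ _ (cvgr_mulrl_pinfty s0)); exact: cvgr_poly2_expRN.
Qed.

Lemma hmom0_plateau c s r : 0 <= c -> 0 < s -> 0 <= r ->
  hmom 0 (plateau c s r) = (c * (r + s^-1))%:E.
Proof.
move=> c0 s0 r0; have sn0 : s != 0 by rewrite gt_eqF.
rewrite (@hmom_piecewise 0 _ (fun=> c) (fun x => c * expR (- (s * (x - r)))) r)//.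
- rewrite integral_cst_hmom0// (@integral_is_derivey _ _ _ _ _
    (fun x => is_derive_hmom0 c r x sn0) _ (cvgr_hmom0 c r s0)).
  + by rewrite -EFinD; congr (_%:E); rewrite subrr mulr0 oppr0 expR0; field.
  + move=> x rx; apply: mulr_ge0; last by rewrite mulr_ge0 ?expR_ge0.
    by apply: exprn_ge0; exact: le_trans rx.
  + exact: continuous_hmom_exp.
- exact: measurable_plateau.
- by apply: measurable_funM => //; exact: measurable_expRN_affine.
- by move=> x _; exact: plateau_ge0.
- by move=> x _ xr; rewrite /plateau xr.
- by move=> x rx; rewrite /plateau leNgt rx.
Qed.

Lemma hmom2_plateau c s r : 0 <= c -> 0 < s -> 0 <= r ->
  hmom 2 (plateau c s r) =
  (c * (r ^+ 3 / 3 + r ^+ 2 / s + 2 * r / s ^+ 2 + 2 / s ^+ 3))%:E.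
Proof.
move=> c0 s0 r0; have sn0 : s != 0 by rewrite gt_eqF.
rewrite (@hmom_piecewise 2 _ (fun=> c) (fun x => c * expR (- (s * (x - r)))) r)//.
- rewrite integral_cst_hmom2// (@integral_is_derivey _ _ _ _ _
    (fun x => is_derive_hmom2 c r x sn0) _ (cvgr_hmom2 c r s0)).
  + by rewrite -EFinD; congr (_%:E); rewrite subrr mulr0 oppr0 expR0; field.
  + move=> x rx; apply: mulr_ge0; last by rewrite mulr_ge0 ?expR_ge0.
    by apply: exprn_ge0; exact: le_trans rx.
  + exact: continuous_hmom_exp.
- exact: measurable_plateau.
- by apply: measurable_funM => //; exact: measurable_expRN_affine.
- by move=> x _; exact: plateau_ge0.
- by move=> x _ xr; rewrite /plateau xr.
- by move=> x rx; rewrite /plateau leNgt rx.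
Qed.

Lemma hmom_trunc_exp_uniform c b : 0 <= c -> 0 <= b ->
  hmom 0 (trunc_exp c 0 b) = (c * b)%:E /\
  hmom 2 (trunc_exp c 0 b) = (c * (b ^+ 3 / 3))%:E.
Proof.
move=> c0 b0; split.
- rewrite (@hmom_piecewise 0 _ (fun=> c) (fun=> 0) b)//.
  + by rewrite integral_zero_hmom adde0 integral_cst_hmom0.
  + exact: measurable_trunc_exp.
  + by move=> x _; exact: trunc_exp_ge0.
  + by move=> x _ xb; rewrite /trunc_exp xb mul0r oppr0 expR0 mulr1.
  + by move=> x bx; rewrite /trunc_exp leNgt bx.
- rewrite (@hmom_piecewise 2 _ (fun=> c) (fun=> 0) b)//.
  + by rewrite integral_zero_hmom adde0 integral_cst_hmom2.
  + exact: measurable_trunc_exp.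
  + by move=> x _; exact: trunc_exp_ge0.
  + by move=> x _ xb; rewrite /trunc_exp xb mul0r oppr0 expR0 mulr1.
  + by move=> x bx; rewrite /trunc_exp leNgt bx.
Qed.

End moments.

(** * Log-concave densities on the half-line *)

Section log_concavity.
Context {R : realType}.
Implicit Types (f : R -> R) (x y t s c r : R).

(** Log-concavity without an extended-real potential: the first conjunct makes the set where [f] is
    positive convex, and the second is concavity of [ln f] on it. *)
Definition ln_concave f := forall x y t, 0 <= t -> t <= 1 -> 0 < f x -> 0 < f y ->
  0 < f (t * x + (1 - t) * y) /\
  t * ln (f x) + (1 - t) * ln (f y) <= ln (f (t * x + (1 - t) * y)).

Lemma log_concave_ln f : log_concave f -> ln_concave f.
Proof.
move=> [V [[VNy Vc] fV]].
have Vfin z : 0 < f z -> V z = (- ln (f z))%:E.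
  move=> fz; have := fV z; have := VNy z; case: (V z) => [v _ /= [->]| |//].
  - by rewrite expRK opprK.
  - by move=> _ /= [fz0]; move: fz; rewrite fz0 ltxx.
move=> x y t t0 t1 fx fy; have := Vc x y t t0 t1.
rewrite (Vfin x fx) (Vfin y fy) -!EFinM -EFinD.
set z := t * x + (1 - t) * y; have := fV z; have := VNy z.
case: (V z) => [v _ /= [fz]| //|//]; rewrite lee_fin => h.
by rewrite fz expRK; split; [exact: expR_gt0|lra].
Qed.

(** [x] is a convex combination of [y] and [- y], where [f] takes the same value. *)
Lemma even_ln_concave_nonincreasing f : (forall x, 0 <= f x) -> ln_concave f ->
  (forall x, f (- x) = f x) -> forall x y, 0 <= x -> x <= y -> f y <= f x.
Proof.
move=> f0 lc ev x y x0 xy.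
have [fy|fy] := ltP 0 (f y); last by apply: (le_trans fy).
have [y0|y0] := leP y 0; first by have -> : x = y by lra.
pose t := (x + y) / (2 * y).
have t0 : 0 <= t by rewrite divr_ge0//; lra.
have t1 : t <= 1 by rewrite ler_pdivrMr; lra.
have fNy : 0 < f (- y) by rewrite ev.
have [] := lc y (- y) t t0 t1 fy fNy.
have -> : t * y + (1 - t) * - y = x by rewrite /t; field; rewrite gt_eqF.
rewrite ev => fx h; rewrite -ler_ln ?posrE//; lra.
Qed.

Lemma ln_concave_slopes f x y z : ln_concave f -> x < y -> y < z ->
  0 < f x -> 0 < f z -> 0 < f y /\
  (ln (f x) - ln (f y)) / (y - x) <= (ln (f y) - ln (f z)) / (z - y).
Proof.
move=> lc xy yz fx fz; pose t := (z - y) / (z - x).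
have zx : 0 < z - x by lra.
have t0 : 0 <= t by rewrite divr_ge0//; lra.
have t1 : t <= 1 by rewrite ler_pdivrMr//; lra.
have [] := lc x z t t0 t1 fx fz.
have -> : t * x + (1 - t) * z = y by rewrite /t; field; rewrite gt_eqF.
move=> fy h; split => //.
rewrite ler_pdivrMr ?subr_gt0// mulrAC ler_pdivlMr ?subr_gt0//.
have := ler_wpM2r (ltW zx) h; rewrite mulrDl.
rewrite (_ : t * _ * _ = (z - y) * ln (f x)); last by rewrite /t; field; rewrite gt_eqF.
rewrite (_ : (1 - t) * _ * _ = (y - x) * ln (f z)); last by rewrite /t; field; rewrite gt_eqF.
lra.
Qed.

(** [s] is the supremum of the slopes of [- ln f] over intervals ending at [x0]. Any slope to the
    right of [x0] bounds them, and the point [x1] provides one, so the supremum is finite. At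
    [x0 = 0] monotonicity allows [s = 0]. *)
Lemma ln_concave_supergradient f x0 x1 : (forall x, 0 <= f x) -> ln_concave f ->
  (forall x y, 0 <= x -> x <= y -> f y <= f x) ->
  0 <= x0 -> x0 < x1 -> 0 < f x1 ->
  exists2 s, 0 <= s & forall x, 0 <= x -> f x <= f x0 * expR (- (s * (x - x0))).
Proof.
move=> f0 lc dec x00 x01 fx1.
have fx0 : 0 < f x0 by rewrite (lt_le_trans fx1)// dec// ltW.
have [x0p|x0n] := ltP 0 x0; last first.
  exists 0 => // x x0'; rewrite mul0r oppr0 expR0 mulr1 dec//; lra.
pose sl x := (ln (f x) - ln (f x0)) / (x0 - x).
have pos x : 0 <= x -> x < x0 -> 0 < f x.
  by move=> x0' xx0; rewrite (lt_le_trans fx0)// dec// ltW.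
pose S := [set sl x | x in `[0, x0[].
have slub z x : x0 < z -> 0 < f z -> 0 <= x -> x < x0 ->
    sl x <= (ln (f x0) - ln (f z)) / (z - x0).
  move=> x0z fz xp xx0; rewrite /sl.
  by have [] := ln_concave_slopes lc xx0 x0z (pos _ xp xx0) fz.
have S0 : S (sl 0) by exists 0 => //=; rewrite in_itv/= lexx.
have ubS z : x0 < z -> 0 < f z -> ubound S ((ln (f x0) - ln (f z)) / (z - x0)).
  move=> x0z fz _ [x + <-]; rewrite /= in_itv/= => /andP[xp xx0].
  exact: slub.
have Sub : has_ubound S by eexists; exact: ubS fx1.
pose s := sup S.
have sl0 : 0 <= sl 0.
  rewrite /sl subr0 divr_ge0// subr_ge0 ler_ln ?posrE//; first exact: dec.
  exact: pos.
exists s; first by apply: le_trans sl0 _; apply: ub_le_sup.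
move=> x xp; have [fxp|fx] := ltP 0 (f x); last first.
  by apply: (le_trans fx); rewrite mulr_ge0 ?expR_ge0.
rewrite -ler_ln ?posrE ?mulr_gt0 ?expR_gt0// lnM ?posrE ?expR_gt0// expRK.
have [xx0|x0x|->] := ltgtP x x0.
- have : sl x <= s by apply: ub_le_sup => //; exists x => //=; rewrite in_itv/= xp xx0.
  by rewrite /sl ler_pdivrMr ?subr_gt0//; lra.
- have : s <= (ln (f x0) - ln (f x)) / (x - x0).
    by apply: ge_sup; [exists (sl 0)|exact: ubS].
  by rewrite ler_pdivlMr ?subr_gt0//; lra.
- by rewrite subrr mulr0 subr0.
Qed.

Lemma level_crossing f c r : (forall x y, 0 <= x -> x <= y -> f y <= f x) -> 0 <= r ->
  exists z, [/\ 0 <= z, z <= r, (forall x, 0 <= x -> x < z -> c <= f x) &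
    (forall x, z < x -> x <= r -> f x <= c)].
Proof.
(* Adjoining 0 keeps the set nonempty even if [f < c] throughout. *)
move=> dec r0; pose S := [set x | x = 0 \/ [/\ 0 <= x, x <= r & c <= f x]].
have S0 : S 0 by left.
have ubS : ubound S r by move=> x [->//|[]].
have hS : has_ubound S by exists r.
have z0 : 0 <= sup S by exact: ub_le_sup.
exists (sup S); split => //.
- by apply: ge_sup => //; exists 0.
- move=> x x0 xz; have [//|y Sy xy] := @sup_gt _ S x _ xz; first by exists 0.
  case: Sy => [y0|[y0 yr cy]]; first by move: xy; rewrite y0 ltNge x0.
  by apply: (le_trans cy); rewrite dec// ltW.
- move=> x zx xr; rewrite leNgt; apply/negP => /ltW cx.
  have : x <= sup S by apply: ub_le_sup => //; right; split => //; lra.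
  by rewrite leNgt zx.
Qed.

End log_concavity.

(** * Comparison of a profile with uniform, truncated exponential and plateau functions *)

Section profile.
Context {R : realType}.
Implicit Types (f g : R -> R) (x y z v t s c r b M : R).

(* The restriction to [0, +oo[ of an even log-concave density. *)
Definition profile f := [/\ measurable_fun setT f, (forall x, 0 <= f x),
  (forall x y, 0 <= x -> x <= y -> f y <= f x), ln_concave f &
  hmom 0 f = (1 / 2)%:E].

(** The factor 2 passes from the half-line to the even density. *)
Definition hsd f := Num.sqrt (2 * fine (hmom 2 f)).

Lemma hmom_ge0 (n : nat) f : (forall x, 0 <= x -> 0 <= f x) -> (0 <= hmom n f)%E.
Proof.
move=> f0; apply: integral_ge0 => x /=; rewrite in_itv/= andbT => x0.
by rewrite lee_fin mulr_ge0 ?exprn_ge0 ?f0.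
Qed.

Lemma le_hmom (n : nat) f g : measurable_fun setT f -> measurable_fun setT g ->
  (forall x, 0 <= x -> 0 <= f x) -> (forall x, 0 <= x -> f x <= g x) ->
  (hmom n f <= hmom n g)%E.
Proof.
move=> mf mg f0 fg; apply: ge0_le_integral => //.
- by move=> x /=; rewrite in_itv/= andbT => x0; rewrite lee_fin mulr_ge0 ?exprn_ge0 ?f0.
- exact: measurable_monom.
- exact: measurable_monom.
- move=> x /=; rewrite in_itv/= andbT => x0.
  by rewrite lee_fin ler_wpM2l ?exprn_ge0 ?fg.
Qed.

Lemma profile_gt0 f : profile f -> 0 < f 0.
Proof.
move=> [mf f0 dec _ m0]; rewrite lt_neqAle f0 andbT; apply/eqP => fz.
have : hmom 0 f = 0%E.
  rewrite /hmom; apply: integral0_eq => x /=; rewrite in_itv/= andbT => x0.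
  have -> : f x = 0 by apply/eqP; rewrite eq_le f0 andbT fz dec.
  by rewrite mulr0.
by rewrite m0 => -[]; lra.
Qed.

Lemma hmom0_cst_gt c r : 0 < c -> 0 <= r -> (forall f, measurable_fun setT f ->
  (forall x, 0 <= x -> c <= f x) -> ((c * r)%:E <= hmom 0 f)%E).
Proof.
move=> c0 r0 f mf fc; have [<- _] := hmom_trunc_exp_uniform (ltW c0) r0.
apply: le_hmom => //; first exact: measurable_trunc_exp.
- by move=> x _; exact/trunc_exp_ge0/ltW.
- move=> x x0; rewrite /trunc_exp; case: ifP => _.
    by rewrite mul0r oppr0 expR0 mulr1 fc.
  by rewrite (le_trans (ltW c0))// fc.
Qed.

(** Finite mass forces a drop below [f 0] at some [x1], and log-concavity carries the average decay
    rate on [[0, x1]] beyond [x1]. *)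
Lemma profile_decay f : profile f ->
  exists C s, [/\ 0 <= C, 0 < s & forall x, 0 <= x -> f x <= C * expR (- (s * x))].
Proof.
move=> pf; have fz := profile_gt0 pf; have [mf f0 dec lc m0] := pf.
have [x1 x10 fx1] : exists2 x1, 0 < x1 & f x1 < f 0.
  apply: contrapT => hn.
  have fc x : 0 <= x -> f 0 <= f x.
    rewrite le_eqVlt => /predU1P[<-//|x0]; rewrite leNgt; apply/negP => fx.
    by apply: hn; exists x.
  have r0 : 0 <= (f 0)^-1 by rewrite invr_ge0 ltW.
  have := hmom0_cst_gt fz r0 mf fc.
  by rewrite m0 divff ?gt_eqF// lee_fin; lra.
(* If [f x1 = 0], then [f] vanishes beyond [x1] and any rate will do. *)
pose s := if f x1 == 0 then 1 else (ln (f 0) - ln (f x1)) / x1.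
have s0 : 0 < s.
  rewrite /s; case: eqP => // /eqP fn0.
  have fp : 0 < f x1 by rewrite lt_neqAle eq_sym fn0 f0.
  by rewrite divr_gt0// subr_gt0 ltr_ln ?posrE.
exists (f 0 * expR (s * x1)), s; split => //.
  by rewrite mulr_ge0 ?expR_ge0.
move=> x x0; rewrite -mulrA -expRD.
have [xx1|x1x] := leP x x1.
  apply: (le_trans (dec _ _ (lexx 0) x0)); rewrite ler_peMr// -[leLHS]expR0 ler_expR.
  by rewrite subr_ge0 ler_pM2l.
have [fx|fx] := ltP 0 (f x); last first.
  by apply: (le_trans fx); rewrite mulr_ge0 ?expR_ge0.
have fp : 0 < f x1 by rewrite (lt_le_trans fx)// dec// ltW.
have [_] := ln_concave_slopes lc x10 x1x fz fx.
rewrite subr0 => h.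
have sE : s = (ln (f 0) - ln (f x1)) / x1 by rewrite /s gt_eqF.
rewrite -sE ler_pdivlMr ?subr_gt0// in h.
rewrite -ler_ln ?posrE ?mulr_gt0 ?expR_gt0// lnM ?posrE ?expR_gt0// expRK.
have : ln (f x1) <= ln (f 0) by rewrite ler_ln ?posrE// ltW.
lra.
Qed.

Lemma profile_hmom2_fin f : profile f -> hmom 2 f \is a fin_num.
Proof.
move=> pf; have [C [s [C0 s0 fC]]] := profile_decay pf.
have [mf f0 dec lc m0] := pf.
have f0' x : 0 <= x -> 0 <= f x by [].
rewrite ge0_fin_numE ?hmom_ge0//.
apply: (@le_lt_trans _ _ (hmom 2 (plateau C s 0))); last first.
  by rewrite hmom2_plateau// ltry.
apply: le_hmom => //; first exact: measurable_plateau.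
move=> x x0; rewrite /plateau subr0; case: ifP => xz; last exact: fC.
by apply: (le_trans (fC _ x0)); rewrite ler_piMr// expR_le1 oppr_le0 mulr_ge0// ltW.
Qed.

Lemma sqr_hsd f : profile f -> hmom 2 f = (hsd f ^+ 2 / 2)%:E.
Proof.
move=> pf; have [_ f0 _ _ _] := pf.
have h : 0 <= fine (hmom 2 f) by rewrite fine_ge0// hmom_ge0.
rewrite /hsd sqr_sqrtr ?mulr_ge0// mulrAC divff ?mul1r ?fineK//.
exact: profile_hmom2_fin.
Qed.

Lemma hsd_ge0 f : 0 <= hsd f.
Proof. exact: sqrtr_ge0. Qed.

Lemma profile_crossing_le f g z v : profile f -> measurable_fun setT g ->
  (forall x, 0 <= x -> 0 <= g x) -> 0 <= z ->
  (forall x, 0 <= x -> x < z -> f x <= g x) -> (forall x, z < x -> g x <= f x) ->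
  hmom 0 g = (1 / 2)%:E -> hmom 2 g = v%:E -> 2 * v <= hsd f ^+ 2.
Proof.
move=> pf mg g0 z0 lo hi g1 gv; have [mf f0 _ _ m0] := pf.
have := hmom2_crossing mg mf g0 (fun x _ => f0 x) z0 lo hi.
by rewrite g1 m0 => /(_ erefl (ltry _)); rewrite gv sqr_hsd// lee_fin; lra.
Qed.

Lemma profile_crossing_ge f g z v : profile f -> measurable_fun setT g ->
  (forall x, 0 <= x -> 0 <= g x) -> 0 <= z ->
  (forall x, 0 <= x -> x < z -> g x <= f x) -> (forall x, z < x -> f x <= g x) ->
  hmom 0 g = (1 / 2)%:E -> hmom 2 g = v%:E -> hsd f ^+ 2 <= 2 * v.
Proof.
move=> pf mg g0 z0 lo hi g1 gv; have [mf f0 _ _ m0] := pf.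
have := hmom2_crossing mf mg (fun x _ => f0 x) g0 z0 lo hi.
by rewrite g1 m0 => /(_ erefl (ltry _)); rewrite gv sqr_hsd// lee_fin; lra.
Qed.

Lemma trunc_exp_out c s b x : b < x -> trunc_exp c s b x = 0.
Proof. by move=> bx; rewrite /trunc_exp leNgt bx. Qed.

(** Among profiles bounded by [y], the uniform one of height [y] is the most concentrated: it lies
    above [f] up to its end [r] and below it afterwards. *)
Lemma profile_uniform_ge f y : profile f -> 0 < y -> (forall x, 0 <= x -> f x <= y) ->
  1 / (2 * Num.sqrt 3) <= hsd f * y.
Proof.
move=> pf y0 fy; have s3 : 0 < Num.sqrt 3 :> R by rewrite sqrtr_gt0.
have s33 : Num.sqrt 3 ^+ 2 = 3 :> R by rewrite sqr_sqrtr.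
pose r := 1 / (2 * y); have r0 : 0 <= r by rewrite divr_ge0 ?mulr_ge0 ?(ltW y0).
have [_ f0 _ _ _] := pf.
have [u0 u2] := hmom_trunc_exp_uniform (ltW y0) r0.
have := @profile_crossing_le f (trunc_exp y 0 r) r _ pf (measurable_trunc_exp _ _ _)
  (fun x _ => trunc_exp_ge0 _ _ _ (ltW y0)) r0 _ _ _ u2.
have yr : y * r = 1 / 2 by rewrite /r; field; rewrite gt_eqF.
rewrite u0 yr => h.
have {}h : 2 * (y * (r ^+ 3 / 3)) <= hsd f ^+ 2.
  apply: h => //.
  - by move=> x x0 xr; rewrite /trunc_exp (ltW xr) mul0r oppr0 expR0 mulr1 fy.
  - by move=> x rx; rewrite trunc_exp_out.
rewrite -(@ler_pXn2r _ 2)// ?nnegrE ?mulr_ge0 ?hsd_ge0 ?divr_ge0 ?mulr_ge0 ?(ltW s3) ?(ltW y0)//.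
rewrite [leRHS]exprMn [leLHS]expr_div_n expr1n exprMn s33.
have := ler_wpM2r (exprn_ge0 2 (ltW y0)) h.
rewrite (_ : 2 * _ * _ = 2 / 3 * (y * r) ^+ 3); last by ring.
by rewrite yr; lra.
Qed.

Lemma hsd_gt0 f : profile f -> 0 < hsd f.
Proof.
move=> pf; have fz := profile_gt0 pf; have [_ _ dec _ _] := pf.
have := profile_uniform_ge pf fz (fun x => dec _ _ (lexx 0)).
move=> h; rewrite lt_neqAle hsd_ge0 andbT; apply/eqP => e0.
by move: h; rewrite -e0 mul0r leNgt divr_gt0// mulr_gt0// sqrtr_gt0.
Qed.

(** A nonincreasing profile living on [[0, r]] crosses the uniform one there only once, from above.
    This places [t sigma] inside the support for [t < sqrt 3]. *)
Lemma profile_support f r : profile f -> 0 < r -> (forall x, r < x -> f x = 0) ->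
  hsd f ^+ 2 <= r ^+ 2 / 3.
Proof.
move=> pf r0 fr; have [_ f0 dec _ _] := pf.
pose c := 1 / (2 * r); have c0 : 0 <= c by rewrite divr_ge0 ?mulr_ge0 ?(ltW r0).
have [z [z0 zr lo hi]] := level_crossing c dec (ltW r0).
have [u0 u2] := hmom_trunc_exp_uniform c0 (ltW r0).
have cr : c * r = 1 / 2 by rewrite /c; field; rewrite gt_eqF.
have := @profile_crossing_ge f (trunc_exp c 0 r) z _ pf (measurable_trunc_exp _ _ _)
  (fun x _ => trunc_exp_ge0 _ _ _ c0) z0 _ _ _ u2.
rewrite u0 cr => h.
have {}h : hsd f ^+ 2 <= 2 * (c * (r ^+ 3 / 3)).
  apply: h => //.
  - move=> x x0 xz; rewrite /trunc_exp; case: ifP => // _.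
    by rewrite mul0r oppr0 expR0 mulr1 lo.
  - move=> x zx; have [xr|xr] := leP x r; last by rewrite trunc_exp_out// fr.
    by rewrite /trunc_exp xr mul0r oppr0 expR0 mulr1; exact: hi.
apply: (le_trans h).
by rewrite (_ : 2 * _ = 2 / 3 * (c * r) * r ^+ 2); [rewrite cr; lra|ring].
Qed.

Lemma profile_gentle_slope f t s M : profile f -> 0 < t ->
  0 < s -> s * (t * hsd f) <= 1 ->
  (forall x, 0 <= x -> f x <= f (t * hsd f) * expR (- (s * (x - t * hsd f)))) ->
  (forall b, 0 < b -> M <= trunc_laplace_value t b) ->
  M <= hsd f * f (t * hsd f).
Proof.
move=> pf t0 s0 st1 fs hM; have sd0 := hsd_gt0 pf; have [mf f0 _ _ m0] := pf.
set x0 := t * hsd f in st1 fs *; set y := f x0 in fs *.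
pose c := y * expR (s * x0).
have fc x : 0 <= x -> f x <= c * expR (- (s * x)).
  move=> xp; apply: (le_trans (fs _ xp)); rewrite /c -mulrA -expRD.
  by rewrite (_ : - _ = s * x0 - s * x)//; ring.
have c0 : 0 <= c by rewrite mulr_ge0 ?expR_ge0 ?f0.
pose a := 2 * c / s.
have a1 : 1 <= a.
  have : (hmom 0 f <= hmom 0 (plateau c s 0))%E.
    apply: le_hmom => //; first exact: measurable_plateau.
    move=> x xp; rewrite /plateau subr0; case: ifP => xz; last exact: fc.
    by apply: (le_trans (fc _ xp)); rewrite ler_piMr// expR_le1 oppr_le0 mulr_ge0// ltW.
  by rewrite m0 hmom0_plateau// lee_fin add0r /a; lra.
have a0 : 0 < a by lra.
(* [a] is twice the mass of the majorant. Truncating the majorant itself to mass [1/2] means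
   [th = 1 / a], but for [a = 1] the truncation point would be infinite. So the truncated function
   gets the height [d = s / (2 th) >= c], with [th < 1], and [a th] is brought close to 1 only at
   the end. *)
have key th : 0 < th -> a * th <= 1 -> th < 1 -> a * th * M <= hsd f * y.
  move=> th0 ath th1; pose b := - ln (1 - th).
  have eb : expR (- b) = 1 - th by rewrite opprK lnK// posrE; lra.
  have b0 : 0 < b by rewrite oppr_gt0 ln_lt0//; lra.
  pose d := s / (2 * th).
  have d0 : 0 <= d by rewrite divr_ge0 ?mulr_ge0 ?(ltW s0) ?(ltW th0).
  have cd : c <= d.
    rewrite /d ler_pdivlMr ?mulr_gt0//.
    move: ath; rewrite /a mulrAC ler_pdivrMr//; lra.
  have sn0 : s != 0 by rewrite gt_eqF.
  have bs0 : 0 <= b / s by rewrite divr_ge0 ?(ltW b0) ?(ltW s0).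
  have sbs : s * (b / s) = b by rewrite mulrC divfK.
  have g0 := hmom0_trunc_exp d0 sn0 bs0; have g2 := hmom2_trunc_exp d0 sn0 bs0.
  rewrite sbs eb in g0 g2.
  have := @profile_crossing_le f (trunc_exp d s (b / s)) (b / s) _ pf
    (measurable_trunc_exp _ _ _) (fun x _ => trunc_exp_ge0 _ _ _ d0) bs0 _ _ _ g2.
  rewrite g0 (_ : d * _ / s = 1 / 2); last by rewrite /d; field; rewrite sn0 gt_eqF.
  move=> h.
  have {}h : (trunc_laplace_sd b / s) ^+ 2 <= hsd f ^+ 2.
    rewrite expr_div_n sqr_trunc_laplace_sd// /trunc_laplace_var eb.
    rewrite (_ : _ / s ^+ 2 = 2 * (d * (2 - (1 - th) * (b ^+ 2 + 2 * b + 2)) / s ^+ 3)); last first.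
      by rewrite /d; field; rewrite sn0 gt_eqF//; lra.
    apply: h => //.
    - move=> x xp xb; rewrite /trunc_exp (ltW xb); apply: (le_trans (fc _ xp)).
      by rewrite ler_wpM2r ?expR_ge0.
    - by move=> x bx; rewrite trunc_exp_out.
  have {}h : trunc_laplace_sd b <= s * hsd f.
    rewrite mulrC -ler_pdivrMr// -(@ler_pXn2r _ 2)// ?nnegrE ?hsd_ge0//.
    by rewrite divr_ge0 ?(ltW s0)// ltW ?trunc_laplace_sd_gt0.
  have tsd : t * (s * hsd f) <= 1 by rewrite mulrCA.
  have := mulr_expRN_incrM t0 (ltW (trunc_laplace_sd_gt0 b0)) h tsd.
  have -> : hsd f * y = a / 2 * (s * hsd f * expR (- (t * (s * hsd f)))).
    rewrite /a /c (_ : t * (s * hsd f) = s * x0); last by rewrite /x0; ring.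
    have e1 := expRxMexpNx_1 (s * x0).
    transitivity (hsd f * y * (expR (s * x0) * expR (- (s * x0)))); first by rewrite e1 mulr1.
    by field.
  move=> h2; apply: le_trans (_ : a / 2 * (trunc_laplace_sd b *
     expR (- (t * trunc_laplace_sd b))) <= _); last by rewrite ler_wpM2l// divr_ge0// ltW.
  apply: (@le_trans _ _ (a * th * trunc_laplace_value t b)).
    by rewrite ler_wpM2l ?hM// mulr_ge0 ?(ltW a0) ?(ltW th0).
  rewrite /trunc_laplace_value eb le_eqVlt; apply/orP; left; apply/eqP.
  by field; rewrite gt_eqF//; lra.
rewrite leNgt; apply/negP => lt.
have M0 : 0 < M by apply: le_lt_trans lt; rewrite mulr_ge0 ?f0 ?(ltW sd0).
pose q := hsd f * y / M.
have q0 : 0 <= q by rewrite divr_ge0 ?mulr_ge0 ?f0 ?(ltW sd0) ?(ltW M0).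
have q1 : q < 1 by rewrite ltr_pdivrMr// mul1r.
have qM : q * M = hsd f * y by rewrite /q divfK// gt_eqF.
(* [a th] is the midpoint of [q] and 1, so [key] would give [(1 + q) / 2 <= q]. *)
pose th := (1 + q) / 2 / a.
have ath : a * th = (1 + q) / 2 by rewrite /th mulrC divfK// gt_eqF.
have th0 : 0 < th by rewrite divr_gt0//; lra.
have th1 : th < 1 by rewrite ltr_pdivrMr//; lra.
by have := key th th0; rewrite ath -qM => /(_ _ th1); nra.
Qed.

Lemma le_laplace_value t M : (forall b, 0 < b -> M <= trunc_laplace_value t b) ->
  M <= expR (- (t * Num.sqrt 2)) / Num.sqrt 2.
Proof.
move=> hM; have cv := @trunc_laplace_value_cvgy R t.
rewrite -(cvg_lim _ cv)//; apply: limr_ge; first by apply/cvg_ex; eexists; exact: cv.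
by near=> b; apply: hM; near: b; apply: nbhs_pinfty_gt; rewrite num_real.
Unshelve. all: by end_near. Qed.

Lemma le_uniform_value t M : 0 <= t ->
  (forall b, 0 < b -> M <= trunc_laplace_value t b) -> M <= 1 / (2 * Num.sqrt 3).
Proof.
move=> t0 hM; have cv := trunc_laplace_value_cvg0 t0.
rewrite -(cvg_lim _ cv)//; apply: limr_ge; first by apply/cvg_ex; eexists; exact: cv.
by near=> b; apply: hM; near: b; exact: nbhs_right_gt.
Unshelve. all: by end_near. Qed.

(** Meant for the case [x0 * f x0 >= 1/4], where [sigma f x0 >= 1 / (4 t)] at once. With
    [u = t sqrt 2] it amounts to [2 u <= e^u]. *)
Lemma laplace_value_le t : 0 < t ->
  expR (- (t * Num.sqrt 2)) / Num.sqrt 2 <= 1 / (4 * t).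
Proof.
move=> t0; have s2 : 0 < Num.sqrt 2 :> R by rewrite sqrtr_gt0.
have s22 : Num.sqrt 2 * Num.sqrt 2 = 2 :> R by rewrite -expr2 sqr_sqrtr.
pose u := t * Num.sqrt 2; have u0 : 0 < u by rewrite mulr_gt0.
have e0 := expR_gt0 u.
have eu : 2 * u <= expR u.
  have := expR_ge_taylor5 (ltW u0).
  have pk k : 0 <= u ^+ k by rewrite exprn_ge0// ltW.
  by have := (pk 3, pk 4, pk 5)%N => -[[p3 p4] p5]; nra.
rewrite -/u expRN ler_pdivlMr ?mulr_gt0// -mulrA mulrC ler_pdivrMr//.
rewrite mul1r mulrC ler_pdivrMr//.
have : 4 * t = 2 * u * Num.sqrt 2 by rewrite /u; nra.
by move=> ->; rewrite ler_pM2r.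
Qed.

(** The supporting exponential, flattened on [[0, r]], has mass at least [1/2] for [r = 0] and at
    most [1/2] for [r = x0]; the intermediate value theorem gives [r]. *)
Lemma plateau_mass_eq y s x0 : 0 < s -> 0 <= x0 -> 1 / 2 <= y * expR (s * x0) / s ->
  y * (x0 + s^-1) <= 1 / 2 ->
  exists r, [/\ 0 <= r, r <= x0 & y * expR (s * (x0 - r)) * (r + s^-1) = 1 / 2].
Proof.
move=> s0 x00 m0 m1.
pose m r := y * expR (s * (x0 - r)) * (r + s^-1).
have cm : continuous m.
  move=> r; apply: cvgM.
    apply: cvgM; first exact: cvg_cst.
    have c1 : s * (x0 - r') @[r' --> r] --> s * (x0 - r).
      by apply: cvgM; [exact: cvg_cst|apply: cvgB; [exact: cvg_cst|exact: cvg_id]].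
    by apply: (@cvg_comp _ _ _ _ (@expR R) _ _ _ c1); exact: continuous_expR.
  by apply: cvgD; [exact: cvg_id|exact: cvg_cst].
have := @IVT R m 0 x0 (1 / 2) x00.
have mE0 : m 0 = y * expR (s * x0) / s by rewrite /m subr0 add0r.
have mE1 : m x0 = y * (x0 + s^-1) by rewrite /m subrr mulr0 expR0 mulr1.
case.
- exact: continuous_subspaceT.
- by rewrite mE0 mE1 ge_min le_max m1 m0 orbT.
- by move=> r; rewrite in_itv/= => /andP[r0 r1] mr; exists r.
Qed.

(** Everything is expressed by [rho = 1 + s r]: mass [1/2] fixes the height [s / (2 rho)], and the
    second moment gives [s sigma <= W] with [3 W^2 = rho^2 + 3 + 2 / rho]. The value [rho = 1] is
    the Laplace case [W = sqrt 2]. Since [W >= sqrt 2], the comparison with it is hardest at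
    [t = sqrt 3], where it becomes [plateau_log_ineq]. *)
Lemma profile_steep_slope f t s : profile f -> 0 < t -> t <= Num.sqrt 3 ->
  0 < s -> 1 < s * (t * hsd f) ->
  (forall x, 0 <= x -> f x <= f (t * hsd f) * expR (- (s * (x - t * hsd f)))) ->
  expR (- (t * Num.sqrt 2)) / Num.sqrt 2 <= hsd f * f (t * hsd f).
Proof.
move=> pf t0 t3 s0 st1 fs; have sd0 := hsd_gt0 pf; have [mf f0 dec _ m0] := pf.
set x0 := t * hsd f in st1 fs *; set y := f x0 in fs *.
have x00 : 0 < x0 by rewrite mulr_gt0.
(* When [y x0 < 1/4], the inequality [s^-1 <= x0] makes the plateau ending at [x0] have mass at most
   [1/2]. *)
have [yx|yx] := leP (1 / 4) (y * x0).
  apply: (le_trans (laplace_value_le t0)); rewrite ler_pdivrMr ?mulr_gt0//.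
  by move: yx; rewrite /x0; lra.
have m1 : y * (x0 + s^-1) <= 1 / 2.
  have : s^-1 <= x0 by rewrite -[leLHS]mul1r ler_pdivrMr// mulrC ltW.
  move=> /(ler_wpM2l (f0 x0)); rewrite -/y; lra.
have c0 : 0 <= y * expR (s * x0) by rewrite mulr_ge0 ?expR_ge0 ?f0.
have fc x : 0 <= x -> f x <= y * expR (s * x0) * expR (- (s * x)).
  move=> xp; apply: (le_trans (fs _ xp)); rewrite -mulrA -expRD.
  by rewrite (_ : - _ = s * x0 - s * x)//; ring.
have m2 : 1 / 2 <= y * expR (s * x0) / s.
  have : (hmom 0 f <= hmom 0 (plateau (y * expR (s * x0)) s 0))%E.
    apply: le_hmom => //; first exact: measurable_plateau.
    move=> x xp; rewrite /plateau subr0; case: ifP => xz; last exact: fc.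
    by apply: (le_trans (fc _ xp)); rewrite ler_piMr// expR_le1 oppr_le0 mulr_ge0// ltW.
  by rewrite m0 hmom0_plateau// lee_fin add0r.
have [r [r0 rx mr]] := plateau_mass_eq s0 (ltW x00) m2 m1.
set c := y * expR (s * (x0 - r)) in mr.
have cp : 0 <= c by rewrite mulr_ge0 ?expR_ge0 ?f0.
have [z [z0 zr lo hi]] := level_crossing c dec r0.
have p0 := hmom0_plateau cp s0 r0; have p2 := hmom2_plateau cp s0 r0.
have := @profile_crossing_ge f (plateau c s r) z _ pf (measurable_plateau _ _ _)
  (fun x _ => plateau_ge0 _ _ _ cp) z0 _ _ _ p2.
rewrite p0 mr => h.
have {}h : hsd f ^+ 2 <= 2 * (c * (r ^+ 3 / 3 + r ^+ 2 / s + 2 * r / s ^+ 2 + 2 / s ^+ 3)).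
  apply: h => //.
  - by move=> x xp xz; rewrite /plateau (le_trans (ltW xz))// lo.
  - move=> x zx; have [xr|xr] := leP x r; first by rewrite /plateau xr; exact: hi.
    rewrite /plateau [x <= r]leNgt xr /=; have xp : 0 <= x by lra.
    apply: (le_trans (fs _ xp)); rewrite /c -mulrA -expRD.
    by rewrite (_ : - _ = s * (x0 - r) + - (s * (x - r)))//; ring.
pose rho := 1 + s * r.
have rho1 : 1 <= rho by rewrite lerDl mulr_ge0// ltW.
have rho0 : 0 < rho by lra.
have cE : c = s / (2 * rho).
  have : c * rho = s / 2.
    transitivity (s * (c * (r + s^-1))); first by rewrite /rho; field; rewrite gt_eqF.
    by rewrite mr; ring.
  by move=> cr; rewrite -(@mulfK _ rho _ c) ?gt_eqF// cr; field; rewrite gt_eqF.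
have s3 : 0 < Num.sqrt 3 :> R by rewrite sqrtr_gt0.
have s33 : Num.sqrt 3 ^+ 2 = 3 :> R by rewrite sqr_sqrtr.
pose A := Num.sqrt (rho ^+ 2 + 3 + 2 / rho).
have Q0 : 0 <= rho ^+ 2 + 3 + 2 / rho.
  by rewrite !addr_ge0 ?sqr_ge0 ?divr_ge0 ?(ltW rho0).
have A2 : A ^+ 2 = rho ^+ 2 + 3 + 2 / rho by rewrite sqr_sqrtr.
have A0 : 0 < A.
  have q0 : 0 <= 2 / rho by rewrite divr_ge0// ltW.
  by rewrite sqrtr_gt0; have := sqr_ge0 rho; lra.
have sA : s * hsd f <= A / Num.sqrt 3.
  rewrite -(@ler_pXn2r _ 2)// ?nnegrE ?mulr_ge0 ?divr_ge0 ?hsd_ge0 ?(ltW s0) ?(ltW A0) ?(ltW s3)//.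
  rewrite exprMn expr_div_n s33 A2.
  apply: le_trans (ler_wpM2l (exprn_ge0 2 (ltW s0)) h) _.
  rewrite cE le_eqVlt; apply/orP; left; apply/eqP.
  by rewrite /rho; field; rewrite gt_eqF ?gt_eqF.
pose W := A / Num.sqrt 3.
have W0 : 0 < W by rewrite divr_gt0.
have tY : 1 <= t * (s * hsd f) by rewrite mulrCA ltW.
have tYW : t * (s * hsd f) <= t * W by rewrite ler_pM2l.
have WY : W * expR (- (t * W)) <= s * hsd f * expR (- (t * (s * hsd f))).
  by have := mulr_expRN_decr tY tYW; rewrite -!mulrA ler_pM2l.
have s2 : 0 < Num.sqrt 2 :> R by rewrite sqrtr_gt0.
have s22 : Num.sqrt 2 * Num.sqrt 2 = 2 :> R by rewrite -expr2 sqr_sqrtr.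
have s6 : Num.sqrt 6 = Num.sqrt 3 * Num.sqrt 2 :> R.
  by rewrite -sqrtrM//; congr Num.sqrt; ring.
have A6 : Num.sqrt 6 <= A.
  apply: ler_wsqrtr; have : 0 <= (rho - 1) * (rho * (rho + 1) - 2) / rho.
    by rewrite divr_ge0 ?mulr_ge0 ?(ltW rho0)//; nra.
  have -> : (rho - 1) * (rho * (rho + 1) - 2) / rho = rho ^+ 2 + 3 + 2 / rho - 6.
    by field; rewrite gt_eqF.
  by lra.
have AW : A = Num.sqrt 3 * W by rewrite /W mulrC divfK// gt_eqF.
have W2 : Num.sqrt 2 <= W by move: A6; rewrite s6 AW ler_pM2l.
have I3 := plateau_log_ineq rho1 (erefl A).
have -> : hsd f * y = expR (rho - 1) / (2 * rho) *
    (s * hsd f * expR (- (t * (s * hsd f)))).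
  have -> : t * (s * hsd f) = s * x0 by rewrite /x0; ring.
  have yE : y = c * expR (- (s * (x0 - r))).
    by rewrite /c -mulrA expRxMexpNx_1 mulr1.
  rewrite yE cE (_ : - (s * (x0 - r)) = (rho - 1) + - (s * x0)); last by rewrite /rho; ring.
  by rewrite expRD; field; rewrite gt_eqF.
have p1 : 0 <= expR (rho - 1) / (2 * rho).
  by rewrite divr_ge0 ?expR_ge0 ?mulr_ge0 ?(ltW rho0).
apply: le_trans (ler_wpM2l p1 WY).
have tW : t * (W - Num.sqrt 2) <= Num.sqrt 3 * (W - Num.sqrt 2).
  by rewrite ler_wpM2r// subr_ge0.
have : expR (t * (W - Num.sqrt 2)) <= A / Num.sqrt 6 / rho * expR (rho - 1).
  have s60 : 0 < Num.sqrt 6 :> R by rewrite sqrtr_gt0.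
  have Ap : 0 < A / Num.sqrt 6 by rewrite divr_gt0.
  have Ar : 0 < A / Num.sqrt 6 / rho by rewrite divr_gt0.
  rewrite -ler_ln ?posrE ?expR_gt0//; last by rewrite mulr_gt0// expR_gt0.
  rewrite expRK lnM ?posrE ?expR_gt0// expRK !ln_div ?posrE//.
  move: I3; rewrite s6 AW; lra.
move=> /(ler_wpM2r (expR_ge0 (- (t * W)))); rewrite -expRD.
rewrite (_ : t * (W - Num.sqrt 2) + _ = - (t * Num.sqrt 2)); last by ring.
move=> k; rewrite ler_pdivrMr//; apply: (le_trans k).
rewrite s6 AW le_eqVlt; apply/orP; left; apply/eqP.
transitivity (expR (rho - 1) / ((Num.sqrt 2 * Num.sqrt 2) * rho) * (W * expR (- (t * W))) * Num.sqrt 2).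
  by field; rewrite !gt_eqF.
by rewrite s22.
Qed.

(** The family decreases in [t], so a bound valid at [t] is valid at every [u <= t]. This permits
    approaching the endpoint from the left, where upper semicontinuity prevents a drop below the
    bound. *)
Lemma profile_value_ge f t M : profile f -> upper_semicontinuous f ->
  0 <= t <= Num.sqrt 3 -> (forall b, 0 < b -> M <= trunc_laplace_value t b) ->
  M <= hsd f * f (t * hsd f).
Proof.
move=> pf usc /andP[t0 t3] hM; have sd0 := hsd_gt0 pf; have [mf f0 dec lc m0] := pf.
have s3 : 0 < Num.sqrt 3 :> R by rewrite sqrtr_gt0.
have s33 : Num.sqrt 3 ^+ 2 = 3 :> R by rewrite sqr_sqrtr.
have interior u : 0 <= u -> u < Num.sqrt 3 -> u <= t -> M <= hsd f * f (u * hsd f).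
  move=> u0 u3 ut.
  have hMu b : 0 < b -> M <= trunc_laplace_value u b.
    by move=> b0; apply: (le_trans (hM _ b0)); exact: trunc_laplace_value_decr.
  set x0 := u * hsd f; have x00 : 0 <= x0 by rewrite mulr_ge0 ?hsd_ge0.
  (* Otherwise [f] would live on [[0, v sigma]] and [profile_support] would give [3 <= v^2]. Taking
     the maximum with 1 keeps the radius positive when [u = 0]. *)
  have [x1 x01 fx1] : exists2 x1, x0 < x1 & 0 < f x1.
    apply: contrapT => hn.
    pose v := Num.max u 1; have v1 : 1 <= v by rewrite le_max lexx orbT.
    have uv : u <= v by rewrite le_max lexx.
    have v3 : v ^+ 2 < 3.
      rewrite -s33 ltr_pXn2r// ?nnegrE ?(ltW s3)//; last by lra.
      rewrite gt_max u3/=.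
      rewrite -(@ltr_pXn2r _ 2)// ?nnegrE ?(ltW s3)// s33 expr1n; lra.
    have r0 : 0 < v * hsd f by rewrite mulr_gt0//; lra.
    have := profile_support pf r0; rewrite exprMn => /(_ _)/wrap[].
      move=> x xr; apply/eqP; rewrite eq_le f0 andbT leNgt; apply/negP => fx.
      apply: hn; exists x => //; apply: le_lt_trans xr.
      by rewrite ler_wpM2r ?hsd_ge0.
    have h2 : 0 < hsd f ^+ 2 by rewrite exprn_gt0.
    nra.
  have [s s0 fs] := ln_concave_supergradient f0 lc dec x00 x01 fx1.
  have fx0 : 0 < f x0 by rewrite (lt_le_trans fx1)// dec// ltW.
  have flat : (forall x, 0 <= x -> f x <= f x0) -> M <= hsd f * f x0.
    move=> h; apply: le_trans (profile_uniform_ge pf fx0 h).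
    exact: le_uniform_value hMu.
  have [u00|up] := eqVneq u 0.
    by apply: flat => x xp; rewrite /x0 u00 mul0r dec.
  have {}up : 0 < u by rewrite lt_neqAle eq_sym up.
  have [s00|sp] := eqVneq s 0.
    by apply: flat => x /fs; rewrite s00 mul0r oppr0 expR0 mulr1.
  have {}sp : 0 < s by rewrite lt_neqAle eq_sym sp.
  have [sx|sx] := leP (s * x0) 1; first exact: profile_gentle_slope sx fs hMu.
  apply: (le_trans (le_laplace_value hMu)).
  exact: profile_steep_slope (ltW u3) sp sx fs.
have [t3'|t3'] := ltP t (Num.sqrt 3); first exact: interior.
have tE : t = Num.sqrt 3 by apply/eqP; rewrite eq_le t3.
rewrite leNgt; apply/negP => lt.
have : f (t * hsd f) < M / hsd f by rewrite ltr_pdivlMr// mulrC.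
rewrite -ltrN2 -lte_fin => /usc [U /nbhs_ballP[e /= e0 eU] hU].
have x00 : 0 < t * hsd f by rewrite mulr_gt0// tE.
pose d := Num.min (e / 2) (t * hsd f).
have d0 : 0 < d by rewrite lt_min divr_gt0.
have de : d < e by rewrite gt_min; apply/orP; left; lra.
have dx : d <= t * hsd f by rewrite ge_min lexx orbT.
pose u := (t * hsd f - d) / hsd f.
have uE : u * hsd f = t * hsd f - d by rewrite /u divfK// gt_eqF.
have u0 : 0 <= u by rewrite divr_ge0 ?subr_ge0 ?hsd_ge0.
have ut : u < t by rewrite ltr_pdivrMr//; lra.
have := interior u u0 (lt_le_trans ut t3) (ltW ut).
have : U (u * hsd f).
  by apply: eU; rewrite /ball/= uE opprB addrC subrK gtr0_norm.
move=> /hU; rewrite lte_fin ltrN2 ltr_pdivlMr// mulrC => h.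
by rewrite leNgt h.
Qed.

End profile.

(** * Random variables with an even density *)

Section densities.
Context {R : realType}.
Implicit Types (f : R -> R) (x y r t m e u v : R).
Local Notation mu := (@lebesgue_measure R).

Import HBNNSimple.

(** The usual ascent from indicators to simple functions to monotone limits. *)
Lemma integral_density (nu : {measure set R -> \bar R}) f (g : R -> \bar R) :
  measurable_fun setT f -> (forall x, 0 <= f x) ->
  (forall A, measurable A -> nu A = (\int[mu]_(x in A) (f x)%:E)%E) ->
  measurable_fun setT g -> (forall x, 0 <= g x)%E ->
  (\int[nu]_x g x = \int[mu]_x (g x * (f x)%:E))%E.
Proof.
move=> mf f0 nuE mg g0.
have mEf : measurable_fun setT (EFin \o f) by exact/measurable_EFinP.
have indic E : measurable E ->
    (\int[nu]_x (\1_E x)%:E = \int[mu]_x ((\1_E x)%:E * (f x)%:E))%E.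
  move=> mE; rewrite integral_indic//= setIT nuE// integral_mkcond/=.
  apply: eq_integral => x _; rewrite patchE indicE.
  by case: ifPn => xE; rewrite ?mul1e ?mul0e.
have nnsfun (h : {nnsfun R >-> R}) :
    (\int[nu]_x (h x)%:E = \int[mu]_x ((h x)%:E * (f x)%:E))%E.
  under [LHS]eq_integral do rewrite fimfunE -fsumEFin//.
  rewrite [LHS]ge0_integral_fsum//; last 2 first.
  - by move=> r; exact/measurable_EFinP/measurableT_comp.
  - by move=> n x _; rewrite EFinM nnfun_muleindic_ge0.
  under [RHS]eq_integral.
    move=> x xD; rewrite fimfunE -fsumEFin// muleC ge0_mule_fsumr; last first.
      by move=> r; rewrite EFinM nnfun_muleindic_ge0.
    over.
  rewrite [RHS]ge0_integral_fsum//; last 2 first.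
  - move=> r; apply: emeasurable_funM => //; apply/measurable_EFinP.
    apply: measurable_funM => //; apply: measurable_indic.
    exact: (measurable_sfunP h).
  - by move=> n x _; apply: mule_ge0; rewrite ?lee_fin// -lee_fin EFinM nnfun_muleindic_ge0.
  apply: eq_fsbigr => r _; rewrite integralZl_indic_nnsfun//= indic//.
  have [r0|r0] := leP 0 r.
    rewrite -ge0_integralZl//=.
    - by apply: eq_integral => x _; rewrite EFinM [RHS]muleC muleA.
    - apply: emeasurable_funM => //; apply/measurable_EFinP.
      by apply: measurable_indic; exact: (measurable_sfunP h).
    - by move=> x _; rewrite mule_ge0// lee_fin.
  rewrite preimage_nnfun0// !integral0_eq ?mule0//.
  - by move=> x _; rewrite indicE in_set0 mulr0 mule0.
  - by move=> x _; rewrite indicE in_set0 mul0e.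
pose g_ := nnsfun_approx measurableT mg.
have mg_ n : measurable_fun setT (fun x : R => (g_ n x)%:E).
  by apply/measurable_EFinP; exact: measurable_funPT.
have nd_ x (m n : nat) : (m <= n)%N -> g_ m x <= g_ n x.
  by move=> mn; exact/lefP/nd_nnsfun_approx.
transitivity (limn (fun n => \int[nu]_x (g_ n x)%:E)%E).
  rewrite -monotone_convergence//=.
  - apply: eq_integral => x _; apply/esym/cvg_lim => //.
    exact: cvg_nnsfun_approx.
  - by move=> n x _; rewrite lee_fin.
  - by move=> x _ m n mn; rewrite lee_fin; exact: nd_.
transitivity (limn (fun n => \int[mu]_x ((g_ n x)%:E * (f x)%:E))%E).
  by congr (limn _); apply/funext => n; exact: nnsfun.
rewrite -monotone_convergence//=.
- apply: eq_integral => x _; apply/cvg_lim => //.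
  have h : (g_ n x)%:E @[n --> \oo] --> g x by exact: cvg_nnsfun_approx.
  exact: cvgeZr.
- move=> n; apply: emeasurable_funM => //.
  exact: mg_.
- by move=> n x _; rewrite -EFinM lee_fin mulr_ge0//.
- move=> x _ m n mn; rewrite -!EFinM lee_fin ler_wpM2r//.
  exact: nd_.
Qed.

Lemma ge0_integral_opp (A : set R) (g : R -> \bar R) : measurable A ->
  measurable_fun setT g -> (forall x, 0 <= g x)%E ->
  (\int[mu]_(x in -%R @^-1` A) g (- x)%R = \int[mu]_(x in A) g x)%E.
Proof.
move=> mA mg g0.
have := @ge0_integral_pushforward _ _ (measurableTypeR R) (measurableTypeR R) R (-%R) _ mu A g.
move=> <-//; last exact: measurable_funTS.
by apply: eq_measure_integral => //= B mB _; exact: lebesgue_measureN.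
Qed.

Lemma ge0_integral_even (g : R -> \bar R) : measurable_fun setT g ->
  (forall x, 0 <= g x)%E -> (forall x, g (- x)%R = g x) ->
  (\int[mu]_x g x = 2%:E * \int[mu]_(x in `[0%R, +oo[) g x)%E.
Proof.
move=> mg g0 ev; have e : setT = `]-oo, 0]%classic `|` `]0, +oo[%classic :> set R.
  by rewrite -itv_bndbnd_setU// ?set_itv_infty_infty// set_itvNyy.
rewrite {1}e ge0_integral_setU//=; first last.
- apply/disj_setPS => x [] /=; rewrite !in_itv/= andbT => a b.
  by move: (le_lt_trans a b); rewrite ltxx.
- by rewrite -e.
rewrite integral_itv_obnd_cbnd; last exact: measurable_funTS.
have -> : (\int[mu]_(x in `]-oo, 0%R]) g x = \int[mu]_(x in `[0%R, +oo[) g x)%E.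
  rewrite ge0_integration_by_substitution0//.
  by apply: eq_integral => x _; rewrite ev.
by rewrite (_ : 2 = 1 + 1)%R// EFinD ge0_muleDl ?mul1e// lee_fin.
Qed.

(** [x] may be an endpoint of the support, so the interval is sought on the side of another support
    point [x1]: along that segment concavity bounds [ln f] below by an affine function. *)
Lemma ln_concave_near f x x1 m e : ln_concave f -> 0 < m -> m < f x -> x1 != x ->
  0 < f x1 -> 0 < e -> exists u v : R, [/\ u < v, x - e <= u, v <= x + e &
    forall y, u <= y -> y <= v -> m <= f y].
Proof.
move=> lc m0 mfx x1x fx1 e0; have fx := lt_trans m0 mfx.
set a := ln (f x); set b := ln (f x1).
have lma : ln m < a by rewrite ltr_ln.
have D0 : 0 < `|a - b| + 1 by rewrite ltr_wpDl.
have X0 : 0 < `|x1 - x| by rewrite normr_gt0 subr_eq0.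
pose l := Num.min 1 (Num.min (e / `|x1 - x|) ((a - ln m) / (`|a - b| + 1))).
have l0 : 0 < l by rewrite !lt_min ltr01/= !divr_gt0// subr_gt0.
have l1 : l <= 1 by rewrite ge_min lexx.
have le1 : l * `|x1 - x| <= e.
  by rewrite -ler_pdivlMr// !ge_min lexx !orbT.
have la : l * (`|a - b| + 1) <= a - ln m.
  by rewrite -ler_pdivlMr// !ge_min lexx !orbT.
have key (t : R) : 0 <= t -> t <= l -> m <= f (x + t * (x1 - x)).
  move=> t0 tl; have t1 := le_trans tl l1.
  have [] := lc x1 x t t0 t1 fx1 fx; rewrite -/a -/b.
  have -> : t * x1 + (1 - t) * x = x + t * (x1 - x) by ring.
  move=> fy h; rewrite -ler_ln ?posrE//; apply: le_trans h.
  have h1 : t * (a - b) <= l * (`|a - b| + 1).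
    apply: (@le_trans _ _ (t * (`|a - b| + 1))); last by rewrite ler_wpM2r// ltW.
    rewrite ler_wpM2l//; have := ler_norm (a - b); lra.
  lra.
have [xx1|x1x'|xe] := ltgtP x x1.
- have xx1' : 0 < x1 - x by rewrite subr_gt0.
  move: le1; rewrite gtr0_norm// => le1.
  exists x, (x + l * (x1 - x)); split; [|lra|lra|].
    by rewrite ltrDl mulr_gt0.
  move=> y xy yl; have -> : y = x + (y - x) / (x1 - x) * (x1 - x).
    by rewrite divfK ?gt_eqF//; ring.
  by apply: key; [rewrite divr_ge0//; lra|rewrite ler_pdivrMr//; lra].
- have xx1' : 0 < x - x1 by rewrite subr_gt0.
  move: le1; rewrite distrC gtr0_norm// => le1.
  exists (x - l * (x - x1)), x; split; [|lra|lra|].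
    by rewrite ltrBlDr ltrDl mulr_gt0.
  move=> y ly yx; have -> : y = x + (x - y) / (x - x1) * (x1 - x).
    by field; rewrite gt_eqF.
  by apply: key; [rewrite divr_ge0//; lra|rewrite ler_pdivrMr//; lra].
- by move: x1x; rewrite xe eqxx.
Qed.

(** Symmetry of the law alone controls integrals, not points. If [f (- x) < f x], log-concavity
    keeps [f] above [m] on an interval near [x], and upper semicontinuity keeps it below [m' < m] on
    the reflected interval; their integrals then differ. *)
Lemma even_density f : measurable_fun setT f -> (forall x, 0 <= f x) ->
  (\int[mu]_x (f x)%:E = 1)%E -> ln_concave f -> upper_semicontinuous f ->
  (forall A, measurable A ->
    (\int[mu]_(x in A) (f x)%:E = \int[mu]_(x in -%R @^-1` A) (f x)%:E)%E) ->
  forall x, f (- x) = f x.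
Proof.
move=> mf f0 f1 lc usc sym.
suff le x : f x <= f (- x) by move=> x; have := le (- x); rewrite opprK => h; apply/le_anti; rewrite le h.
rewrite leNgt; apply/negP => lt.
have fx : 0 < f x by apply: le_lt_trans lt.
(* A density positive at a single point would have integral 0. *)
have [x1 x1x fx1] : exists2 x1, x1 != x & 0 < f x1.
  apply: contrapT => no; move: f1.
  have -> : (\int[mu]_y (f y)%:E = \int[mu]_(y in [set x]) (f y)%:E)%E.
    rewrite [RHS]integral_mkcond/=; apply: eq_integral => y _; rewrite patchE.
    case: ifPn => // yx; congr EFin; apply/le_anti; rewrite f0 andbT leNgt.
    apply/negP => fy; apply: no; exists y => //.
    by apply: contra yx => /eqP ->; rewrite inE.
  by rewrite integral_set1 => -[] /esym/eqP; rewrite oner_eq0.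
pose m' := f (- x) + (f x - f (- x)) / 3; pose m := f (- x) + (f x - f (- x)) * 2 / 3.
have fN := f0 (- x).
have m'0 : 0 < m' by rewrite /m'; lra.
have mm : m' < m by rewrite /m /m'; lra.
have mfx : m < f x by rewrite /m; lra.
have [] := usc (- x) (- m'); first by rewrite lte_fin ltrN2 /m'; lra.
move=> V /nbhs_ballP[e /= e0 eV] Vm.
have e2 : 0 < e / 2 by rewrite divr_gt0.
have [u [v [uv xu vx fm]]] := ln_concave_near lc (lt_trans m'0 mm) mfx x1x fx1 e2.
have := sym `[u, v]%classic (measurable_itv _).
have mE : measurable_fun setT (EFin \o f) by exact/measurable_EFinP.
have A1 : ((m * (v - u))%:E <= \int[mu]_(x in `[u, v]) (f x)%:E)%E.
  apply: (@le_trans _ _ (\int[mu]_(x in `[u, v]) (cst m%:E) x)%E).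
    by rewrite integral_cst//= lebesgue_measure_itv/= lte_fin uv -EFinB -EFinM.
  apply: ge0_le_integral => //.
  - by move=> y _; rewrite lee_fin ltW// (lt_trans m'0).
  - exact: measurable_funTS.
  - by move=> y /=; rewrite in_itv/= => /andP[uy yv]; rewrite lee_fin fm.
have A2 : (\int[mu]_(x in -%R @^-1` `[u, v]) (f x)%:E <= (m' * (v - u))%:E)%E.
  have -> : -%R @^-1` `[u, v] = `[- v, - u]%classic :> set R.
    by rewrite opp_preimage_itvbndbnd.
  apply: (@le_trans _ _ (\int[mu]_(x in `[(- v)%R, (- u)%R]) (cst m'%:E) x)%E).
    apply: ge0_le_integral => //.
    - by move=> y _; rewrite lee_fin f0.
    - exact: measurable_funTS.
    - move=> y /=; rewrite in_itv/= => /andP[vy yu]; rewrite lee_fin ltW//.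
      rewrite -ltrN2 -lte_fin; apply: Vm; apply: eV; rewrite /ball/= ltr_norml.
      by apply/andP; split; lra.
  rewrite integral_cst//= lebesgue_measure_itv/= lte_fin ltrN2 uv -EFinB -EFinM.
  by rewrite opprK addrC lexx.
move=> E; move: (le_trans A1 (eq_ind_r (fun z => (z <= _)%E) A2 E)).
by rewrite lee_fin ler_pM2r ?subr_gt0// leNgt mm.
Qed.

End densities.

(** * From the random variables of the class to profiles *)

Section random_variables.
Context {R : realType} {d : measure_display} {T : measurableType d}.
Variable P : probability T R.
Implicit Types (X : {RV P >-> R}) (f : R -> R).
Local Notation mu := (@lebesgue_measure R).

Lemma ge0_integral_density X f (g : R -> \bar R) : has_density X f ->
  measurable_fun setT g -> (forall x, 0 <= g x)%E ->
  (\int[P]_w g (X w) = \int[mu]_x (g x * (f x)%:E))%E.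
Proof.
move=> [mf f0 fE] mg g0; rewrite -(@integral_density R (distribution P X) f g)//.
by rewrite ge0_integral_distribution.
Qed.

Lemma integral_density1 X f : has_density X f -> (\int[mu]_x (f x)%:E = 1)%E.
Proof. by move=> [mf f0 <-//]; exact: probability_setT. Qed.

Lemma integral_sqr_even f : measurable_fun setT f -> (forall x, 0 <= f x) ->
  (forall x, f (- x) = f x) ->
  (\int[mu]_x ((x ^+ 2)%:E * (f x)%:E) = 2%:E * hmom 2 f)%E.
Proof.
move=> mf f0 ev; rewrite ge0_integral_even//.
- exact: measurable_monom.
- by move=> x; rewrite -EFinM lee_fin mulr_ge0// sqr_ge0.
- by move=> x; rewrite ev sqrrN.
Qed.

Lemma expectation_even X f : has_density X f -> (forall x, f (- x) = f x) ->
  hmom 2 f \is a fin_num -> ('E_P[X] = 0)%E.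
Proof.
move=> Xf ev m2; have [mf f0 _] := Xf.
have mE : measurable_fun setT (EFin \o f) by exact/measurable_EFinP.
(* Evenness makes the integrals of the positive and negative parts equal; they cancel because
   [max x 0 <= 1 + x^2] makes them finite. *)
rewrite expectation_def integralE.
pose p (x : R) : \bar R := (Num.max x 0)%:E.
have mp : measurable_fun setT p.
  by apply/measurable_EFinP; exact: measurable_maxr.
have p0 (x : R) : (0 <= p x)%E by rewrite lee_fin le_max lexx orbT.
have mpN : measurable_fun setT (fun x : R => p (- x)).
  by apply: (measurableT_comp mp); exact: oppr_measurable.
have -> : (\int[P]_w (fun w => (X w)%:E)^\+ w = \int[mu]_x (p x * (f x)%:E))%E.
  by rewrite -(ge0_integral_density Xf)//; apply: eq_integral => w _; rewrite funeposE /p EFin_max.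
have -> : (\int[P]_w (fun w => (X w)%:E)^\- w = \int[mu]_x (p x * (f x)%:E))%E.
  transitivity (\int[P]_w p (- X w)%R)%E.
    by apply: eq_integral => w _; rewrite funenegE /p EFin_max.
  rewrite (ge0_integral_density (g := fun x => p (- x)) Xf)//.
  rewrite -(@ge0_integral_opp R setT (fun x => p x * (f x)%:E)%E)//.
  - by rewrite preimage_setT; apply: eq_integral => x _; rewrite ev.
  - exact: emeasurable_funM.
  - by move=> x; rewrite mule_ge0// lee_fin.
rewrite subee// ge0_fin_numE; last first.
  by apply: integral_ge0 => x _; rewrite mule_ge0// lee_fin.
have m2' : measurable_fun setT (fun x : R => (x ^+ 2)%:E * (f x)%:E)%E.
  exact: measurable_monom.
apply: (@le_lt_trans _ _ (\int[mu]_x ((f x)%:E + (x ^+ 2)%:E * (f x)%:E))%E).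
  apply: ge0_le_integral => //.
  - by move=> x _; rewrite mule_ge0// lee_fin.
  - exact: emeasurable_funM.
  - exact: emeasurable_funD.
  - move=> x _; rewrite -!EFinM -EFinD lee_fin -[X in _ <= X + _]mul1r -mulrDl.
    rewrite ler_wpM2r// ge_max; apply/andP; split; last by rewrite addr_ge0// sqr_ge0.
    have := sqr_ge0 (x - 1); rewrite !expr2; have := sqr_ge0 x; rewrite expr2; lra.
rewrite ge0_integralD//; first last.
- by move=> x _; rewrite -EFinM lee_fin mulr_ge0// sqr_ge0.
- by move=> x _; rewrite lee_fin.
rewrite (integral_density1 Xf) integral_sqr_even// -(fineK m2) -EFinM -EFinD.
exact: ltry.
Qed.

Lemma stddev_even X f : has_density X f -> (forall x, f (- x) = f x) ->
  hmom 2 f \is a fin_num -> stddev X = hsd f.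
Proof.
move=> Xf ev m2; have [mf f0 _] := Xf.
have mE : measurable_fun setT (EFin \o f) by exact/measurable_EFinP.
rewrite /stddev /variance unlock (expectation_even Xf ev m2) unlock/=.
have -> : (\int[P]_w (((X \- cst 0) * (X \- cst 0)) w)%:E = 2%:E * hmom 2 f)%E.
  rewrite -integral_sqr_even// -(ge0_integral_density (g := fun x => (x ^+ 2)%:E) Xf)//.
  - by apply: eq_integral => w _; rewrite mulrfctE /= !subr0 -expr2.
  - by apply/measurable_EFinP; exact: exprn_measurable.
  - by move=> x; rewrite lee_fin sqr_ge0.
by rewrite -(fineK m2) -EFinM.
Qed.

Lemma symmetric_rv_even X f : has_density X f -> (forall x, f (- x) = f x) ->
  symmetric_rv X.
Proof.
move=> [mf f0 fE] ev A mA.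
have -> : pushforward P (\- X) A = distribution P X (-%R @^-1` A) by [].
have mNA : measurable (-%R @^-1` A : set R).
  by rewrite -[X in measurable X]setTI; exact: oppr_measurable.
rewrite !fE// -(@ge0_integral_opp R A (fun x => (f x)%:E))//.
- by apply: eq_integral => x _; rewrite ev.
- exact/measurable_EFinP.
Qed.

Lemma symmetric_log_concave_even X f : symmetric_log_concave X f ->
  forall x, f (- x) = f x.
Proof.
move=> [_ sX Xf lc usc]; have [mf f0 fE] := Xf.
apply: (even_density mf f0 (integral_density1 Xf) (log_concave_ln lc) usc) => A mA.
have mNA : measurable (-%R @^-1` A : set R).
  by rewrite -[X in measurable X]setTI; exact: oppr_measurable.
by rewrite -!fE//; exact: sX.
Qed.

Lemma hmom0_even f : measurable_fun setT f -> (forall x, 0 <= f x) ->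
  (forall x, f (- x) = f x) ->
  (\int[mu]_x (f x)%:E = 2%:E * hmom 0 f)%E.
Proof.
move=> mf f0 ev; rewrite ge0_integral_even//; first last.
- by move=> x; rewrite ev.
- exact/measurable_EFinP.
by congr (_ * _)%E; apply: eq_integral => x _; rewrite expr0 mul1r.
Qed.

Lemma symmetric_log_concave_profile X f : symmetric_log_concave X f -> profile f.
Proof.
move=> Xf; have ev := symmetric_log_concave_even Xf.
have [_ sX hf lc usc] := Xf; have [mf f0 fE] := hf.
split => //; [|exact: log_concave_ln|].
  by apply: even_ln_concave_nonincreasing => //; exact: log_concave_ln.
have := integral_density1 hf; rewrite hmom0_even//.
case: (hmom 0 f) => [r| |]//=.
- rewrite -EFinM => -[h]; congr EFin; lra.
- by rewrite mulry gtr0_sg// mul1e.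
- by rewrite mulrNy gtr0_sg// mul1e.
Qed.

Lemma scaled_densityE X f t : symmetric_log_concave X f ->
  scaled_density X f t = hsd f * f (t * hsd f).
Proof.
move=> Xf; rewrite /scaled_density.
have [_ _ hf _ _] := Xf; rewrite (stddev_even hf)//.
  exact: symmetric_log_concave_even Xf.
exact: profile_hmom2_fin (symmetric_log_concave_profile Xf).
Qed.

Lemma density_not_ae0 X f : has_density X f -> ~ {ae P, forall w, X w = 0}.
Proof.
move=> [mf f0 fE] X0; have mA : measurable (X @^-1` [set 0]).
  by rewrite -[X in measurable X]setTI; exact: measurable_funPT.
have PA : P (X @^-1` [set 0]) = 0%E.
  by have := fE [set 0] (measurable_set1 _); rewrite integral_set1.
have : P (~` (X @^-1` [set 0])) = 0%E.
  by apply/negligibleP => //; exact: measurableC.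
by rewrite probability_setC// PA sube0 => -[] /eqP; rewrite oner_eq0.
Qed.

Lemma symmetric_log_concaveI X f : has_density X f -> (forall x, f (- x) = f x) ->
  log_concave f -> upper_semicontinuous f -> symmetric_log_concave X f.
Proof.
move=> Xf ev lc usc; split => //; first exact: density_not_ae0 Xf.
exact: symmetric_rv_even Xf ev.
Qed.

End random_variables.

(** * Realising a given density by a random variable *)

Section density_measure.
Context {R : realType}.
Local Notation mu := (@lebesgue_measure R).
Context (f : R -> R) (mf : measurable_fun setT f) (f0 : forall x, 0 <= f x)
  (f1 : (\int[mu]_x (f x)%:E = 1)%E).

(* The proofs are arguments so that the probability structure below can be
   inferred from the term. *)
Definition density_measure of measurable_fun setT f & (forall x, 0 <= f x) &
    (\int[mu]_x (f x)%:E = 1)%E : set (measurableTypeR R) -> \bar R :=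
  fun A => (\int[mu]_(x in A) (f x)%:E)%E.

Local Notation nu := (density_measure mf f0 f1).

Let nu0 : nu set0 = 0%E.
Proof. by rewrite /density_measure integral_set0. Qed.

Let nu_ge0 A : (0 <= nu A)%E.
Proof. by apply: integral_ge0 => x _; rewrite lee_fin. Qed.

Let nu_sigma_additive : semi_sigma_additive nu.
Proof.
move=> F mF tF mUF; rewrite /density_measure; apply: cvg_toP.
  apply: ereal_nondecreasing_is_cvgn => m n mn.
  apply: lee_sum_nneg_natr => // k _ _.
  by apply: integral_ge0 => x Fkx; rewrite lee_fin.
rewrite ge0_integral_bigcup//=.
- by apply: measurable_funTS; exact/measurable_EFinP.
- by move=> x _; rewrite lee_fin.
Qed.

HB.instance Definition _ := isMeasure.Build _ _ _ nu nu0 nu_ge0 nu_sigma_additive.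

Let nu_setT : nu [set: _] = 1%E.
Proof. exact: f1. Qed.

HB.instance Definition _ := @Measure_isProbability.Build _ _ R nu nu_setT.

Let idR : measurableTypeR R -> R := idfun.

HB.instance Definition _ :=
  @isMeasurableFun.Build _ _ _ _ idR (@measurable_id _ _ setT).

Lemma exists_density : exists (d : measure_display) (T : measurableType d)
  (P : probability T R) (X : {RV P >-> R}), has_density X f.
Proof.
exists _, (measurableTypeR R), nu, (idR : {RV nu >-> R}); split => //.
Qed.

End density_measure.

(** * Two-sided exponentials restricted to a set *)

Section sym_exp.
Context {R : realType}.
Implicit Types (D : set R) (x y c s t a : R).

(** One shape for three laws: truncated Laplace and uniform on an interval, with [s = 1] and
    [s = 0], and Laplace on the whole line. *)
Definition sym_exp D c s x := c * expR (- (s * `|x|)) * \1_D x.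

Lemma sym_exp_ge0 D c s x : 0 <= c -> 0 <= sym_exp D c s x.
Proof. by move=> c0; rewrite !mulr_ge0 ?expR_ge0. Qed.

Lemma continuous_expR_norm c s : continuous (fun x => c * expR (- (s * `|x|)) : R).
Proof.
move=> x; apply: cvgM; first exact: cvg_cst.
apply: continuous_comp; last exact: continuous_expR.
by apply: cvgN; apply: cvgM; [exact: cvg_cst|exact: norm_continuous].
Qed.

Lemma measurable_sym_exp D c s : measurable D -> measurable_fun setT (sym_exp D c s).
Proof.
move=> mD; apply: measurable_funM; last exact: measurable_indic.
exact: continuous_measurable_fun (@continuous_expR_norm c s).
Qed.

Lemma sym_exp_even D c s x : (forall y, D y -> D (- y)) ->
  sym_exp D c s (- x) = sym_exp D c s x.
Proof.
move=> DN; rewrite /sym_exp normrN; congr (_ * _); rewrite !indicE.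
congr (_%:R); congr nat_of_bool; apply/idP/idP; rewrite !inE; last exact: DN.
by move=> /DN; rewrite opprK.
Qed.

Lemma log_concave_sym_exp D c s : 0 < c -> 0 <= s ->
  (forall x y t, 0 <= t -> t <= 1 -> D x -> D y -> D (t * x + (1 - t) * y)) ->
  log_concave (sym_exp D c s).
Proof.
move=> c0 s0 cD; pose V x : \bar R :=
  if x \in D then (s * `|x| - ln c)%:E else +oo%E.
exists V; split; last first.
  move=> x; rewrite /sym_exp /V indicE; case: ifPn => xD/=; last by rewrite mulr0.
  by rewrite mulr1 opprB expRD lnK.
split=> [x|x y t t0 t1]; first by rewrite /V; case: ifP.
have u0 : 0 <= 1 - t by rewrite subr_ge0.
(* At [t = 0] and [t = 1] the convention [0 * +oo = 0] is at work; for other [t] an infinite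
   potential makes the right side infinite. *)
have [->|tp] := eqVneq t 0.
  by rewrite subr0 !mul0r !mul0e !mul1e add0r add0e mul1r.
have [->|tn] := eqVneq t 1.
  by rewrite subrr !mul0r !mul0e !mul1e addr0 adde0 mul1r.
have tgt : 0 < t by rewrite lt_neqAle eq_sym tp.
have ugt : 0 < 1 - t by rewrite subr_gt0 lt_neqAle tn.
rewrite /V; case: (ifPn (x \in D)) => xD; last first.
  rewrite gt0_muley ?lte_fin// addye ?leey//.
  by case: ifP => _; rewrite ?gt0_muley ?lte_fin// -EFinM.
case: (ifPn (y \in D)) => yD; last by rewrite gt0_muley ?lte_fin// -EFinM addey// leey.
rewrite mem_set; last by apply: cD => //; [rewrite -in_setE|rewrite -in_setE].
rewrite -!EFinM -EFinD lee_fin.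
have := ler_normD (t * x) ((1 - t) * y); rewrite !normrM !(ger0_norm t0) !(ger0_norm u0).
move=> /(ler_wpM2l s0); lra.
Qed.

(** On [D] the function agrees with a continuous one that dominates it everywhere; off the closed
    set [D] it vanishes on a neighbourhood. *)
Lemma upper_semicontinuous_sym_exp D c s : 0 <= c -> closed D ->
  upper_semicontinuous (sym_exp D c s).
Proof.
move=> c0 cD x a; rewrite lte_fin /sym_exp indicE => ax.
have [xD|xD] := boolP (x \in D); last first.
  exists (~` D); first by apply: open_nbhs_nbhs; split; [exact: closed_openC|rewrite notin_setE in xD].
  move=> y yD; rewrite lte_fin indicE memNset// mulr0 oppr0.
  by move: ax; rewrite (negbTE xD) mulr0 oppr0.
move: ax; rewrite xD mulr1 => ax.
exists [set y | a < - (c * expR (- (s * `|y|)))].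
  have := @continuous_expR_norm c s x.
  move=> /cvgN; move/cvgr_gt; apply; exact: ax.
move=> y /= ay; rewrite lte_fin indicE; apply: (lt_le_trans ay).
rewrite lerN2 ler_piMr// ?mulr_ge0 ?expR_ge0//.
by case: (y \in D).
Qed.

End sym_exp.

(** * The truncated Laplace, uniform and Laplace laws *)

Section members.
Context {R : realType}.
Implicit Types (x y b c s t a : R) (f g : R -> R).

Lemma eq_hmom (n : nat) f g : (forall x, 0 <= x -> f x = g x) -> hmom n f = hmom n g.
Proof.
move=> fg; apply: eq_integral => x; rewrite inE/= in_itv/= andbT => x0.
by rewrite fg.
Qed.

Lemma sym_exp_itvE b c s x : 0 <= x -> sym_exp `[- b, b] c s x = trunc_exp c s b x.
Proof.
move=> x0; rewrite /sym_exp /trunc_exp ger0_norm// indicE mem_setE/= in_itv/=.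
case: (leP x b) => xb; rewrite ?andbF ?mulr0// andbT.
by rewrite (_ : - b <= x) ?mulr1//; lra.
Qed.

Lemma sym_exp_setTE c s x : 0 <= x -> sym_exp setT c s x = plateau c s 0 x.
Proof.
move=> x0; rewrite /sym_exp /plateau ger0_norm// indicT mulr1 subr0.
by case: ifP => // x0'; rewrite (_ : x = 0) ?mulr0 ?oppr0 ?expR0 ?mulr1//; lra.
Qed.

Lemma itv_sym_exp_even b c s x : sym_exp `[- b, b] c s (- x) = sym_exp `[- b, b] c s x.
Proof.
apply: sym_exp_even => y /=; rewrite !in_itv/= => /andP[h1 h2]; apply/andP; split; lra.
Qed.

Lemma slc_sym_exp_itv d (T : measurableType d) (P : probability T R) (X : {RV P >-> R})
  b c s : 0 < c -> 0 <= s -> has_density X (sym_exp `[- b, b] c s) ->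
  symmetric_log_concave X (sym_exp `[- b, b] c s).
Proof.
move=> c0 s0 Xf; apply: symmetric_log_concaveI Xf _ _ _.
- exact: itv_sym_exp_even.
- apply: log_concave_sym_exp => // x y t t0 t1; rewrite /= !in_itv/=.
  move=> /andP[x1 x2] /andP[y1 y2].
  have u0 : 0 <= 1 - t by rewrite subr_ge0.
  have := ler_wpM2l t0 x1; have := ler_wpM2l t0 x2.
  have := ler_wpM2l u0 y1; have := ler_wpM2l u0 y2.
  by move=> h1 h2 h3 h4; apply/andP; split; lra.
- by apply: upper_semicontinuous_sym_exp; [exact: ltW|exact: itv_closed].
Qed.

(** By [profile_support] the standard deviation is at most [b / sqrt 3], so for [t <= sqrt 3] the
    point of evaluation lies in the support and the indicator is 1. *)
Lemma scaled_density_sym_exp_itv d (T : measurableType d) (P : probability T R)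
  (X : {RV P >-> R}) b c s t : 0 < b -> 0 < c -> 0 <= s ->
  has_density X (sym_exp `[- b, b] c s) -> 0 <= t <= Num.sqrt 3 ->
  let v := hsd (sym_exp `[- b, b] c s) in
  scaled_density X (sym_exp `[- b, b] c s) t = v * (c * expR (- (s * (t * v)))).
Proof.
move=> b0 c0 s0 Xf /andP[t0 t3] v; have slc := slc_sym_exp_itv c0 s0 Xf.
rewrite (scaled_densityE _ slc) -/v; congr (_ * _).
have v0 : 0 <= v by exact: hsd_ge0.
rewrite sym_exp_itvE ?mulr_ge0// /trunc_exp ifT//.
have : v ^+ 2 <= b ^+ 2 / 3.
  apply: (profile_support (symmetric_log_concave_profile slc)) => // x bx.
  rewrite sym_exp_itvE; last by rewrite ltW// (lt_trans b0).
  by rewrite /trunc_exp leNgt bx.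
move=> vb; rewrite -(@ler_pXn2r _ 2) ?nnegrE ?mulr_ge0 ?(ltW b0)//.
have : t ^+ 2 <= 3 by rewrite -(@sqr_sqrtr _ 3)// ler_pXn2r ?nnegrE ?sqrtr_ge0.
move=> t9; rewrite exprMn; have := ler_wpM2r (sqr_ge0 v) t9; lra.
Qed.

Lemma trunc_laplace_pdfE b : 0 < b ->
  trunc_laplace_pdf b = sym_exp `[- b, b] (1 / (2 * (1 - expR (- b)))) 1.
Proof.
by move=> b0; apply/funext => x; rewrite /trunc_laplace_pdf /sym_exp !mul1r [_^-1 * _]mulrC.
Qed.

Lemma hsd_trunc_laplace b : 0 < b -> hsd (trunc_laplace_pdf b) = trunc_laplace_sd b.
Proof.
move=> b0; have u0 := one_sub_expRN_gt0 b0.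
rewrite /hsd trunc_laplace_pdfE// (eq_hmom 2 (@sym_exp_itvE b _ _)) hmom2_trunc_exp//=.
- by congr Num.sqrt; rewrite !mul1r expr1n; field; rewrite gt_eqF.
- by rewrite divr_ge0// mulr_ge0// ltW.
- exact: ltW.
Qed.

Lemma trunc_laplace_slc d (T : measurableType d) (P : probability T R)
  (X : {RV P >-> R}) b : 0 < b -> has_density X (trunc_laplace_pdf b) ->
  symmetric_log_concave X (trunc_laplace_pdf b).
Proof.
move=> b0; have u0 := one_sub_expRN_gt0 b0; rewrite trunc_laplace_pdfE//.
by apply: slc_sym_exp_itv => //; rewrite divr_gt0// mulr_gt0.
Qed.

Lemma scaled_density_trunc_laplace d (T : measurableType d) (P : probability T R)
  (X : {RV P >-> R}) b t : 0 < b -> has_density X (trunc_laplace_pdf b) ->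
  0 <= t <= Num.sqrt 3 ->
  scaled_density X (trunc_laplace_pdf b) t = trunc_laplace_value t b.
Proof.
move=> b0 Xf t3; have u0 := one_sub_expRN_gt0 b0.
move: (hsd_trunc_laplace b0) Xf; rewrite trunc_laplace_pdfE// => hE Xf.
rewrite scaled_density_sym_exp_itv//; last by rewrite divr_gt0// mulr_gt0.
rewrite hE /trunc_laplace_value !mul1r.
by rewrite [_^-1 * _]mulrC mulrA.
Qed.

Lemma exists_sym_exp_itv b c s : 0 <= c -> hmom 0 (trunc_exp c s b) = (1 / 2)%:E ->
  exists (d : measure_display) (T : measurableType d)
    (P : probability T R) (X : {RV P >-> R}), has_density X (sym_exp `[- b, b] c s).
Proof.
move=> c0 m0; have mf : measurable_fun setT (sym_exp `[- b, b] c s).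
  by apply: measurable_sym_exp; exact: measurable_itv.
have f0 x : 0 <= sym_exp `[- b, b] c s x by exact: sym_exp_ge0.
apply: exists_density => //.
rewrite (@hmom0_even R _ mf f0 (itv_sym_exp_even b c s)).
by rewrite (eq_hmom 0 (@sym_exp_itvE b _ _)) m0 -EFinM mulrCA divff// mulr1.
Qed.

Lemma uniform_pdfE a : 0 < a -> uniform_pdf (- a) a = sym_exp `[- a, a] (1 / (2 * a)) 0.
Proof.
move=> a0; apply/funext => x; rewrite /uniform_pdf /sym_exp mul0r oppr0 expR0 mulr1.
rewrite indicE mem_setE/= in_itv/=; case: ifP => _; rewrite ?mulr0 ?mulr1//.
by rewrite opprK mul1r mulr_natl mulr2n.
Qed.

Lemma hsd_uniform a : 0 < a -> hsd (uniform_pdf (- a) a) = a / Num.sqrt 3.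
Proof.
move=> a0; have c0 : 0 <= 1 / (2 * a) by rewrite divr_ge0// mulr_ge0// ltW.
have [_ m2] := hmom_trunc_exp_uniform c0 (ltW a0).
rewrite /hsd uniform_pdfE// (eq_hmom 2 (@sym_exp_itvE a _ _)) m2/=.
rewrite (_ : 2 * _ = (a / Num.sqrt 3) ^+ 2); last first.
  by rewrite expr_div_n sqr_sqrtr//; field; rewrite gt_eqF.
by rewrite sqrtr_sqr ger0_norm// divr_ge0 ?sqrtr_ge0// ltW.
Qed.

Lemma uniform_slc a t : 0 < a -> 0 <= t <= Num.sqrt 3 ->
  exists (d : measure_display) (T : measurableType d)
    (P : probability T R) (X : {RV P >-> R}),
  symmetric_log_concave X (uniform_pdf (- a) a) /\
  scaled_density X (uniform_pdf (- a) a) t = 1 / (2 * Num.sqrt 3).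
Proof.
move=> a0 t3; have c0 : 0 < 1 / (2 * a) by rewrite divr_gt0// mulr_gt0.
have [m0 _] := hmom_trunc_exp_uniform (ltW c0) (ltW a0).
have [|d [T [P [X Xf]]]] := @exists_sym_exp_itv a (1 / (2 * a)) 0 (ltW c0).
  by rewrite m0; congr EFin; field; rewrite gt_eqF.
exists d, T, P, X; have := hsd_uniform a0; rewrite uniform_pdfE// => hE.
split; first exact: slc_sym_exp_itv Xf.
rewrite scaled_density_sym_exp_itv// hE mul0r oppr0 expR0 mulr1.
by field; rewrite !gt_eqF ?sqrtr_gt0.
Qed.

Lemma laplace_pdfE a : 0 < a -> laplace_pdf a = sym_exp setT (1 / (2 * a)) a^-1.
Proof.
move=> a0; apply/funext => x.
by rewrite /laplace_pdf /sym_exp indicT mulr1 mul1r mulrC [`|x| / a]mulrC.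
Qed.

Lemma hsd_laplace a : 0 < a -> hsd (laplace_pdf a) = Num.sqrt 2 * a.
Proof.
move=> a0; have c0 : 0 <= 1 / (2 * a) by rewrite divr_ge0// mulr_ge0// ltW.
have i0 : 0 < a^-1 by rewrite invr_gt0.
rewrite /hsd laplace_pdfE// (eq_hmom 2 (@sym_exp_setTE _ _)) hmom2_plateau//=.
rewrite (_ : 2 * _ = (Num.sqrt 2 * a) ^+ 2); last first.
  by rewrite exprMn sqr_sqrtr//; field; rewrite gt_eqF.
by rewrite sqrtr_sqr ger0_norm// mulr_ge0 ?sqrtr_ge0// ltW.
Qed.

Lemma laplace_slc a t : 0 < a -> 0 <= t ->
  exists (d : measure_display) (T : measurableType d)
    (P : probability T R) (X : {RV P >-> R}),
  symmetric_log_concave X (laplace_pdf a) /\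
  scaled_density X (laplace_pdf a) t = expR (- (t * Num.sqrt 2)) / Num.sqrt 2.
Proof.
move=> a0 t0; have c0 : 0 < 1 / (2 * a) by rewrite divr_gt0// mulr_gt0.
have i0 : 0 < a^-1 by rewrite invr_gt0.
have := hsd_laplace a0; rewrite laplace_pdfE// => hE.
set f := sym_exp _ _ _ in hE *.
have mf : measurable_fun setT f by exact: measurable_sym_exp.
have f0 x : 0 <= f x by apply: sym_exp_ge0; exact: ltW.
have ev x : f (- x) = f x by exact: sym_exp_even.
have [|d [T [P [X Xf]]]] := exists_density mf f0.
  rewrite (@hmom0_even R _ mf f0 ev) (eq_hmom 0 (@sym_exp_setTE _ _)).
  rewrite hmom0_plateau// ?(ltW c0)// -EFinM; congr EFin.
  by rewrite add0r invrK; field; rewrite gt_eqF.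
exists d, T, P, X.
have slc : symmetric_log_concave X f.
  apply: symmetric_log_concaveI Xf ev _ _.
  - by apply: log_concave_sym_exp => //; exact: ltW.
  - by apply: upper_semicontinuous_sym_exp; [exact: ltW|exact: closedT].
split => //; rewrite (scaled_densityE _ slc) hE /f /sym_exp indicT mulr1.
rewrite ger0_norm; last by rewrite !mulr_ge0 ?sqrtr_ge0// ltW.
have s0 : 0 < Num.sqrt 2 :> R by rewrite sqrtr_gt0.
have -> : a^-1 * (t * (Num.sqrt 2 * a)) = t * Num.sqrt 2 by field; rewrite gt_eqF.
transitivity (Num.sqrt 2 ^+ 2 / 2 * expR (- (t * Num.sqrt 2)) / Num.sqrt 2).
  by field; rewrite !gt_eqF.
by rewrite sqr_sqrtr// divff// mul1r.
Qed.

End members.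

(** * The infimum over the class and the final assembly *)

Section extremal_values.
Context {R : realType}.
Implicit Types (t b L : R).

Lemma slc_values_ge0 t v : slc_values t v -> 0 <= v.
Proof.
move=> [d [T [P [X [f [Xf ->]]]]]]; have [_ _ [_ f0 _] _ _] := Xf.
by rewrite /scaled_density mulr_ge0// sqrtr_ge0.
Qed.

Lemma slc_inf_le t v : slc_values t v -> slc_inf t <= v.
Proof. by move=> tv; apply: ge_inf => //; exists 0 => u /slc_values_ge0. Qed.

Lemma slc_inf_ge t M : 0 <= t <= Num.sqrt 3 ->
  (forall b, 0 < b -> M <= trunc_laplace_value t b) -> M <= slc_inf t.
Proof.
move=> t3 hM; apply: lb_le_inf.
  have [d [T [P [X [Xf _]]]]] := uniform_slc ltr01 t3.
  by eexists; exists d, T, P, X, (uniform_pdf (- 1) 1); split; first exact: Xf.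
move=> _ [d [T [P [X [f [Xf ->]]]]]]; rewrite (scaled_densityE _ Xf).
have [_ _ _ _ usc] := Xf.
exact: profile_value_ge (symmetric_log_concave_profile Xf) usc t3 hM.
Qed.

Lemma slc_inf_achieved t L f (S : exists (d : measure_display) (T : measurableType d)
    (P : probability T R) (X : {RV P >-> R}),
  symmetric_log_concave X f /\ scaled_density X f t = L) :
  slc_inf t = L -> slc_inf_achieved_by f t.
Proof. by case: S => d [T [P [X [Xf fL]]]] tL; exists d, T, P, X; rewrite fL tL. Qed.

End extremal_values.

Lemma critical_t0_numeric (R : realType) :
  1 / 2 < (critical_t0 : R) < 1 / Num.sqrt 2 /\
  `|(critical_t0 : R) - (63 * 10 ^+ 3 + 217) / 10 ^+ 5| <= 1 / (2 * 10 ^+ 5).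
Proof.
have := @critical_t0_itv R; rewrite /tau_lo /tau_hi => /andP[lo hi].
have lo' : 632 / 1000 <= (critical_t0 : R) by lra.
have hi' : (critical_t0 : R) <= 633 / 1000 by lra.
split; last by rewrite ler_norml; apply/andP; split; lra.
clear lo hi; have /andP[r1 r2] := @sqrt2_itv R.
apply/andP; split; first by apply: lt_le_trans lo'; lra.
have s2 : 0 < Num.sqrt 2 :> R by rewrite sqrtr_gt0.
by apply: (le_lt_trans hi'); rewrite (ltr_pdivlMr _ _ s2); lra.
Qed.

Theorem theorem2 (R : realType)
  (d : R -> measure_display) (T : forall b : R, measurableType (d b))
  (P : forall b : R, probability (T b) R)
  (Y : forall b : R, {RV (P b) >-> R})
  (hY : forall b : R, 0 < b -> has_density (Y b) (trunc_laplace_pdf b)) :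
  let F (t0 b : R) := scaled_density (Y b) (trunc_laplace_pdf b) t0 in
  [/\ (forall t0 : R, 0 <= t0 <= Num.sqrt 3 ->
         slc_inf t0 = inf [set F t0 b | b in `]0, +oo[]),

      (forall t0 : R, 0 <= t0 <= Num.sqrt 3 ->
         let L := expR (- (t0 * Num.sqrt 2)) / Num.sqrt 2 in
         ((F t0 b @[b --> +oo] --> L /\ slc_inf t0 = L) <->
            1 / Num.sqrt 2 <= t0 <= Num.sqrt 3) /\
         (1 / Num.sqrt 2 <= t0 <= Num.sqrt 3 ->
            forall a : R, 0 < a -> slc_inf_achieved_by (laplace_pdf a) t0)) &

      exists c0 : R,
        [/\ 1 / 2 < c0 < 1 / Num.sqrt 2,
            (forall t0 : R, 0 <= t0 <= Num.sqrt 3 ->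
               let L := 1 / (2 * Num.sqrt 3) in
               ((F t0 b @[b --> 0^'+] --> L /\ slc_inf t0 = L) <->
                  0 <= t0 <= c0) /\
               (0 <= t0 <= c0 ->
                  forall a : R, 0 < a ->
                    slc_inf_achieved_by (uniform_pdf (- a) a) t0)),
            (forall b : R, 0 < b -> 0 < trunc_laplace_sd b),
            c0 = inf [set (trunc_laplace_sd b)^-1 *
                          ln (Num.sqrt 3 * trunc_laplace_sd b / (1 - expR (- b)))
                     | b in `]0, +oo[] &
            `|c0 - (63 * 10 ^+ 3 + 217) / 10 ^+ 5| <= 1 / (2 * 10 ^+ 5)]].
Proof.
move=> F.
have FE (t b : R) : 0 <= t <= Num.sqrt 3 -> 0 < b -> F t b = trunc_laplace_value t b.
  by move=> t3 b0; apply: scaled_density_trunc_laplace => //; exact: hY.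
have Fv (t b : R) : 0 <= t <= Num.sqrt 3 -> 0 < b -> slc_values t (F t b).
  move=> t3 b0; exists (d b), (T b), (P b), (Y b), (trunc_laplace_pdf b).
  by split=> //; apply: trunc_laplace_slc => //; exact: hY.
have le_value (t b : R) : 0 <= t <= Num.sqrt 3 -> 0 < b -> slc_inf t <= trunc_laplace_value t b.
  by move=> t3 b0; rewrite -FE//; apply: slc_inf_le; exact: Fv.
have laplace_le (t a : R) : 0 <= t <= Num.sqrt 3 -> 0 < a ->
    slc_inf t <= expR (- (t * Num.sqrt 2)) / Num.sqrt 2.
  move=> /andP[t0 t3] a0; have [d' [T' [P' [X [Xf <-]]]]] := laplace_slc a0 t0.
  by apply: slc_inf_le; exists d', T', P', X, (laplace_pdf a).
have uniform_le (t a : R) : 0 <= t <= Num.sqrt 3 -> 0 < a ->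
    slc_inf t <= 1 / (2 * Num.sqrt 3).
  move=> t3 a0; have [d' [T' [P' [X [Xf <-]]]]] := uniform_slc a0 t3.
  by apply: slc_inf_le; exists d', T', P', X, (uniform_pdf (- a) a).
split.
- move=> t t3; apply/le_anti/andP; split.
    apply: lb_le_inf; first by exists (F t 1), 1 => //=; rewrite in_itv/= ltr01.
    by move=> _ [b + <-]; rewrite /= in_itv/= andbT => b0; rewrite FE// le_value.
  apply: slc_inf_ge => // b b0; rewrite -FE//; apply: ge_inf.
    exists 0 => _ [c + <-]; rewrite /= in_itv/= andbT => c0.
    exact: slc_values_ge0 (Fv _ _ t3 c0).
  by exists b => //=; rewrite in_itv/= b0.
- move=> t t3 L.
  have infE : 1 / Num.sqrt 2 <= t <= Num.sqrt 3 -> slc_inf t = L.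
    move=> /andP[t1 _]; apply/le_anti; rewrite (laplace_le t 1)//=.
    by apply: slc_inf_ge => // b b0; exact: trunc_laplace_value_ge_laplace.
  split; last first.
    move=> ht a a0; apply: slc_inf_achieved (infE ht).
    by apply: laplace_slc => //; case/andP: t3.
  split=> [[_ hinf]|ht]; last first.
    split; last exact: infE.
    apply: cvg_trans (@trunc_laplace_value_cvgy R t).
    apply: near_eq_cvg; near=> b; rewrite -FE//.
  (* Below [1 / sqrt 2] some member of the family lies strictly under its limit, which rules out the
     value of the infimum. *)
  have /andP[t0 ->] := t3; rewrite andbT leNgt; apply/negP => t1.
  have [b b0] := trunc_laplace_value_lt_laplace t0 t1.
  by rewrite ltNge -/L -hinf le_value.
- have [c_itv c_near] := critical_t0_numeric R.
  exists critical_t0; split => //; last exact: trunc_laplace_sd_gt0.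
  move=> t t3 L; have /andP[t0 _] := t3.
  have infE : 0 <= t <= critical_t0 -> slc_inf t = L.
    move=> /andP[_ tc]; apply/le_anti; rewrite (uniform_le t 1)//=.
    apply: slc_inf_ge => // b b0; rewrite /L trunc_laplace_value_uniform//.
    by apply/asboolP; exact: (proj1 (le_critical_t0 t) tc).
  split; last first.
    by move=> ht a a0; apply: slc_inf_achieved (infE ht); exact: uniform_slc.
  split=> [[_ hinf]|ht]; last first.
    split; last exact: infE.
    apply: cvg_trans (trunc_laplace_value_cvg0 t0).
    by apply: near_eq_cvg; near=> b; rewrite -FE.
  (* An infimum equal to the uniform value keeps every [Y_b] at or above it, which is the
     description of [t <= critical_t0]. *)
  rewrite t0/=; apply/le_critical_t0 => b b0; apply/asboolP.
  by rewrite -trunc_laplace_value_uniform// -/L -hinf le_value.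
Unshelve. all: by end_near.
Qed.
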